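(* Let $\Lambda$ be an artin algebra with a fixed complete set $\Delta$ of primitive orthogonal idempotents. Let $\mathfrak{M}$ be the set of torsion pairs on $\Lambda\text{-mod}$, and let $\mathfrak{N}$ be the set of pairs $(S,(\mathcal{T}',\mathcal{F}'))$ where $S=\{\Delta_0,\Delta_1,\dots,\Delta_m\}$ is a 1-type part partition and $(\mathcal{T}',\mathcal{F}')\in\mathbf{E}(\Lambda_S^{m+1})$. There is a one-to-one correspondence between $\mathfrak{M}$ and $\mathfrak{N}$, given by the mutually inverse maps $F:\mathfrak{M}\to\mathfrak{N}$ and $G:\mathfrak{N}\to\mathfrak{M}$ described in the context.
   Context: Modules are finitely generated left modules; $D$ is the standard duality; $\mathrm{add}\,M$ is the category of direct summands of finite direct sums of copies of $M$. A torsion pair on $\Gamma\text{-mod}$ is a pair $(\mathcal{T},\mathcal{F})$ of full (isomorphism-closed) subcategories with $\mathrm{Hom}(X,Y)=0$ for $X\in\mathcal{T},Y\in\mathcal{F}$ and such that every module $X$ has an exact sequence $0\to X_{\mathcal{T}}\to X\to X_{\mathcal{F}}\to0$ with $X_{\mathcal T}\in\mathcal T,X_{\mathcal F}\in\mathcal F$. $\mathcal{P}(\Gamma)$, $\mathcal{I}(\Gamma)$ are the categories of projective, injective modules in $\Gamma\text{-mod}$. $\mathbf{E}(\Gamma)$ is the set of torsion pairs $(\mathcal{T},\mathcal{F})$ on $\Gamma\text{-mod}$ such that $\mathcal{T}\cap\mathcal{P}(\Gamma)$ and $\mathcal{F}\cap\mathcal{I}(\Gamma)$ contain no nonzero module.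 $\langle\cdots\rangle$ denotes the smallest full extension-closed subcategory of $\Lambda\text{-mod}$ containing the given ones; $\mathcal D^\bot=\{N\mid\mathrm{Hom}(M,N)=0\ \forall M\in\mathcal D\}$ and ${}^\bot\mathcal D=\{M\mid\mathrm{Hom}(M,N)=0\ \forall N\in\mathcal D\}$. $\mathrm{Gen}$, $\mathrm{Cogen}$ of a module denote the categories of quotients, respectively submodules, of finite direct sums of copies of it. Given $S=\{\Delta_0,\dots,\Delta_m\}$ consisting of pairwise disjoint subsets of $\Delta$ with $\Delta_1,\dots,\Delta_m\neq\emptyset$ ($\Delta_0$ may be empty), put $e_S^i=\sum_{e\in\Delta_i}e$, $\varepsilon_S^i=\sum_{j=0}^i e_S^j$, $\Lambda_S^0=\Lambda$, $\Lambda_S^{i+1}=\Lambda_S^i/\Lambda_S^ie_S^i\Lambda_S^i=\Lambda/\Lambda\varepsilon_S^i\Lambda$ for $0\le i\le m$, $\mathrm{P}_i(\Lambda_S^i)=\bigoplus_{e\in\Delta_i}\Lambda_S^ie$, $\mathrm{I}_i(\Lambda_S^i)=\bigoplus_{e\in\Delta_i}D(e\Lambda_S^i)$. Modules over quotients of $\Lambda$ are viewed as $\Lambda$-modules. $S$ is a 1-type part partition if (1) for all $0<2i\le m$ and $e\in\Delta_{2i}$, $e_S^{2i-1}\Lambda_S^{2i-1}e\ne0$; (2) for all $1<2i+1\le m$ and $e\in\Delta_{2i+1}$, $e\Lambda_S^{2i}e_S^{2i}\neq0$. Map $F$: given $(\mathcal{T},\mathcal{F})$, put $\mathcal{T}^0=\mathcal{T}$,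 $\mathcal{F}^0=\mathcal{F}$, $\Lambda^0=\Lambda$. At stage $i$, given a torsion pair $(\mathcal{T}^i,\mathcal{F}^i)$ on $\Lambda^i\text{-mod}$: if $i$ is even, there is some $\Delta_i\subseteq\Delta\setminus(\Delta_0\cup\dots\cup\Delta_{i-1})$ with $\mathcal{T}^i\cap\mathcal{P}(\Lambda^i)=\mathrm{add}\bigoplus_{e\in\Delta_i}\Lambda^ie$, and one puts $\mathcal{T}^{i+1}=\mathcal{T}^i\cap(\bigoplus_{e\in\Delta_i}\Lambda^ie)^\bot$, $\mathcal{F}^{i+1}=\mathcal{F}^i$; if $i$ is odd, there is some such $\Delta_i$ with $\mathcal{F}^i\cap\mathcal{I}(\Lambda^i)=\mathrm{add}\bigoplus_{e\in\Delta_i}D(e\Lambda^i)$, and one puts $\mathcal{T}^{i+1}=\mathcal{T}^i$, $\mathcal{F}^{i+1}=\mathcal{F}^i\cap{}^\bot(\bigoplus_{e\in\Delta_i}D(e\Lambda^i))$; and $\Lambda^{i+1}=\Lambda/\Lambda\varepsilon\Lambda$ with $\varepsilon=\sum_{e\in\Delta_0\cup\dots\cup\Delta_i}e$. Stage $0$ is always performed; the procedure, which terminates because $\Delta$ is finite, stops after the first stage $m$ with $(\mathcal{T}^{m+1},\mathcal{F}^{m+1})\in\mathbf{E}(\Lambda^{m+1})$. Then $F((\mathcal{T},\mathcal{F}))=(\{\Delta_0,\dots,\Delta_m\},(\mathcal{T}^{m+1},\mathcal{F}^{m+1}))$. Map $G$: $G((S,(\mathcal{T}',\mathcal{F}')))=(\langle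 \mathrm{Gen}\,\mathrm{P}_0(\Lambda_S^0),\mathrm{Gen}\,\mathrm{P}_2(\Lambda_S^2),\dots,\mathcal{T}'\rangle,\ \langle\mathcal{F}',\dots,\mathrm{Cogen}\,\mathrm{I}_3(\Lambda_S^3),\mathrm{Cogen}\,\mathrm{I}_1(\Lambda_S^1)\rangle)$, where the even indices and odd indices run up to $m$.
   Formalization: Λ is additionally assumed basic (Λe ≅ Λe′ for e, e′ in Δ only if e = e′); otherwise Δ_i is not determined and the claim fails, e.g. for M_2(k) with Δ = {E11, E22}. *)

(* Defs.v *)
From HB Require Import structures.
From mathcomp Require Import all_boot all_algebra generic_quotient ring_quotient.
From mathcomp Require Import boolp functions.

Set Implicit Arguments.
Unset Strict Implicit.
Unset Printing Implicit Defensive.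

Import GRing.Theory.
Local Open Scope ring_scope.
Local Open Scope quotient_scope.

(* A right A-module is a left module over the converse ring [A^c]; A as a      *)
(* module over itself is [A^o].                                                *)

Section QuotientModule.
Context (A : pzRingType) (V : lmodType A) (N : submodClosed V).

Definition quotmod_pred : {pred V} := fun x => x \in N.

Fact quotmod_pred_zmod : zmod_closed quotmod_pred.
Proof.
split=> [|x y xN yN]; first exact: (rpred0 N).
by rewrite -scaleN1r; apply: (@rpredD V N) => //; apply: (@rpredZ A V N).
Qed.

HB.instance Definition _ :=
  GRing.isZmodClosed.Build V quotmod_pred quotmod_pred_zmod.

Definition quotmod : Type := Quotient.quot quotmod_pred.

HB.instance Definition _ := GRing.Zmodule.on quotmod.
HB.instance Definition _ := EqQuotient.on quotmod.

Definition quotmod_scale (a : A) (x : quotmod) : quotmod :=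
  \pi_quotmod (a *: repr x).

Lemma quotmod_piP (x y : V) : \pi_quotmod x = \pi_quotmod y <-> x - y \in N.
Proof.
rewrite -[x - y \in N]/(x - y \in quotmod_pred) Quotient.idealrBE.
by split=> [/eqP|/eqP].
Qed.

Lemma quotmod_scaleE a (x : V) :
  quotmod_scale a (\pi_quotmod x) = \pi_quotmod (a *: x).
Proof.
apply/quotmod_piP; rewrite -scalerBr; apply: (@rpredZ A V N).
by apply/quotmod_piP; rewrite reprK.
Qed.

Lemma quotmod_piD (x y : V) :
  \pi_quotmod (x + y) = \pi_quotmod x + \pi_quotmod y.
Proof. exact: Quotient.pi_add. Qed.

Fact quotmod_scalerA a b x :
  quotmod_scale a (quotmod_scale b x) = quotmod_scale (a * b) x.
Proof. by elim/quotW: x => x; rewrite (quotmod_scaleE b) !quotmod_scaleE scalerA. Qed.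

Fact quotmod_scale1r : left_id 1 quotmod_scale.
Proof. by elim/quotW => x; rewrite quotmod_scaleE scale1r. Qed.

Fact quotmod_scalerDr : right_distributive quotmod_scale +%R.
Proof.
move=> a; elim/quotW => x; elim/quotW => y.
by rewrite -quotmod_piD !quotmod_scaleE scalerDr quotmod_piD.
Qed.

Fact quotmod_scalerDl x : {morph quotmod_scale^~ x : a b / a + b}.
Proof.
by elim/quotW: x => x a b /=; rewrite !quotmod_scaleE scalerDl quotmod_piD.
Qed.

HB.instance Definition _ := GRing.Zmodule_isLmodule.Build A quotmod
  quotmod_scalerA quotmod_scale1r quotmod_scalerDr quotmod_scalerDl.

End QuotientModule.

Section CyclicSubmodule.
Context (A : pzRingType) (V : lmodType A) (x : V).

Definition cyclic_pred : {pred V} := fun y => `[< exists a : A, y = a *: x >].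

Fact cyclic_pred_submod : submod_closed cyclic_pred.
Proof.
split; first by apply/asboolP; exists 0; rewrite scale0r.
move=> a _ _ /asboolP[b ->] /asboolP[c ->]; apply/asboolP.
by exists (a * b + c); rewrite scalerDl scalerA.
Qed.

HB.instance Definition _ :=
  GRing.isSubmodClosed.Build A V cyclic_pred cyclic_pred_submod.

Record cyclic : Type := Cyclic { cyclic_val : V; _ : cyclic_val \in cyclic_pred }.

HB.instance Definition _ := [isSub for cyclic_val].
HB.instance Definition _ := [Choice of cyclic by <:].
HB.instance Definition _ := [SubChoice_isSubLmodule of cyclic by <:].

End CyclicSubmodule.

Section DirectSum.
Context (A : pzRingType) (I : finType) (M : I -> lmodType A).

Definition dsum : Type := {dffun forall i : I, M i}.

HB.instance Definition _ := Choice.on dsum.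

Definition dsum_zero : dsum := [ffun i => 0].
Definition dsum_opp (f : dsum) : dsum := [ffun i => - f i].
Definition dsum_add (f g : dsum) : dsum := [ffun i => f i + g i].
Definition dsum_scale (a : A) (f : dsum) : dsum := [ffun i => a *: f i].

Fact dsum_addA : associative dsum_add.
Proof. by move=> f g h; apply/ffunP => i; rewrite !ffunE addrA. Qed.
Fact dsum_addC : commutative dsum_add.
Proof. by move=> f g; apply/ffunP => i; rewrite !ffunE addrC. Qed.
Fact dsum_add0 : left_id dsum_zero dsum_add.
Proof. by move=> f; apply/ffunP => i; rewrite !ffunE add0r. Qed.
Fact dsum_addN : left_inverse dsum_zero dsum_opp dsum_add.
Proof. by move=> f; apply/ffunP => i; rewrite !ffunE addNr. Qed.

HB.instance Definition _ :=
  GRing.isZmodule.Build dsum dsum_addA dsum_addC dsum_add0 dsum_addN.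

Fact dsum_scalerA a b f : dsum_scale a (dsum_scale b f) = dsum_scale (a * b) f.
Proof. by apply/ffunP => i; rewrite !ffunE scalerA. Qed.
Fact dsum_scale1 : left_id 1 dsum_scale.
Proof. by move=> f; apply/ffunP => i; rewrite !ffunE scale1r. Qed.
Fact dsum_scaleDr : right_distributive dsum_scale +%R.
Proof. by move=> a f g; apply/ffunP => i; rewrite !ffunE scalerDr. Qed.
Fact dsum_scaleDl f : {morph dsum_scale^~ f : a b / a + b}.
Proof. by move=> a b; apply/ffunP => i; rewrite !ffunE scalerDl. Qed.

HB.instance Definition _ := GRing.Zmodule_isLmodule.Build A dsum
  dsum_scalerA dsum_scale1 dsum_scaleDr dsum_scaleDl.

End DirectSum.

(* Full subcategories of the category of all left A-modules. *)
Definition subcat (A : pzRingType) := lmodType A -> Prop.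

Section Modules.
Context (A : pzRingType).
Implicit Types (M N X Y : lmodType A) (C : subcat A).

Definition fin_gen M : Prop :=
  exists (n : nat) (g : 'I_n -> M), forall x : M,
    exists c : 'I_n -> A, x = \sum_(i < n) c i *: g i.

Definition zero_module M : Prop := forall x : M, x = 0.

Definition iso M N : Prop := exists f : {linear M -> N}, bijective f.

Definition surjective_map (U W : Type) (f : U -> W) : Prop :=
  forall y, exists x, f x = y.

Definition hom_zero M N : Prop := forall (f : {linear M -> N}) (x : M), f x = 0.

(* There is an exact sequence 0 -> X -> M -> Y -> 0. *)
Definition short_exact X M Y : Prop :=
  exists (f : {linear X -> M}) (g : {linear M -> Y}),
    [/\ injective f, surjective_map g &
        forall y : M, g y = 0 <-> exists x : X, y = f x].

Definition projective_in C M : Prop :=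
  C M /\ forall X Y (p : {linear X -> Y}) (g : {linear M -> Y}),
    C X -> C Y -> surjective_map p ->
    exists h : {linear M -> X}, forall x, p (h x) = g x.

Definition injective_in C M : Prop :=
  C M /\ forall X Y (i : {linear X -> Y}) (g : {linear X -> M}),
    C X -> C Y -> injective i ->
    exists h : {linear Y -> M}, forall x, h (i x) = g x.

Definition add M : subcat A := fun X =>
  exists (n : nat) (Y : lmodType A), iso (X * Y)%type {ffun 'I_n -> M}.

Definition Gen M : subcat A := fun X =>
  fin_gen X /\
  exists (n : nat) (p : {linear {ffun 'I_n -> M} -> X}), surjective_map p.

Definition Cogen M : subcat A := fun X =>
  fin_gen X /\
  exists (n : nat) (i : {linear X -> {ffun 'I_n -> M}}), injective i.

(* The smallest extension-closed full subcategory containing C.  It consists   *)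
(* of finitely generated modules when C does, and is closed under isomorphism  *)
(* when C contains a zero module.                                              *)
Inductive ext_closure C : subcat A :=
| ext_incl X : C X -> ext_closure C X
| ext_ext X M Y : ext_closure C X -> ext_closure C Y ->
    short_exact X M Y -> ext_closure C M.

Definition artinian_module M : Prop :=
  forall N : nat -> submodClosed M,
    (forall n, {subset N n.+1 <= N n}) ->
    exists n, forall m, (n <= m)%N -> N m =i N n.

Definition injective_envelope M N : Prop :=
  injective_in (fun=> True) N /\
  exists i : {linear M -> N}, injective i /\
    forall K : submodClosed N, (exists2 y, y \in K & y != 0) ->
      exists2 x : M, i x \in K & i x != 0.

End Modules.

Section Jacobson.
Context (R : comNzRingType).

Definition maximal_ideal (N : submodClosed R^o) : Prop :=
  1 \notin N /\ forall N' : submodClosed R^o,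
    {subset N <= N'} -> 1 \in N' \/ {subset N' <= N}.

Definition jacobson : {pred R^o} := fun x =>
  `[< forall N : submodClosed R^o, maximal_ideal N -> x \in N >].

Fact jacobson_submod : submod_closed jacobson.
Proof.
split; first by apply/asboolP => N _; rewrite rpred0.
move=> a x y /asboolP hx /asboolP hy; apply/asboolP => N hN.
by rewrite rpredD ?rpredZ ?hx ?hy.
Qed.

HB.instance Definition _ :=
  GRing.isSubmodClosed.Build R R^o jacobson jacobson_submod.

(* R / rad R *)
Definition semisimple_quotient : lmodType R := quotmod jacobson.

End Jacobson.

Definition artin_algebra (R : comNzRingType) (L : algType R) : Prop :=
  artinian_module R^o /\ fin_gen (L : lmodType R).

(* The duality D = Hom_R(-, J), from right to left modules. *)
Section Duality.
Context (R : comNzRingType) (L : algType R) (J : lmodType R) (N : lmodType L^c).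

(* R acts on the right L-module N by r x = x (r 1_L). *)
Definition dual_pred : {pred N -> J} := fun f =>
  `[< forall (r : R) (x y : N), f (((r%:A : L) : L^c) *: x + y) = r *: f x + f y >].

Fact dual_pred_zmod : zmod_closed dual_pred.
Proof.
split; first by apply/asboolP => r x y; rewrite -[RHS]/(r *: 0 + 0) scaler0 addr0.
move=> f g /asboolP hf /asboolP hg; apply/asboolP => r x y.
rewrite -[LHS]/(f _ - g _) -[RHS]/(r *: (f x - g x) + (f y - g y)).
by rewrite hf hg scalerBr opprD addrACA.
Qed.

HB.instance Definition _ :=
  GRing.isZmodClosed.Build (N -> J) dual_pred dual_pred_zmod.

Record dual : Type := Dual { dual_fun : N -> J; _ : dual_fun \in dual_pred }.

HB.instance Definition _ := [isSub for dual_fun].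
HB.instance Definition _ := [Choice of dual by <:].
HB.instance Definition _ := [SubChoice_isSubZmodule of dual by <:].

Fact dual_scale_subproof (a : L) (f : dual) :
  (fun x : N => dual_fun f ((a : L^c) *: x)) \in dual_pred.
Proof.
case: f => f /= /asboolP hf; apply/asboolP => r x y.
rewrite scalerDr -hf !scalerA; congr (f (_ *: _ + _)).
by rewrite -[LHS]/((r%:A : L) * a) -[RHS]/(a * r%:A) mulr_algl mulr_algr.
Qed.

(* (a f)(x) = f (x a) *)
Definition dual_scale (a : L) (f : dual) : dual := Dual (dual_scale_subproof a f).

Fact dual_scalerA a b f : dual_scale a (dual_scale b f) = dual_scale (a * b) f.
Proof. by apply: val_inj; apply: funext => x /=; rewrite scalerA. Qed.

Fact dual_scale1 : left_id 1 dual_scale.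
Proof. by move=> f; apply: val_inj; apply: funext => x /=; rewrite scale1r. Qed.

Fact dual_scaleDr : right_distributive dual_scale +%R.
Proof. by move=> a f g; apply: val_inj. Qed.

Fact dual_scaleDl f : {morph dual_scale^~ f : a b / a + b}.
Proof.
move=> a b; apply: val_inj; apply: funext => x /=.
case: f => f fP; have /asboolP hf := fP.
have := hf 1 ((a : L^c) *: x) ((b : L^c) *: x).
by rewrite !scale1r -scalerDl.
Qed.

HB.instance Definition _ := GRing.Zmodule_isLmodule.Build L dual
  dual_scalerA dual_scale1 dual_scaleDr dual_scaleDl.

End Duality.

(* Modules over the factor ring A / A eps A are the A-modules annihilated by   *)
(* A eps A, so the (possibly trivial) factor ring itself is never formed.      *)
Section FactorRing.
Context (A : nzRingType).
Implicit Types (eps x : A).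

(* The two-sided ideal A eps A. *)
Definition ideal eps : {pred A^o} := fun y =>
  `[< exists (n : nat) (a b : 'I_n -> A), y = \sum_(i < n) a i * eps * b i >].

Fact ideal_submod eps : submod_closed (ideal eps).
Proof.
split.
  by apply/asboolP; exists 0%N, (fun=> 0), (fun=> 0); rewrite big_ord0.
move=> c _ _ /asboolP[n [a [b ->]]] /asboolP[m [a' [b' ->]]]; apply/asboolP.
pose u i := match @fintype.split n m i with inl j => c * a j | inr j => a' j end.
pose w i := match @fintype.split n m i with inl j => b j | inr j => b' j end.
exists (n + m)%N, u, w; rewrite big_split_ord /= scaler_sumr.
congr (_ + _); apply: eq_bigr => i _; rewrite /u /w.
  by rewrite (unsplitK (inl i)) -!mulrA.
by rewrite (unsplitK (inr i)).
Qed.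

HB.instance Definition _ eps :=
  GRing.isSubmodClosed.Build A A^o (ideal eps) (@ideal_submod eps).

(* (A / A eps A) x as a left A-module. *)
Definition principal eps x : lmodType A :=
  cyclic (\pi_(quotmod (ideal eps)) (x : A^o)).

(* All modules, resp. the finitely generated modules, over A / A eps A. *)
Definition Mod eps : subcat A := fun M =>
  forall (a : A) (x : M), a \in ideal eps -> a *: x = 0.

Definition fgmod eps : subcat A := fun M => Mod eps M /\ fin_gen M.

Definition projectives eps : subcat A := fun M =>
  fin_gen M /\ projective_in (Mod eps) M.

Definition injectives eps : subcat A := fun M =>
  fin_gen M /\ injective_in (Mod eps) M.

Definition subcat_pair := (subcat A * subcat A)%type.

(* Torsion pairs on the category of finitely generated A / A eps A-modules. *)
Definition torsion_pair eps (tf : subcat_pair) : Prop :=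
  let: (T, F) := tf in
  [/\ (forall X, T X -> fgmod eps X) /\ (forall X, F X -> fgmod eps X),
      (forall X Y, iso X Y -> T X -> T Y) /\ (forall X Y, iso X Y -> F X -> F Y),
      forall X Y, T X -> F Y -> hom_zero X Y &
      forall X, fgmod eps X ->
        exists U W : lmodType A, [/\ T U, F W & short_exact U X W]].

(* The set E(A / A eps A). *)
Definition torsion_pair_E eps (tf : subcat_pair) : Prop :=
  [/\ torsion_pair eps tf,
      forall X, tf.1 X -> projectives eps X -> zero_module X &
      forall X, tf.2 X -> injectives eps X -> zero_module X].

End FactorRing.

Section Idempotents.
Context (A : nzRingType) (I : finType) (e : I -> A).

Definition idempotent_elt (x : A) : Prop := x * x = x.

Definition primitive_idempotent (x : A) : Prop :=
  [/\ idempotent_elt x, x <> 0 &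
      forall y z : A, idempotent_elt y -> idempotent_elt z ->
        y * z = 0 -> z * y = 0 -> x = y + z -> y = 0 \/ z = 0].

Definition complete_primitive_orthogonal : Prop :=
  [/\ forall i, primitive_idempotent (e i),
      forall i j, i != j -> e i * e j = 0 &
      \sum_i e i = 1].

(* For a complete set of primitive orthogonal idempotents this says that A is  *)
(* basic.                                                                      *)
Definition basic_idempotents : Prop :=
  forall i j, iso (cyclic (e i : A^o)) (cyclic (e j : A^o)) -> i = j.

End Idempotents.

(* The set Delta is the family e : I -> L, its subsets are given by their sets *)
(* of indices, and S = {Delta_0, ..., Delta_m} is the sequence of length m.+1  *)
(* with entries Delta_i = nth set0 S i.  The ring Lambda_S^i is then           *)
(* L / L (eps (take i S)) L.                                                   *)
Section Correspondence.
Context (R : comNzRingType) (L : algType R) (J : lmodType R).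
Context (I : finType) (e : I -> L).
Implicit Types (S : seq {set I}) (D : {set I}) (tf : subcat_pair L).

Definition idem_sum D : L := \sum_(j in D) e j.

Definition eps S : L := \sum_(D <- S) idem_sum D.

(* The direct sum over j in D of the Gamma e_j, resp. of the D(e_j Gamma),     *)
(* where Gamma = L / L x L.  The ideal generated by x is the same in L and in  *)
(* L^c, so e_j Gamma is [principal] over L^c.                                  *)
Definition proj_sum (x : L) D : lmodType L :=
  dsum (fun j : {j : I | j \in D} => principal x (e (val j)) : lmodType L).

Definition inj_sum (x : L) D : lmodType L :=
  dsum (fun j : {j : I | j \in D} =>
          dual J (principal (x : L^c) (e (val j) : L^c)) : lmodType L).

Definition part_partition S : Prop :=
  [/\ (0 < size S)%N,
      forall i j, (i < j < size S)%N -> [disjoint nth set0 S i & nth set0 S j] &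
      forall i, (0 < i < size S)%N -> nth set0 S i != set0].

Definition type1_part_partition S : Prop :=
  [/\ part_partition S,
      forall i, (0 < i.*2 < size S)%N -> forall j, j \in nth set0 S i.*2 ->
        exists a : L, idem_sum (nth set0 S i.*2.-1) * a * e j
                        \notin ideal (eps (take i.*2.-1 S)) &
      forall i, (1 < i.*2.+1 < size S)%N -> forall j, j \in nth set0 S i.*2.+1 ->
        exists a : L, e j * a * idem_sum (nth set0 S i.*2)
                        \notin ideal (eps (take i.*2 S))].

(* At stage i = size S, where S = [:: Delta_0; ...; Delta_(i-1)], D is an      *)
(* admissible choice of Delta_i.                                               *)
Definition stage_choice S tf D : Prop :=
  [disjoint D & \bigcup_(D' <- S) D'] /\
  if odd (size S) then
    forall X, tf.2 X /\ injectives (eps S) X <-> add (inj_sum (eps S) D) X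
  else
    forall X, tf.1 X /\ projectives (eps S) X <-> add (proj_sum (eps S) D) X.

Definition stage_next S tf D : subcat_pair L :=
  if odd (size S) then
    (tf.1, fun X => tf.2 X /\ hom_zero X (inj_sum (eps S) D))
  else
    (fun X => tf.1 X /\ hom_zero (proj_sum (eps S) D) X, tf.2).

(* Performing the stages 0, ..., i-1 from tf0 yields S = [:: Delta_0; ...;     *)
(* Delta_(i-1)] and the pair (T^i, F^i).  A further stage is performed only if *)
(* none was performed yet or this pair is not in E(Lambda^i).                  *)
Inductive F_stages (tf0 : subcat_pair L) : seq {set I} -> subcat_pair L -> Prop :=
| F_start : F_stages tf0 [::] tf0
| F_stage S tf D :
    F_stages tf0 S tf ->
    torsion_pair (eps S) tf ->
    (S != [::] -> ~ torsion_pair_E (eps S) tf) ->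
    stage_choice S tf D ->
    F_stages tf0 (rcons S D) (stage_next S tf D).

Definition F_graph (tf : subcat_pair L) (y : seq {set I} * subcat_pair L) : Prop :=
  [/\ y.1 != [::], F_stages tf y.1 y.2 & torsion_pair_E (eps y.1) y.2].

Definition G_map (y : seq {set I} * subcat_pair L) : subcat_pair L :=
  let D i := nth set0 y.1 i in
  let x i := eps (take i y.1) in
  (ext_closure (fun X => y.2.1 X \/ exists i,
     [/\ (i < size y.1)%N, ~~ odd i & Gen (proj_sum (x i) (D i)) X]),
   ext_closure (fun X => y.2.2 X \/ exists i,
     [/\ (i < size y.1)%N, odd i & Cogen (inj_sum (x i) (D i)) X])).

(* L-mod is the case eps = 0. *)
Definition setM : Type := {tf : subcat_pair L | torsion_pair 0 tf}.

Definition setN : Type :=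
  {y : seq {set I} * subcat_pair L |
     type1_part_partition y.1 /\ torsion_pair_E (eps y.1) y.2}.

End Correspondence.

(* Main.v *)
Require Import Defs.
From HB Require Import structures.
From mathcomp Require Import all_boot all_algebra generic_quotient.
From mathcomp Require Import boolp.

(* For a set U of indices let x be the sum of the idempotents in U, and        *)
(* consider torsion pairs (T, F) on the modules over L / L x L, that is, on    *)
(* the modules killed by the e_j, j in U.  Let P_k = (L / L x L) e_k and       *)
(* I_k = D(e_k (L / L x L)).  Since T is the left perpendicular of F and F the *)
(* right perpendicular of T, the projective P_k lies in T iff                  *)
(* e_k kills F, and the injective I_k lies in F iff e_k kills T.  Moreover a   *)
(* projective of T is a sum of P_k's lying in T (and dually).  Hence a stage   *)
(* of the procedure depends only on the supports of T and F: at an even stage  *)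
(* Delta_i is the set of k outside U with e_k F = 0, at an odd stage the set   *)
(* of k outside U with e_k T = 0, and (T, F) is in E iff T and F both have     *)
(* full support off U.  After an even stage F has full support, after an odd   *)
(* stage T does, which gives the conditions on the type.  Conversely a stage   *)
(* is undone by replacing T (resp. F) by the perpendicular of F (resp. T) over *)
(* the larger ring, and the conditions on the type say exactly that the next   *)
(* stage removes the prescribed idempotents.  Finally a module in T is an      *)
(* extension of a module without maps from the P_k, k in Delta_i, by a module  *)
(* generated by them, whence the formula for G.                                *)

(** The passage to supports rests on two facts about a module X over L / L x L: Hom(P_k, X) is e_k
    X, and Hom(X, I_k) vanishes exactly when e_k X does ([iproj_hom0], [iinj_hom0]). With the
    description of the projectives in T and of the injectives in F ([projective_torsion_add],
    [injective_torsion_free_add]) they yield [torsion_choiceP], [torsion_free_choiceP] and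
    [torsion_pair_EP]. Hence each stage is deterministic ([stage_choiceP]).

    The correspondence is then two inductions. Forwards, [F_stages_spec] maintains that the class
    left unchanged by the last stage has full support off the removed indices; this makes later
    Delta_i nonempty and, through [link_even] and [link_odd], gives the type. Backwards,
    [F_stages_backward] reads S from its end, and [back_even_full] and [back_odd_full] use the type
    to restore the same invariant, so F is onto. [F_stages_G] recovers the initial pair of any run
    by the formula for G, so F is injective with inverse G.

    The algebra underneath: R is noetherian and J is finitely generated ([noetherian_ring],
    [envelope_fin_gen]), so finitely generated L-modules satisfy both chain conditions, and minimal
    or maximal submodules replace arguments by length. Fitting's lemma makes e L e local for e
    primitive; for a basic algebra this gives [idem_not_in_ideal], so P_k and I_k survive in every
    quotient that does not remove e_k. Finally I_k has a simple socle ([coinduced_uniform]), the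
    dual of P_k being local. *)

Set Implicit Arguments.
Unset Strict Implicit.
Unset Printing Implicit Defensive.

Import GRing.Theory.
Local Open Scope ring_scope.

(** * Submodules and linear maps *)

Section LinearMaps.
Context (A : pzRingType).
Implicit Types (U V W : lmodType A).

Definition mklin U V (f : U -> V) (hf : linear f) : {linear U -> V} :=
  HB.pack_for {linear U -> V} f (GRing.isLinear.Build A U V _ f hf).

(** Submodules are predicates in Prop, so that arbitrary conditions define them and equal ones can
    be identified by extensionality; [submod_of] converts back when a quotient or a type of elements
    is formed. *)
Definition is_submod V (N : V -> Prop) : Prop :=
  N 0 /\ forall a x y, N x -> N y -> N (a *: x + y).

Lemma submodD V (N : V -> Prop) x y : is_submod N -> N x -> N y -> N (x + y).
Proof. by case=> _ h Nx Ny; rewrite -[x]scale1r; apply: h. Qed.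

Lemma submodZ V (N : V -> Prop) a x : is_submod N -> N x -> N (a *: x).
Proof. by case=> N0 h Nx; rewrite -[_ *: _]addr0; apply: h. Qed.

Lemma submodN V (N : V -> Prop) x : is_submod N -> N x -> N (- x).
Proof. by move=> h Nx; rewrite -scaleN1r; apply: submodZ. Qed.

Lemma submodB V (N : V -> Prop) x y : is_submod N -> N x -> N y -> N (x - y).
Proof. by move=> h Nx Ny; apply: submodD => //; apply: submodN. Qed.

Lemma submod_sum V (N : V -> Prop) (I : finType) (F : I -> V) :
  is_submod N -> (forall i, N (F i)) -> N (\sum_i F i).
Proof.
move=> h NF; elim/big_ind: _ => [|x y|i _]; [by case: h|exact: submodD|exact: NF].
Qed.

Lemma submod_setT V : is_submod (fun _ : V => True).
Proof. by []. Qed.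

Lemma submod_zero V : is_submod (fun x : V => x = 0).
Proof. by split=> // a x y -> ->; rewrite scaler0 addr0. Qed.

Lemma submod_preim U V (f : {linear U -> V}) (N : V -> Prop) :
  is_submod N -> is_submod (fun x => N (f x)).
Proof. by case=> N0 h; split=> [|a x y]; rewrite ?linear0 // linearP; apply: h. Qed.

Lemma submod_im U V (f : {linear U -> V}) (N : U -> Prop) :
  is_submod N -> is_submod (fun y => exists2 x, N x & f x = y).
Proof.
case=> N0 h; split=> [|a _ _ [x Nx <-] [y Ny <-]]; first by exists 0; rewrite ?linear0.
by exists (a *: x + y); rewrite ?linearP //; apply: h.
Qed.

Lemma submod_ker U V (f : {linear U -> V}) : is_submod (fun x => f x = 0).
Proof. exact: (submod_preim f (@submod_zero V)). Qed.

Lemma submod_add V (N K : V -> Prop) : is_submod N -> is_submod K ->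
  is_submod (fun z => exists x y, [/\ N x, K y & z = x + y]).
Proof.
move=> [N0 hN] [K0 hK]; split=> [|a _ _ [x [y [Nx Ky ->]]] [x' [y' [Nx' Ky' ->]]]].
  by exists 0, 0; rewrite addr0.
by exists (a *: x + x'), (a *: y + y'); split; auto; rewrite scalerDr addrACA.
Qed.

Lemma submod_cap V (N K : V -> Prop) : is_submod N -> is_submod K ->
  is_submod (fun z => N z /\ K z).
Proof. by move=> [N0 hN] [K0 hK]; split=> // a x y [? ?] [? ?]; split; auto. Qed.

Lemma submod_cyclic V (x : V) : is_submod (fun y => exists a, y = a *: x).
Proof.
split=> [|c _ _ [a ->] [b ->]]; first by exists 0; rewrite scale0r.
by exists (c * a + b); rewrite scalerDl scalerA.
Qed.

(** A total relation compatible with linear combinations is single-valued as soon as it is so at 0.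
    Maps out of quotients, into submodules and out of cyclic modules all arise from such
    relations. *)
Lemma linear_of_rel U V (G : U -> V -> Prop) :
    (forall u, exists v, G u v) ->
    (forall a u u' v v', G u v -> G u' v' -> G (a *: u + u') (a *: v + v')) ->
    (forall v, G 0 v -> v = 0) ->
  exists f : {linear U -> V}, forall u v, G u v -> f u = v.
Proof.
move=> Gex Glin G0; have [f fG] := choice Gex.
have Gu u v v' : G u v -> G u v' -> v = v'.
  move=> Gv Gv'; apply/eqP; rewrite -subr_eq0; apply/eqP/G0.
  by have := Glin (-1) _ _ _ _ Gv' Gv; rewrite !scaleN1r addNr addrC.
have fl : linear f by move=> a u v; apply: (Gu (a *: u + v)) => //; apply: Glin.
by exists (mklin fl) => u v Guv; apply: (Gu u) => //=.
Qed.

Definition submod_pred V (N : V -> Prop) : {pred V} := fun x => `[< N x >].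

Lemma submod_predP V (N : V -> Prop) : is_submod N -> submod_closed (submod_pred N).
Proof.
case=> N0 h; split; first exact/asboolP.
by move=> a x y /asboolP Nx /asboolP Ny; apply/asboolP/h.
Qed.

Definition submod_of V (N : V -> Prop) (hN : is_submod N) : submodClosed V :=
  HB.pack_for (submodClosed V) (submod_pred N)
    (GRing.isSubmodClosed.Build A V (submod_pred N) (submod_predP hN)).

Lemma submod_ofP V (N : V -> Prop) (hN : is_submod N) x :
  reflect (N x) (x \in submod_of hN).
Proof. exact: asboolP. Qed.

Lemma is_submod_closed V (N : submodClosed V) : is_submod (fun x => x \in N).
Proof. by split=> [|a x y Nx Ny]; rewrite ?rpred0 // rpredD ?rpredZ. Qed.

Lemma quotient_exists V (N : V -> Prop) : is_submod N ->
  exists (Q : lmodType A) (p : {linear V -> Q}),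
    surjective_map p /\ forall x, p x = 0 <-> N x.
Proof.
move=> hN; pose S := submod_of hN; pose p := \pi_(quotmod S)%qT : V -> quotmod S.
have pl : linear p.
  by move=> a x y; rewrite /p quotmod_piD -quotmod_scaleE.
exists (quotmod S), (mklin pl); split=> [y|x].
  by exists (repr y); rewrite /= /p reprK.
rewrite -(linear0 (mklin pl)); split=> [/quotmod_piP|Nx]; last apply/quotmod_piP.
  by rewrite subr0 => /submod_ofP.
by rewrite subr0; apply/submod_ofP.
Qed.

End LinearMaps.

Section SubmoduleType.
Context (A : pzRingType) (V : lmodType A) (N : submodClosed V).

Record submodule : Type := Submodule { submodule_val : V; _ : submodule_val \in N }.

HB.instance Definition _ := [isSub for submodule_val].
HB.instance Definition _ := [Choice of submodule by <:].
HB.instance Definition _ := [SubChoice_isSubLmodule of submodule by <:].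

End SubmoduleType.

Section Basics.
Context (A : pzRingType).
Implicit Types (U V W X Y Z : lmodType A).

Lemma submodule_exists V (N : V -> Prop) : is_submod N ->
  exists (X : lmodType A) (i : {linear X -> V}),
    injective i /\ forall x, N x <-> exists y, i y = x.
Proof.
move=> hN; pose i := @submodule_val A V (submod_of hN).
have il : linear i by [].
exists (submodule (submod_of hN)), (mklin il); split; first exact: val_inj.
move=> x; split=> [Nx|[[y yN] <-]]; last exact/(submod_ofP hN).
by exists (Submodule (introT (submod_ofP hN x) Nx)).
Qed.

Lemma inj_ker U V (f : {linear U -> V}) : injective f <-> forall x, f x = 0 -> x = 0.
Proof.
split=> [fi x|h x y /eqP]; first by rewrite -[RHS in _ = RHS -> _](linear0 f);
  apply: fi.
by rewrite -subr_eq0 -linearB => /eqP/h/eqP; rewrite subr_eq0 => /eqP.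
Qed.

Lemma factor_surj U V W (p : {linear U -> V}) (f : {linear U -> W}) :
    surjective_map p -> (forall x, p x = 0 -> f x = 0) ->
  exists g : {linear V -> W}, forall x, g (p x) = f x.
Proof.
move=> ps pf; have [|||g gP] := @linear_of_rel A V W (fun v w => exists x,
  p x = v /\ f x = w).
- by move=> v; have [x <-] := ps v; exists (f x), x.
- move=> a _ _ _ _ [x [<- <-]] [y [<- <-]]; exists (a *: x + y); by rewrite !linearP.
- by move=> _ [x [/pf <- <-]].
by exists g => x; apply: gP; exists x.
Qed.

Lemma factor_inj U V W (i : {linear U -> V}) (f : {linear W -> V}) :
    injective i -> (forall x, exists y, i y = f x) ->
  exists g : {linear W -> U}, forall x, i (g x) = f x.
Proof.
move=> ii h; have [|||g gP] := @linear_of_rel A W U (fun w u => i u = f w).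
- by move=> w; have [y <-] := h w; exists y.
- by move=> a u u' v v' E E'; rewrite !linearP E E'.
- by move=> v; rewrite linear0 => /(proj1 (inj_ker i) ii).
by exists g => x; have [y yP] := h x; rewrite (gP x y yP) yP.
Qed.

Lemma bij_inv U V (f : {linear U -> V}) : injective f -> surjective_map f ->
  exists g : {linear V -> U}, cancel f g /\ cancel g f.
Proof.
move=> fi fs; have [g gP] := @factor_inj U V V f idfun fi fs.
by exists g; split=> // x; apply: fi; rewrite gP.
Qed.

Lemma iso_bij U V (f : {linear U -> V}) : injective f -> surjective_map f -> iso U V.
Proof. by move=> fi fs; have [g [fg gf]] := bij_inv fi fs; exists f, g. Qed.

Lemma iso_inv U V : iso U V -> exists (f : {linear U -> V}) (g : {linear V -> U}),
  cancel f g /\ cancel g f.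
Proof.
case=> f [g fg gf]; have [||h hP] := @bij_inv U V f; first exact: (can_inj fg).
  by move=> y; exists (g y).
by exists f, h.
Qed.

Lemma iso_sym U V : iso U V -> iso V U.
Proof. by move=> /iso_inv[f [g [fg gf]]]; exists g, f. Qed.

Lemma short_exactP X Y Z (i : {linear X -> Y}) (p : {linear Y -> Z}) :
  injective i -> surjective_map p -> (forall y, p y = 0 <-> exists x, i x = y) ->
  short_exact X Y Z.
Proof.
move=> ii ps h; exists i, p; split=> // y.
by split=> [/h[x <-]|[x ->]]; [exists x|apply/h; exists x].
Qed.

Lemma submodule_quotient V (N : V -> Prop) : is_submod N ->
  exists (X Y : lmodType A) (i : {linear X -> V}) (p : {linear V -> Y}),
  [/\ injective i, surjective_map p, forall x, N x <-> exists y, i y = x &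
      forall x, p x = 0 <-> N x].
Proof.
move=> hN; have [X [i [ii iP]]] := submodule_exists hN.
by have [Y [p [ps pP]]] := quotient_exists hN; exists X, Y, i, p.
Qed.

Lemma hom_cyclic V W (v : V) (w : W) : (forall x, exists a, x = a *: v) ->
    (forall a, a *: v = 0 -> a *: w = 0) ->
  exists f : {linear V -> W}, f v = w.
Proof.
move=> gen ann.
have [|||f fP] := @linear_of_rel A V W (fun x y => exists a, x = a *: v /\ y = a *: w).
- by move=> u; have [a ->] := gen u; exists (a *: w), a.
- move=> a _ _ _ _ [b [-> ->]] [c [-> ->]]; exists (a * b + c).
  by rewrite !scalerDl !scalerA.
- by move=> y [a [/esym/ann E ->]].
by exists f; apply: fP; exists 1; rewrite !scale1r.
Qed.

Lemma hom_ring V (v : V) : exists f : {linear A^o -> V}, forall a : A, f a = a *: v.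
Proof.
have fl : linear (fun a : A^o => (a : A) *: v).
  by move=> a x y; rewrite scalerDl -scalerA.
by exists (mklin fl).
Qed.

End Basics.

(** * Chain conditions *)

Section Chain.
Context (A : pzRingType).
Implicit Types (U V W X Y Z : lmodType A).

Definition fg_sub V (N : V -> Prop) : Prop :=
  exists (n : nat) (g : 'I_n -> V), (forall i, N (g i)) /\
    forall x, N x -> exists c : 'I_n -> A, x = \sum_i c i *: g i.

Definition noetherian V : Prop := forall N : V -> Prop, is_submod N -> fg_sub N.

(** The minimum condition: the arguments below pick minimal members of families of submodules rather
    than follow chains. *)
Definition artinian V : Prop := forall P : (V -> Prop) -> Prop,
  (exists2 N, is_submod N & P N) ->
  exists N, [/\ is_submod N, P N &
    forall N', is_submod N' -> P N' -> (forall x, N' x -> N x) -> forall x,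
      N x -> N' x].

Lemma chain_choice (T : Type) (P : T -> Prop) (r : T -> T -> Prop) (x0 : T) :
  P x0 -> (forall x, P x -> exists2 y, P y & r x y) ->
  exists u : nat -> T, (forall n, P (u n)) /\ forall n, r (u n) (u n.+1).
Proof.
move=> Px0 h; have [f fP] : {f : T -> T & forall x, P x -> P (f x) /\ r x (f x)}.
  apply: (@choice _ _ (fun x y => P x -> P y /\ r x y)) => x.
  by case: (EM (P x)) => [/h[y Py ry]|nPx]; [exists y|exists x].
pose u n := iter n f x0.
have uP n : P (u n) by elim: n => // n IH; case: (fP _ IH).
by exists u; split=> // n; case: (fP _ (uP n)).
Qed.

Lemma artinian_moduleP V : artinian_module V -> artinian V.
Proof.
move=> aV P [N0 sN0 PN0]; apply: contrapT => H.
pose r N N' := (forall x : V, N' x -> N x) /\ exists2 x, N x & ~ N' x.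
have [N [sN PN]|N [NP Nr]] := @chain_choice _ (fun N =>
  is_submod N /\ P N) r N0 (conj sN0 PN0).
  apply: contrapT => H'; apply: H; exists N; split=> // N' sN' PN' le x Nx.
  by apply: contrapT => nN'x; apply: H'; exists N' => //; split=> //; exists x.
have [n x|n nP] := aV (fun n => submod_of (proj1 (NP n))).
  by move=> /submod_ofP h; apply/submod_ofP; case: (Nr n) => le _; apply: le.
have [_ [x Nx]] := Nr n; apply; have := nP n.+1 (leqnSn n) x.
by move=> E; apply/(submod_ofP (proj1 (NP n.+1))); rewrite E; apply/submod_ofP.
Qed.

(** Otherwise there is a strictly increasing sequence of members; its union is finitely generated,
    and the generators already lie in one term. *)
Lemma noetherian_max V : noetherian V -> forall P : (V -> Prop) -> Prop,
  (exists2 N, is_submod N & P N) ->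
  exists N, [/\ is_submod N, P N &
    forall N', is_submod N' -> P N' -> (forall x, N x -> N' x) -> forall x,
      N' x -> N x].
Proof.
move=> aV P [N0 sN0 PN0]; apply: contrapT => H.
pose r N N' := (forall x : V, N x -> N' x) /\ exists2 x, N' x & ~ N x.
have [N [sN PN]|N [NP Nr]] := @chain_choice _ (fun N =>
  is_submod N /\ P N) r N0 (conj sN0 PN0).
  apply: contrapT => H'; apply: H; exists N; split=> // N' sN' PN' le x Nx.
  by apply: contrapT => nN'x; apply: H'; exists N' => //; split=> //; exists x.
have mono m n x : (m <= n)%N -> N m x -> N n x.
  move=> /subnK <-; elim: (n - m)%N => // k IH Nx; rewrite addSn.
  by case: (Nr (k + m)%N) => + _; apply; apply: IH.
have sU : is_submod (fun x => exists n, N n x).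
  split=> [|a x y [m Nx] [n Ny]]; first by exists 0%N; case: (NP 0%N) => -[].
  exists (maxn m n); apply: (proj2 (proj1 (NP _))).
    by apply: mono Nx; rewrite leq_maxl.
  by apply: mono Ny; rewrite leq_maxr.
have [k [g [gN gP]]] := aV _ sU; have [h hP] := choice gN.
pose n := (\max_i h i)%N; have [_ [x Nx]] := Nr n; apply.
have [|c ->] := gP x; first by exists n.+1.
apply: submod_sum => [|i]; first by case: (NP n).
apply: submodZ; first by case: (NP n).
by apply: mono (hP i); apply: (leq_bigmax i).
Qed.

Lemma fg_sub_im V W (f : {linear V -> W}) (N : V -> Prop) :
  fg_sub N -> fg_sub (fun y => exists2 x, N x & f x = y).
Proof.
case=> n [g [gN gP]]; exists n, (f \o g); split=> [i|_ [x /gP[c ->] <-]].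
  by exists (g i).
by exists c; rewrite linear_sum; apply: eq_bigr => i _; rewrite linearZ.
Qed.

Lemma fg_subT V : fin_gen V <-> fg_sub (fun _ : V => True).
Proof.
split=> [[n [g gP]]|[n [g [_ gP]]]]; first by exists n, g; split.
by exists n, g => x; apply: gP.
Qed.

Lemma fg_sub_ext V W (f : {linear V -> W}) (N : V -> Prop) : is_submod N ->
  fg_sub (fun y => exists2 x, N x & f x = y) -> fg_sub (fun x => N x /\ f x = 0) ->
  fg_sub N.
Proof.
move=> sN [n [g [gN gP]]] [m [h [hN hP]]].
have [g' g'P] : {g' : 'I_n -> V & forall i, N (g' i) /\ f (g' i) = g i}.
  by apply: (@choice _ _ (fun i x => N x /\ f x = g i)) => i; have [x Nx fx] := gN i;
    exists x.
exists (n + m)%N, (fun i => match fintype.split i with inl j => g' j | inr j =>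
  h j end).
split=> [i|x Nx]; first by case: (fintype.split i) => j; [case: (g'P j)|case: (hN j)].
have [|c cP] := gP (f x); first by exists x.
have [|d dP] := hP (x - \sum_i c i *: g' i).
  split; first by apply: submodB => //; apply: submod_sum => // i;
    apply: submodZ => //; case: (g'P i).
  rewrite linearB cP linear_sum; apply/eqP; rewrite subr_eq0; apply/eqP/eq_bigr => i _.
  by rewrite linearZ; case: (g'P i) => _ ->.
exists (fun i => match fintype.split i with inl j => c j | inr j => d j end).
rewrite big_split_ord -[LHS](subrK (\sum_i c i *: g' i)) addrC dP.
congr (_ + _); apply: eq_bigr => i _; cbv beta.
  by rewrite (unsplitK (inl i)).
by rewrite (unsplitK (inr i)).
Qed.

Lemma noetherian_surj V W (p : {linear V -> W}) :
  surjective_map p -> noetherian V -> noetherian W.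
Proof.
move=> ps nV N sN; have := fg_sub_im p (nV _ (submod_preim p sN)).
case=> n [g [gN gP]]; exists n, g; split=> [i|x Nx].
  by have [y + <-] := gN i.
by apply: gP; have [y E] := ps x; exists y; rewrite ?E.
Qed.

Lemma noetherian_inj V W (i : {linear V -> W}) :
  injective i -> noetherian W -> noetherian V.
Proof.
move=> ii nW N sN; have [n [g [gN gP]]] := nW _ (submod_im i sN).
have [h hP] : {h : 'I_n -> V & forall k, N (h k) /\ i (h k) = g k}.
  by apply: (@choice _ _ (fun k x => N x /\ i x = g k)) => k; have [x Nx fx] := gN k;
    exists x.
exists n, h; split=> [k|x Nx]; first by case: (hP k).
have [|c cP] := gP (i x); first by exists x.
exists c; apply: ii; rewrite cP linear_sum; apply: eq_bigr => k _.
by rewrite linearZ; case: (hP k) => _ ->.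
Qed.

Lemma noetherian_ext X V Y (i : {linear X -> V}) (p : {linear V -> Y}) :
  (forall x, p x = 0 -> exists y, i y = x) ->
  noetherian X -> noetherian Y -> noetherian V.
Proof.
move=> h nX nY N sN; apply: (fg_sub_ext (f := p)) => //.
  by apply: nY; apply: submod_im.
have := fg_sub_im i (nX _ (submod_preim i (submod_cap sN (submod_ker p)))).
case=> n [g [gN gP]]; exists n, g; split=> [k|x [Nx px]].
  by have [y + <-] := gN k.
by apply: gP; have [y E] := h x px; exists y; rewrite E.
Qed.

Lemma noetherian_fin_gen V : noetherian V -> fin_gen V.
Proof. by move=> nV; apply/fg_subT/nV. Qed.

Lemma artinian_surj V W (p : {linear V -> W}) :
  surjective_map p -> artinian V -> artinian W.
Proof.
move=> ps aV P [N0 sN0 PN0].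
have ext N : (fun y => exists2 x, N (p x) & p x = y) = N.
  apply: funext => y; apply/propext; split=> [[x + <-//]|Ny].
  by have [x E] := ps y; exists x; rewrite ?E.
have [|N [sN PN Nmin]] := aV (fun N => P (fun y => exists2 x, N x & p x = y) /\
     (forall x y, p x = p y -> N x -> N y)).
  exists (fun x => N0 (p x)); first exact: submod_preim.
  by split=> [|x y ->]; rewrite ?ext.
exists (fun y => exists2 x, N x & p x = y); split; [exact: submod_im|by case: PN|].
move=> N' sN' PN' le _ [x Nx <-]; apply: (Nmin (fun x => N' (p x))) => //.
- exact: submod_preim.
- by split=> [|y z ->]; rewrite ?ext.
- by move=> y /le[z Nz E]; case: PN => _ /(_ _ _ E); apply.
Qed.

(** Minimise first the image in Y, then the trace on X among members with that image. A smaller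
    member has the same image and trace, hence is equal. *)
Lemma artinian_ext X V Y (i : {linear X -> V}) (p : {linear V -> Y}) :
  (forall x, p x = 0 -> exists y, i y = x) ->
  artinian X -> artinian Y -> artinian V.
Proof.
move=> h aX aY P [N0 sN0 PN0].
pose im N : Y -> Prop := fun y => exists2 x, N x & p x = y.
have [|M [sM [N1 [sN1 PN1 E1]] Mmin]] :=
    aY (fun M => exists N, [/\ is_submod N, P N & im N = M]).
  by exists (im N0); [apply: submod_im|exists N0].
have [|K [sK [N [sN PN E EK]] Kmin]] :=
    aX (fun K => exists N, [/\ is_submod N, P N, im N = M & (fun x => N (i x)) = K]).
  by exists (fun x => N1 (i x)); [apply: submod_preim|exists N1].
exists N; split=> // N' sN' PN' le x Nx.
have E' : im N' = M.
  have sub : forall y, im N' y -> M y by rewrite -E => _ [z /le Nz <-]; exists z.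
  apply: funext => y; apply/propext; split; first exact: sub.
  by move: y; apply: Mmin => //; [apply: submod_im|exists N'].
have [x' N'x' px'] : im N' (p x) by rewrite E' -E; exists x.
have [z zE] : exists z, i z = x - x'.
  by apply: h; rewrite linearB px' subrr.
have : N' (i z).
  apply: (Kmin (fun z => N' (i z))); first exact: submod_preim.
  - by exists N'.
  - by move=> w /le; rewrite -EK.
  by rewrite -EK zE; apply: submodB => //; apply: le.
rewrite zE => N'z; rewrite -(subrK x' x); exact: submodD.
Qed.

(** Induction on the number of generators: the span of the first one is a quotient of the regular
    module, and the quotient by it needs one generator fewer. Both chain conditions pass from the
    ring to its finitely generated modules this way. *)
Lemma fin_gen_ind (C : lmodType A -> Prop) :
  C A^o ->
  (forall V W (p : {linear V -> W}), surjective_map p -> C V -> C W) ->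
  (forall X V Y (i : {linear X -> V}) (p : {linear V -> Y}),
    (forall x, p x = 0 -> exists y, i y = x) -> C X -> C Y -> C V) ->
  forall V, fin_gen V -> C V.
Proof.
move=> CA Csurj Cext V [n]; elim: n => [|n IH] in V * => -[g gP].
  have V0 (x : V) : x = 0 by have [c ->] := gP x; rewrite big_ord0.
  have [p pP] := hom_ring (0 : V); apply: (Csurj _ _ p) CA => y.
  by exists 0; rewrite linear0 (V0 y).
have [X [Y [i [p [ii ps iP pP]]]]] := submodule_quotient (submod_cyclic (g ord0)).
apply: (Cext _ _ _ i p) => [x /pP/iP//||].
  have [y yE] : exists y, i y = g ord0 by apply/iP; exists 1; rewrite scale1r.
  have [q qP] := hom_ring y; apply: (Csurj _ _ q) CA => x.
  have /iP[a aE] : exists y, i y = i x by exists x.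
  by exists a; apply: ii; rewrite qP linearZ yE aE.
apply: IH; exists (fun j => p (g (lift ord0 j))) => y.
have [x <-] := ps y; have [c ->] := gP x; exists (fun j => c (lift ord0 j)).
rewrite big_ord_recl linearD linear_sum.
have -> : p (c ord0 *: g ord0) = 0 by apply/pP; exists (c ord0).
by rewrite add0r; apply: eq_bigr => j _; rewrite linearZ.
Qed.

Lemma fin_gen_surj V W (p : {linear V -> W}) : surjective_map p -> fin_gen V ->
  fin_gen W.
Proof.
move=> ps /fg_subT/(fg_sub_im p)[n [g [_ gP]]]; exists n, g => x; apply: gP.
by have [y <-] := ps x; exists y.
Qed.

Lemma fin_gen_ext X V Y : short_exact X V Y -> fin_gen X -> fin_gen Y -> fin_gen V.
Proof.
case=> i [p [ii ps h]] /fg_subT/(fg_sub_im i)[n [g [gN gP]]] /fg_subT[m [g' [gN' gP']]].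
apply/fg_subT/(fg_sub_ext (f := p)); first exact: submod_setT.
  exists m, g'; split=> [k|y _]; last exact: gP'.
  by have [x <-] := ps (g' k); exists x.
exists n, g; split=> [k|x [_ px]].
  by have [x _ <-] := gN k; split=> //; apply/h; exists x.
by apply: gP; have [y ->] := proj1 (h x) px; exists y.
Qed.

End Chain.

(** * Finite direct sums *)

Section Biproducts.
Context (A : pzRingType).
Implicit Types (U V W X Y Z S M : lmodType A) (C : subcat A).

Lemma fin_gen_finType V (T : finType) (g : T -> V) :
  (forall x, exists c : T -> A, x = \sum_t c t *: g t) -> fin_gen V.
Proof.
move=> h; exists #|T|, (fun k => g (enum_val k)) => x; have [c ->] := h x.
exists (fun k => c (enum_val k)).
by rewrite (reindex (@enum_val T predT)) //; apply: onW_bij; apply: enum_val_bij.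
Qed.

Definition is_biprod (I : finType) (M : I -> lmodType A) S : Prop :=
  exists (inj : forall i, {linear M i -> S}) (pr : forall i, {linear S -> M i}),
  [/\ forall i m, pr i (inj i m) = m,
      forall i j m, i != j -> pr j (inj i m) = 0 &
      forall s, s = \sum_i inj i (pr i s)].

Lemma dsum_biprod (I : finType) (M : I -> lmodType A) : is_biprod M (dsum M).
Proof.
have prl i : linear (fun s : dsum M => s i) by move=> a x y; rewrite !ffunE.
pose inj i (m : M i) : dsum M := finfun (dfwith (fun j => 0 : M j) m).
have injE i m : inj i m i = m by rewrite ffunE dfwith_in.
have injE0 i j m : i != j -> inj i m j = 0 by move=> ?; rewrite ffunE dfwith_out.
have injl i : linear (inj i).
  move=> a x y; apply/ffunP => j; case: (eqVneq i j) => [<-|ij].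
    by rewrite injE ffunE ffunE !injE.
  by rewrite injE0 // ffunE ffunE !injE0 // scaler0 addr0.
exists (fun i => mklin (injl i)), (fun i => mklin (prl i)); split=> //= s.
apply/ffunP => j; rewrite -[RHS]/(mklin (prl j) _) linear_sum (bigD1 j) //= injE.
by rewrite big1 ?addr0 // => i ij; rewrite injE0.
Qed.

Lemma ffun_biprod n V : is_biprod (fun _ : 'I_n => V) {ffun 'I_n -> V}.
Proof.
have prl i : linear (fun s : {ffun 'I_n -> V} => s i) by move=> a x y; rewrite !ffunE.
pose inj i (m : V) : {ffun 'I_n -> V} := [ffun j => if i == j then m else 0].
have injl i : linear (inj i).
  move=> a x y; apply/ffunP => j; rewrite !ffunE.
  by case: eqP => // _; rewrite scaler0 addr0.
exists (fun i => mklin (injl i)), (fun i => mklin (prl i)).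
split=> /= [i m|i j m /negbTE ij|s]; rewrite ?ffunE ?eqxx ?ij //.
apply/ffunP => j; rewrite sum_ffunE (bigD1 j) //= ffunE eqxx.
by rewrite big1 ?addr0 // => i /negbTE ij; rewrite ffunE ij.
Qed.

Section Theory.
Context (I : finType) (M : I -> lmodType A) (S : lmodType A).
Hypothesis bS : is_biprod M S.

Lemma biprod_hom_out X : hom_zero S X <-> forall i, hom_zero (M i) X.
Proof.
case: bS => inj [pr [prinj _ sumE]]; split=> [h i f m|h f s].
  by have := h (f \o pr i : {linear S -> X}) (inj i m); rewrite /= prinj.
rewrite (sumE s) linear_sum big1 // => i _.
exact: (h i (f \o inj i : {linear M i -> X})).
Qed.

Lemma biprod_hom_in X : hom_zero X S <-> forall i, hom_zero X (M i).
Proof.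
case: bS => inj [pr [prinj _ sumE]]; split=> [h i f x|h f x].
  rewrite -[LHS](prinj i).
  by have /= -> := h (inj i \o f : {linear X -> S}) x; rewrite linear0.
rewrite (sumE (f x)) big1 // => i _.
by have /= -> := h i (pr i \o f : {linear X -> M i}) x; rewrite linear0.
Qed.

Lemma biprod_fin_gen : (forall i, fin_gen (M i)) -> fin_gen S.
Proof.
move=> fgM; case: bS => inj [pr [_ _ sumE]].
have [n nP] := choice fgM; have [g gP] := cid (fin_all_exists nP).
apply: (@fin_gen_finType S {i : I & 'I_(n i)} (fun t =>
  inj (tag t) (g (tag t) (tagged t)))).
move=> s; have [c cP] := cid (fin_all_exists (fun i => gP i (pr i s))).
exists (fun t => c (tag t) (tagged t)).
rewrite -(sig_big_dep (fun i => true) (fun i j => true)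
  (fun i j => c i j *: inj i (g i j))) /= [LHS]sumE; apply: eq_bigr => i _.
by rewrite [in LHS]cP linear_sum; apply: eq_bigr => j _; rewrite linearZ.
Qed.

Lemma biprod_projective C : C S -> (forall i,
  projective_in C (M i)) -> projective_in C S.
Proof.
move=> CS pM; split=> // X Y p g CX CY ps; case: bS => inj [pr [_ _ sumE]].
have [h hP] := cid (fin_all_exists (fun i =>
  proj2 (pM i) X Y p (g \o inj i : {linear M i -> Y}) CX CY ps)).
have fl : linear (fun s => \sum_i h i (pr i s)).
  move=> a x y; rewrite scaler_sumr -big_split; apply: eq_bigr => i _ /=.
  by rewrite !linearP.
exists (mklin fl) => s /=; rewrite linear_sum [in RHS](sumE s) linear_sum.
by apply: eq_bigr => i _; rewrite hP.
Qed.

Lemma biprod_injective C : C S -> (forall i, injective_in C (M i)) -> injective_in C S.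
Proof.
move=> CS pM; split=> // X Y p g CX CY pi; case: bS => inj [pr [_ _ sumE]].
have [h hP] := cid (fin_all_exists (fun i =>
  proj2 (pM i) X Y p (pr i \o g : {linear X -> M i}) CX CY pi)).
have fl : linear (fun s => \sum_i inj i (h i s)).
  move=> a x y; rewrite scaler_sumr -big_split; apply: eq_bigr => i _ /=.
  by rewrite !linearP.
exists (mklin fl) => s /=; rewrite [in RHS](sumE (g s)).
by apply: eq_bigr => i _; rewrite hP.
Qed.

End Theory.

Definition retract X M : Prop :=
  exists (i : {linear X -> M}) (r : {linear M -> X}), cancel i r.

Lemma retract_add n X M : retract X {ffun 'I_n -> M}%type -> Defs.add M X.
Proof.
case=> i [r ir]; have [Y [k [ki kP]]] := submodule_exists (submod_ker r).
exists n, Y; have fl : linear (fun z : X * Y => i z.1 + k z.2).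
  by move=> a [x y] [x' y'] /=; rewrite !linearP scalerDr addrACA.
have rk y : r (k y) = 0 by apply/kP; exists y.
apply: (iso_bij (f := mklin fl)) => /= [[x y] [x' y'] /= E|m].
  have := congr1 r E; rewrite !linearD !ir !rk !addr0 => Ex; move: E.
  by rewrite Ex => /addrI/ki ->.
have [|y yE] := proj1 (kP (m - i (r m))); first by rewrite linearB ir subrr.
by exists (r m, y); rewrite /= yE addrC subrK.
Qed.

Lemma add_retract X M : Defs.add M X -> exists n, retract X {ffun 'I_n -> M}%type.
Proof.
case=> n [Y /iso_inv[f [g [fg gf]]]]; exists n.
have il : linear (fun x : X => f (x, 0 : Y)).
  move=> a x y; rewrite -linearP; congr (f _).
  by congr pair; rewrite /= scaler0 addr0.
have rl : linear (fun z => (g z).1 : X) by move=> a x y; rewrite linearP.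
by exists (mklin il), (mklin rl) => x /=; rewrite fg.
Qed.

Lemma retract_hom_out X M Y : retract X M -> hom_zero M Y -> hom_zero X Y.
Proof.
case=> i [r ir] h f x; rewrite -(ir x).
exact: (h (f \o r : {linear M -> Y})).
Qed.

Lemma retract_hom_in X M Y : retract X M -> hom_zero Y M -> hom_zero Y X.
Proof.
case=> i [r ir] h f x; rewrite -(ir (f x)).
by have /= -> := h (i \o f : {linear Y -> M}) x; rewrite linear0.
Qed.

Lemma retract_fin_gen X M : retract X M -> fin_gen M -> fin_gen X.
Proof. by case=> i [r ir]; apply: (fin_gen_surj (p := r)) => x; exists (i x). Qed.

Lemma retract_projective C X M : C X -> retract X M ->
  projective_in C M -> projective_in C X.
Proof.
move=> CX [i [r ir]] [_ pM]; split=> // Y Z p g CY CZ ps.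
have [h hP] := pM Y Z p (g \o r : {linear M -> Z}) CY CZ ps.
by exists (h \o i : {linear X -> Y}) => x; rewrite /= hP /= ir.
Qed.

Lemma retract_injective C X M : C X -> retract X M ->
  injective_in C M -> injective_in C X.
Proof.
move=> CX [i [r ir]] [_ pM]; split=> // Y Z p g CY CZ ps.
have [h hP] := pM Y Z p (i \o g : {linear Y -> M}) CY CZ ps.
by exists (r \o h : {linear Z -> X}) => x; rewrite /= hP /= ir.
Qed.

(** Among the images of maps from powers of M choose a maximal one. It contains the image of every
    f, because f can be added as one more component. *)
Lemma finite_generation M X : noetherian X ->
    (forall N, is_submod N -> (forall (f : {linear M -> X}) m, N (f m)) -> forall x,
      N x) ->
  exists n (p : {linear {ffun 'I_n -> M} -> X}), surjective_map p.
Proof.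
move=> nX gen.
pose P (N : X -> Prop) := exists n (p : {linear {ffun 'I_n -> M} -> X}),
  (fun x => exists2 y, True & p y = x) = N.
have [|N [sN [n [p pN]] Nmax]] := noetherian_max nX (P := P).
  have zl : linear (fun _ : {ffun 'I_0 -> M} => 0 : X).
    by move=> a x y; rewrite scaler0 addr0.
  exists (fun x => exists2 y, True & mklin zl y = x).
    exact: (submod_im _ (@submod_setT _ _)).
  by exists 0%N, (mklin zl).
exists n, p; suff h x : N x by move=> x; have := h x; rewrite -pN => -[y _ <-];
  exists y.
apply: gen => // f m.
pose tl (g : {ffun 'I_n.+1 -> M}) : {ffun 'I_n -> M} := [ffun i => g (lift ord0 i)].
have tll : linear tl by move=> a x' y'; apply/ffunP => i; rewrite !ffunE.
have ql : linear (fun g : {ffun 'I_n.+1 -> M} => p (tl g) + f (g ord0)).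
  by move=> a x' y'; rewrite tll !ffunE !linearP scalerDr addrACA.
have h g : exists g' : {ffun 'I_n.+1 -> M}, tl g' = g.1 /\ g' ord0 = g.2.
  exists [ffun i => if unlift ord0 i is Some j then g.1 j else g.2].
  by split; [apply/ffunP => i|]; rewrite ?ffunE ?liftK ?unlift_none.
apply: (Nmax (fun x => exists2 y, True & mklin ql y = x)).
- exact: (submod_im _ (@submod_setT _ _)).
- by exists n.+1, (mklin ql).
- rewrite -pN => _ [y _ <-]; have [g [E1 E2]] := h (y, 0); exists g => //=.
  by rewrite E1 E2 linear0 addr0.
have [g [E1 E2]] := h (0, m); exists g => //=; by rewrite E1 E2 linear0 add0r.
Qed.

(** Dually, a minimal kernel of a map to a power of M lies in the kernel of every map from X to
    M. *)
Lemma finite_cogeneration M X : artinian X ->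
    (forall x : X, x <> 0 -> exists f : {linear X -> M}, f x <> 0) ->
  exists n (i : {linear X -> {ffun 'I_n -> M}}), injective i.
Proof.
move=> nX cog.
pose P (N : X -> Prop) := exists n (p : {linear X -> {ffun 'I_n -> M}}),
  (fun x => p x = 0) = N.
have [|N [sN [n [p pN]] Nmin]] := nX P.
  have zl : linear (fun _ : X => 0 : {ffun 'I_0 -> M}).
    by move=> a x y; rewrite scaler0 addr0.
  exists (fun x => mklin zl x = 0); first exact: submod_ker.
  by exists 0%N, (mklin zl).
exists n, p; apply/inj_ker => x px; apply: contrapT => /cog[f]; apply.
pose q (x : X) : {ffun 'I_n.+1 -> M} :=
  [ffun i => if unlift ord0 i is Some j then p x j else f x].
have ql : linear q.
  move=> a x' y'; apply/ffunP => i; rewrite !ffunE.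
  by case: unlift => [j|]; rewrite linearP ?ffunE.
have q0 y : q y = 0 -> p y = 0 /\ f y = 0.
  move=> /ffunP E; split.
    by apply/ffunP => i; have := E (lift ord0 i); rewrite !ffunE liftK.
  by have := E ord0; rewrite !ffunE unlift_none.
suff : mklin ql x = 0 by move=> /q0[].
apply: (Nmin (fun x => mklin ql x = 0)).
- exact: submod_ker.
- by exists n.+1, (mklin ql).
- by move=> y /q0[py _]; rewrite -pN.
by rewrite -pN.
Qed.

End Biproducts.

(** * Commutative artinian rings and the injective envelope *)

Section ArtinianRing.
Context (R : comNzRingType) (J : lmodType R).
Implicit Types (V W : lmodType R) (K m : R^o -> Prop).

(** Maximality in terms of elements: whatever lies outside m is invertible modulo m. *)
Definition is_maximal m : Prop :=
  [/\ is_submod m, ~ m 1 & forall r : R, ~ m r -> exists s : R, m (1 - s * r)].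

Lemma idealMl K (a b : R) : is_submod K -> K b -> K (a * b).
Proof. by move=> sK Kb; apply: (submodZ (V := R^o) a sK Kb). Qed.

Lemma idealD K (a b : R) : is_submod K -> K a -> K b -> K (a + b).
Proof. by move=> sK Ka Kb; apply: (submodD (V := R^o) sK Ka Kb). Qed.

Lemma maximal_prime m (a b : R) : is_maximal m -> m (a * b) -> ~ m a -> m b.
Proof.
case=> sm _ h mab /h[s hs].
have -> : b = b * (1 - s * a) + s * (a * b) by rewrite mulrBr mulr1 mulrCA [b *
  a]mulrC subrK.
by apply: idealD => //; apply: idealMl.
Qed.

Lemma maximal_sub m m' : is_maximal m -> is_maximal m' ->
  (forall r, m r -> m' r) -> forall r, m' r -> m r.
Proof.
move=> [_ _ h] [sm' n1 _] le r m'r; apply: contrapT => /h[s /le m's].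
by apply: n1; rewrite -[1](subrK (s * r)); apply: idealD => //; apply: idealMl.
Qed.

Lemma maximal_idealP (N : submodClosed R^o) : maximal_ideal N ->
  is_maximal (fun r => r \in N).
Proof.
case=> n1 h; split=> [||r nr]; [exact: is_submod_closed|exact/negP|].
have sN := is_submod_closed N.
have sS := submod_add sN (submod_cyclic (r : R^o)).
have [|/submod_ofP[x [_ [Nx [a ->] E]]]|/(_ r) le] := h (submod_of sS).
- move=> x Nx; apply/submod_ofP; exists x, 0; split=> //; last by rewrite addr0.
  by exists 0; rewrite scale0r.
- by exists a; rewrite [1]E -[a *: _]/(a * r) addrK.
case: nr; apply: le; apply/submod_ofP; exists 0, r; split; rewrite ?add0r ?rpred0 //.
by exists 1; rewrite scale1r.
Qed.

Lemma is_maximal_ideal m (sm : is_submod m) : is_maximal m ->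
  maximal_ideal (submod_of sm).
Proof.
case=> _ n1 h; split=> [|N' le]; first by apply/negP => /submod_ofP.
case: (EM (forall r : R^o, r \in N' -> m r)) =>
  [h'|/existsNP[r /not_implyP[rN' /h[s ms]]]].
  by right=> r rN'; apply/submod_ofP/h'.
left; rewrite -[1](subrK (s * r)); apply: (idealD (K := fun x => x \in N'));
  first exact: is_submod_closed.
  by apply/le/submod_ofP.
by apply: (idealMl (K := fun x => x \in N')) => //; apply: is_submod_closed.
Qed.

Lemma jacobsonP (x : R^o) :
  x \in @jacobson R <-> forall m, is_maximal m -> m x.
Proof.
split=> [/asboolP h m mm|h]; last by apply/asboolP => N /maximal_idealP/h.
case: (mm) => sm _ _.
by apply/(submod_ofP sm)/h/is_maximal_ideal.
Qed.

Lemma semisimple_quotientP : exists p : {linear R^o -> semisimple_quotient R},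
  surjective_map p /\ forall x, p x = 0 <-> forall m, is_maximal m -> m x.
Proof.
pose S := @jacobson R : submodClosed R^o.
have pl : linear (\pi_(quotmod S)%qT : R^o -> quotmod S).
  by move=> a x y; rewrite quotmod_piD -quotmod_scaleE.
exists (mklin pl); split=> [y|x]; first by exists (repr y); rewrite /= reprK.
rewrite -(linear0 (mklin pl)) -jacobsonP.
by split=> [/quotmod_piP|h]; [|apply/quotmod_piP]; rewrite subr0.
Qed.

(** A submodule minimal among those not inside K gives a simple submodule of V / K, whose
    annihilator is maximal; V / K itself is not formed. *)
Lemma annihilated_maximal V (K : V -> Prop) : artinian V -> is_submod K ->
  (exists x, ~ K x) -> exists x, ~ K x /\ is_maximal (fun r => K (r *: x)).
Proof.
move=> aV sK [x0 nx0].
have [|N [sN [x Nx nKx] Nmin]] := aV (fun N => exists2 x, N x & ~ K x).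
  by exists (fun _ => True); [exact: submod_setT|exists x0].
exists x; split=> //; split=> [||r nr]; last first.
- have [|||a aE] := Nmin (fun y => exists a, y = a *: (r *: x)) _ _ _ x Nx.
  + exact: submod_cyclic.
  + by exists (r *: x) => //; exists 1; rewrite scale1r.
  + by move=> _ [a ->]; do 2![apply: submodZ => //].
  exists a; suff -> : (1 - a * r) *: x = 0 by case: sK.
  by rewrite scalerBl scale1r -scalerA -aE subrr.
- by rewrite scale1r.
- split=> [|a b c Kb Kc]; first by rewrite scale0r; case: sK.
  by rewrite scalerDl -scalerA; case: sK => _; apply.
Qed.

Hypothesis artR : artinian_module R^o.
Hypothesis envJ : injective_envelope (semisimple_quotient R) J.

Let artR' : artinian R^o := artinian_moduleP artR.

Definition killed V m (y : V) : Prop := forall r : R, m r -> r *: y = 0.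

(** By essentiality, elements of J killed by m come from R / rad R. A representative of the nonzero
    element x lies outside some maximal ideal; that ideal contains m, so it is m, and the
    representative can be inverted modulo m. *)
Lemma envelope_simple m (x y : J) : is_maximal m -> killed m x -> killed m y ->
  x <> 0 -> exists s, y = s *: x.
Proof.
move=> mm kx ky x0; case: envJ => _ [i [ii ess]].
have [p [ps pP]] := semisimple_quotientP.
have pre z : killed m z -> exists r, i (p r) = z.
  move=> kz; case: (eqVneq z 0) => [->|z0]; first by exists 0; rewrite !linear0.
  have [|u] := ess (submod_of (submod_cyclic z)).
    by exists z => //; apply/submod_ofP; exists 1; rewrite scale1r.
  move=> /submod_ofP[a E] au0; case: (mm) => _ _ /(_ a)[|b /kz].
    by move=> /kz E'; move: au0; rewrite E E' eqxx.
  rewrite scalerBl scale1r -scalerA -E => /eqP; rewrite subr_eq0 => /eqP ->.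
  by have [r rE] := ps (b *: u); exists r; rewrite rE linearZ.
have [rx Ex] := pre _ kx; have [ry Ey] := pre _ ky.
have jac z r a : i (p r) = z -> killed m z -> m a -> forall m',
  is_maximal m' -> m' (a * r).
  move=> <- kz ma; apply/pP; apply: ii;
    rewrite -[a * r]/(a *: r) linearZ linearZ linear0.
  exact: kz.
have [m' [mm' nrx]] : exists m', is_maximal m' /\ ~ m' rx.
  apply: contrapT => H; apply: x0; rewrite -Ex; suff -> : p rx = 0 by rewrite linear0.
  by apply/pP => m' mm'; apply: contrapT => H'; apply: H; exists m'.
have le a : m a -> m' a.
  by move=> ma; apply: (maximal_prime mm' _ nrx); rewrite mulrC; apply: (jac x).
case: (mm') => _ _ /(_ _ nrx)[s /(maximal_sub mm mm' le) ms].
exists (ry * s); rewrite -Ex -Ey -!linearZ; apply/eqP; rewrite -subr_eq0 -!linearB.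
have -> : ry - (ry * s) *: rx = (1 - s * rx) * ry.
  by rewrite -[_ *: _]/(ry * s * rx) mulrBl mul1r; congr (_ - _);
    rewrite [RHS]mulrC mulrA.
suff -> : p ((1 - s * rx) * ry) = 0 by rewrite linear0.
by apply/pP; apply: (jac y).
Qed.

(** An ideal minimal among those not inside m contains some x outside m, and minimality puts x into
    every other maximal ideal. So m x lies in the radical, and the class of x is nonzero and killed
    by m. *)
Lemma envelope_socle m : is_maximal m -> exists2 y : J, y <> 0 & killed m y.
Proof.
move=> mm; case: envJ => _ [i [ii _]]; have [p [ps pP]] := semisimple_quotientP.
case: (mm) => sm n1 hm.
have [|K [sK [x Kx nmx] Kmin]] := artR' (P := fun K => exists2 x, K x & ~ m x).
  by exists (fun _ => True); [exact: submod_setT|exists 1].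
exists (i (p x)) => [/eqP|a ma].
  by rewrite -(linear0 i) => /eqP/ii/pP/(_ _ mm).
rewrite -!linearZ; suff -> : p (a *: x) = 0 by rewrite linear0.
apply/pP => m' mm'; case: (mm') => sm' _ _.
case: (EM (forall r, m' r -> m r)) => [le|/existsNP[n /not_implyP[m'n nmn]]].
  rewrite -[_ *: _]/(a * x) mulrC; apply: idealMl => //.
  exact: (maximal_sub mm' mm le).
apply: idealMl => //.
have [|||b ->] := Kmin (fun y => exists b, y = b *: (n *: x)) _ _ _ x Kx.
- exact: submod_cyclic.
- exists (n *: x); first by exists 1; rewrite scale1r.
  by move=> /(maximal_prime mm)/(_ nmn).
- by move=> _ [b ->]; do 2![apply: submodZ => //].
apply: idealMl => //; rewrite -[_ *: _]/(n * x) mulrC; exact: idealMl.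
Qed.

Lemma envelope_extend V W (f : {linear V -> W}) (g : {linear V -> J}) :
  (forall v, f v = 0 -> g v = 0) -> exists h : {linear W -> J}, forall v, h (f v) = g v.
Proof.
move=> fg; have [X [k [ki kP]]] := submodule_exists (submod_im f (@submod_setT _ V)).
have [|f' f'P] := @factor_inj _ _ _ _ k f ki; first by move=> v; apply/kP; exists v.
have [||g' g'P] := @factor_surj _ _ _ _ f' g.
- move=> x; have [v _ vE] : exists2 v, True & f v = k x by apply/kP; exists x.
  by exists v; apply: ki; rewrite f'P.
- by move=> v fv; apply: fg; rewrite -f'P fv linear0.
case: envJ => -[_ injJ] _; have [h hP] := injJ _ _ k g' I I ki.
by exists h => v; rewrite -f'P hP g'P.
Qed.

(** Some multiple of x generates a simple module R / m, which embeds in J by [envelope_socle];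
    injectivity of J extends this embedding. *)
Lemma envelope_cogenerates V (x : V) : x <> 0 -> exists f : {linear V -> J}, f x <> 0.
Proof.
move=> x0; have [f fP] := hom_ring x.
have [|r [nr mm]] := annihilated_maximal artR' (submod_ker f).
  by exists 1; rewrite fP scale1r.
have [y y0 ky] := envelope_socle mm.
have [f' f'P] := hom_ring (r *: x); have [g gP] := hom_ring y.
have [|h hP] := @envelope_extend _ _ f' g.
  move=> v; rewrite f'P gP => E; apply: ky; rewrite fP.
  by rewrite -[v *: r]/(v * r) -scalerA.
exists h => hx; apply: y0; have := hP 1.
by rewrite f'P gP !scale1r linearZ /= hx scaler0.
Qed.

Lemma hom_mul V (r : R) : exists f : {linear V -> V}, forall x, f x = r *: x.
Proof.
have fl : linear (fun x : V => r *: x).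
  by move=> a x y; rewrite scalerDr !scalerA mulrC.
by exists (mklin fl).
Qed.

(* A minimal ideal [I] that is not finitely generated satisfies [r I = I] or   *)
(* [r I = 0] for every [r], so it is a vector space over a residue field; a    *)
(* map [I -> J] not vanishing at [x] then splits off the line [R x].           *)
Lemma noetherian_ring : noetherian R^o.
Proof.
move=> I0 sI0; apply: contrapT => nfg0.
have [|I [sI nfg Imin]] := artR' (P := fun N => ~ fg_sub N); first by exists I0.
have {}Imin N : is_submod N -> (forall x, N x -> I x) -> (exists2 x,
  I x & ~ N x) -> fg_sub N.
  move=> sN le [x Ix nNx]; apply: contrapT => nfgN; apply: nNx; exact: (Imin N).
pose P (r : R^o) := forall x, I x -> (r : R) *: x = 0.
have dich (r : R) : ~ P r -> forall x, I x -> exists2 y, I y & x = r *: y.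
  move=> nP x Ix; apply: contrapT => nx; have [f fP] := hom_mul R^o r.
  apply: nP => y Iy; apply: contrapT => ny; apply: nfg.
  apply: (fg_sub_ext (f := f)) => //.
    apply: Imin; first exact: submod_im.
      by move=> _ [z Iz <-]; rewrite fP; apply: submodZ.
    by exists x => // -[z Iz E]; apply: nx; exists z; rewrite // -E fP.
  apply: Imin; [exact: (submod_cap sI (submod_ker f))|by move=> z []|].
  by exists y => // -[_]; rewrite fP.
have mP : is_maximal P.
  split=> [|P1|r nPr].
  - split=> [x Ix|a r s Pr Ps x Ix]; first by rewrite scale0r.
    by rewrite scalerDl -scalerA Pr // Ps // scaler0 addr0.
  - apply: nfg; exists 0%N, (fun=> 0); split=> [[]//|x Ix]; exists (fun=> 0).
    by rewrite big_ord0 -[x]scale1r P1.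
  (* Multiplication by [r] is onto [I], so every x of [I] is r^n y; the stationary chain of powers,
     r^n = s r^(n+1), then shows that s inverts r modulo [P]. *)
  have [|N [sN [n NE] Nmin]] := artR' (P :=
    fun N => exists n, N = fun y => exists a, y = a *: (r ^+ n : R^o)).
    by exists (fun y => exists a, y = a *: (r ^+ 0 : R^o));
      [exact: submod_cyclic|exists 0%N].
  have [||||s sE] := Nmin (fun y => exists a,
    y = a *: (r ^+ n.+1 : R^o)) _ _ _ (r ^+ n).
  - exact: submod_cyclic.
  - by exists n.+1.
  - by move=> _ [a ->]; rewrite NE; exists (a * r); rewrite -scalerA exprS.
  - by rewrite NE; exists 1; rewrite scale1r.
  exists s => x Ix.
  have [y Iy ->] : exists2 y, I y & x = r ^+ n *: y.
    elim: n {N sN NE Nmin sE} => [|n [y Iy ->]]; first by exists x; rewrite ?scale1r.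
    have [z Iz ->] := dich r nPr y Iy.
    by exists z => //; rewrite scalerA -exprSr.
  rewrite scalerA mulrBl mul1r -mulrA -exprS.
  by rewrite {1}(sE : r ^+ n = s * r ^+ n.+1) subrr scale0r.
have [x Ix x0] : exists2 x, I x & x <> 0.
  apply: contrapT => H; case: mP => _ + _; apply => x Ix.
  by rewrite scale1r; apply: contrapT => x0; apply: H; exists x.
have [f fx] := envelope_cogenerates x0.
have kf z : I z -> killed P (f z) by move=> Iz r Pr; rewrite -linearZ Pr // linear0.
apply: nfg; apply: (fg_sub_ext (f := f)) => //.
  exists 1%N, (fun=> f x); split=> [_|_ [z Iz <-]]; first by exists x.
  have [s ->] := envelope_simple mP (kf x Ix) (kf z Iz) fx.
  by exists (fun=> s); rewrite big_ord1.
apply: Imin; [exact: (submod_cap sI (submod_ker f))|by move=> z []|].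
by exists x => // -[].
Qed.

Lemma noetherian_fg_ring V : fin_gen V -> noetherian V.
Proof.
move: V; apply: fin_gen_ind; first exact: noetherian_ring.
  by move=> V W p; apply: noetherian_surj.
by move=> X V Y i p; apply: noetherian_ext.
Qed.

Lemma artinian_fg_ring V : fin_gen V -> artinian V.
Proof.
move: V; apply: fin_gen_ind; first exact: artR'.
  by move=> V W p; apply: artinian_surj.
by move=> X V Y i p; apply: artinian_ext.
Qed.

(* Noetherian induction on [K] shows that the part of [J] killed by [K] is     *)
(* finitely generated: multiply by [x] with [m x] inside [K], [m] maximal.     *)
Lemma envelope_fin_gen : fin_gen J.
Proof.
apply: contrapT => nfg.
have [|K [sK nfgK Kmax]] := noetherian_max noetherian_ring
    (P := fun K => ~ fg_sub (fun y : J => killed K y)).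
  exists (fun r => r = 0); first exact: submod_zero.
  move=> h; apply: nfg; apply/fg_subT.
  suff -> : (fun _ : J => True) = (fun y => killed (fun r : R^o => r = 0) y) by [].
  by apply: funext => y; apply/propext; split=> // _ r ->; rewrite scale0r.
have [|x [nKx mm]] := annihilated_maximal artR' sK.
  exists 1 => K1; apply: nfgK; exists 0%N, (fun=> 0); split=> [[]//|x kx].
  by exists (fun=> 0); rewrite big_ord0 -[x]scale1r kx.
have sK' := submod_add sK (submod_cyclic x).
have KK' : forall r, K r -> exists y z, [/\ K y, exists a, z = a *: x & r = y + z].
  by move=> r Kr; exists r, 0; split=> //; [exists 0; rewrite scale0r|rewrite addr0].
have fgK' : fg_sub (fun y : J => killed (fun z => exists r a, [/\ K r, exists b,
  a = b *: x & z = r + a]) y).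
  apply: contrapT => nf; apply: nKx; apply: (Kmax _ sK' nf KK').
  exists 0, x; split; [by case: sK| |by rewrite add0r].
  by exists 1; rewrite scale1r.
have [f fP] := hom_mul J x.
have sJK : is_submod (fun y : J => killed K y).
  split=> [r _|a y z ky kz r Kr]; first by rewrite scaler0.
  by rewrite scalerDr kz // scalerA mulrC -scalerA ky // scaler0 addr0.
have kf y : killed K y -> killed (fun r => K (r *: x)) (f y).
  by move=> ky r Kr; rewrite fP scalerA; apply: ky.
apply: nfgK; apply: (fg_sub_ext (f := f)) => //.
  case: (EM (exists2 y, killed K y & f y <> 0)) => [[y0 k0 f0]|H].
    exists 1%N, (fun=> f y0); split=> [_|_ [y ky <-]]; first by exists y0.
    have [s ->] := envelope_simple mm (kf _ k0) (kf _ ky) f0.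
    by exists (fun=> s); rewrite big_ord1.
  exists 0%N, (fun=> 0); split=> [[]//|_ [y ky <-]].
  exists (fun=> 0); rewrite big_ord0; apply: contrapT => f0; apply: H.
  by exists y.
case: fgK' => n [g [gK gP]]; exists n, g; split=> [k|y [ky fy]].
  split=> [r Kr|]; first by apply: gK; apply: KK'.
  rewrite fP; apply: gK; exists 0, x; split; [by case: sK| |by rewrite add0r].
  by exists 1; rewrite scale1r.
apply: gP => _ [r [_ [Kr [b ->] ->]]].
by rewrite scalerDl ky // -scalerA -fP fy scaler0 addr0.
Qed.

End ArtinianRing.

(** * Restriction of scalars and simple elements *)

Section Restriction.
Context (R : comNzRingType) (L : algType R) (X : lmodType L).

(** An alias with the same elements and addition, on which the R-module structure through R -> L can
    be declared. *)
Definition restr : Type := X.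

HB.instance Definition _ := GRing.Zmodule.on restr.

Definition restr_scale (r : R) (x : restr) : restr := (r%:A : L) *: (x : X).

Fact restr_scalerA a b x : restr_scale a (restr_scale b x) = restr_scale (a * b) x.
Proof. by rewrite /restr_scale scalerA mulr_algl scalerA. Qed.
Fact restr_scale1 : left_id 1 restr_scale.
Proof. by move=> x; rewrite /restr_scale scale1r scale1r. Qed.
Fact restr_scaleDr : right_distributive restr_scale +%R.
Proof. by move=> a x y; rewrite /restr_scale scalerDr. Qed.
Fact restr_scaleDl x : {morph restr_scale^~ x : a b / a + b}.
Proof. by move=> a b; rewrite /restr_scale !scalerDl. Qed.

HB.instance Definition _ := GRing.Zmodule_isLmodule.Build R restr
  restr_scalerA restr_scale1 restr_scaleDr restr_scaleDl.

End Restriction.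

Section SimpleElements.
Context (A : pzRingType).
Implicit Types (X : lmodType A).

(** A generator of a simple submodule; socles are handled through these elements. *)
Definition simple_elt X (u : X) : Prop :=
  u <> 0 /\ forall a : A, a *: u <> 0 -> exists c : A, c *: (a *: u) = u.

Lemma simple_elt_scale X (u : X) b : simple_elt u -> b *: u <> 0 -> simple_elt (b *: u).
Proof.
case=> u0 h bu0; split=> // a abu0; have [|c cE] := h (a * b);
  first by rewrite -scalerA.
by exists (b * c); rewrite -scalerA [a *: _]scalerA cE.
Qed.

Lemma simple_elt_exists X (N : X -> Prop) x : artinian X -> is_submod N -> N x ->
  x <> 0 ->
  exists2 u, N u & simple_elt u.
Proof.
move=> aX sN Nx x0.
have [|K [sK [le [u Ku u0]] Kmin]] := aX (fun K => (forall y,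
  K y -> N y) /\ exists2 y, K y & y <> 0).
  by exists N => //; split=> //; exists x.
exists u; [exact: le|split=> // a au0].
have [|||c cE] := Kmin (fun y => exists c, y = c *: (a *: u)) _ _ _ u Ku.
- exact: submod_cyclic.
- split=> [_ [c ->]|]; first by do 2![apply: submodZ => //]; apply: le.
  by exists (a *: u) => //; exists 1; rewrite scale1r.
- by move=> _ [c ->]; do 2![apply: submodZ => //].
by exists c.
Qed.

Lemma maximal_submodule_exists X (N : X -> Prop) x : noetherian X -> is_submod N ->
  ~ N x ->
  exists K : X -> Prop, [/\ is_submod K, forall y, N y -> K y, exists y, ~ K y &
    forall y z, ~ K y -> exists c, K (z - c *: y)].
Proof.
move=> nX sN nNx.
have [|K [sK [le [y0 nKy0]] Kmax]] := noetherian_max nX (P :=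
  fun K => (forall y, N y -> K y) /\ exists y, ~ K y).
  by exists N => //; split=> //; exists x.
exists K; split=> //; first by exists y0.
move=> y z nKy; apply: contrapT => H; apply: nKy.
have sK' := submod_add sK (submod_cyclic y).
apply: (Kmax _ sK') => [|w Kw|].
- split=> [w /le Kw|]; first by exists w, 0; split; rewrite ?addr0 //; exists 0;
  rewrite scale0r.
  by exists z => -[w [_ [Kw [c ->] E]]]; apply: H; exists c; rewrite E addrK.
- by exists w, 0; split; rewrite ?addr0 //; exists 0; rewrite scale0r.
by exists 0, y; split; rewrite ?add0r //; [case: sK|exists 1; rewrite scale1r].
Qed.

End SimpleElements.

(** * Primitive idempotents of artin algebras *)

Section Principal.
Context (A : nzRingType).

(** The generator is the class of e. Later arguments see (A / A x A) e only through this generator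
    and its annihilator. *)
Lemma principalP (x e : A) : e * e = e ->
  exists g : principal x e, [/\ Mod x (principal x e), e *: g = g,
    forall p, exists a, p = a *: g & forall a : A, a *: g = 0 <-> a * e \in ideal x].
Proof.
move=> ee; pose S := ideal x : submodClosed A^o.
have piZ (a : A) : a *: (\pi_(quotmod S) (e : A^o))%qT = (\pi_(quotmod S) (a * e :
  A^o))%qT.
  exact: quotmod_scaleE.
have gP : (\pi_(quotmod S) (e : A^o))%qT \in cyclic_pred (\pi_(quotmod S) (e : A^o))%qT.
  by apply/asboolP; exists 1; rewrite scale1r.
pose g : principal x e := Cyclic gP.
have pi0 (a : A) : (\pi_(quotmod S) (a : A^o))%qT = 0 :> quotmod S <-> a \in ideal x.
  have pl : linear (\pi_(quotmod S)%qT : A^o -> quotmod S).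
    by move=> b y z; rewrite quotmod_piD -quotmod_scaleE.
  rewrite -(linear0 (mklin pl)); by split=> [/quotmod_piP|h]; [|apply/quotmod_piP];
    rewrite subr0.
have g0 (a : A) : a *: g = 0 <-> a * e \in ideal x.
  rewrite -pi0 -piZ; split=> [/(congr1 val)//|E]; exact: val_inj.
have gen p : exists a, p = a *: g.
  case: p => p pP; have /asboolP[a aE] := pP; exists a; exact: val_inj.
exists g; split=> //.
  move=> a p ax; have [b ->] := gen p; rewrite scalerA; apply/g0.
  have /asboolP[n [c [d ->]]] := ax; apply/asboolP; exists n, c, (fun i => d i * b * e).
  by rewrite !big_distrl; apply: eq_bigr => i _; rewrite !mulrA.
by apply: val_inj; rewrite /= piZ ee.
Qed.

End Principal.

Lemma geometric_sum (A : pzRingType) (a : A) n :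
  (\sum_(i < n) a ^+ i) * (1 - a) = 1 - a ^+ n.
Proof.
elim: n => [|n IH]; first by rewrite big_ord0 mul0r subrr.
by rewrite big_ord_recr mulrDl IH /= mulrBr mulr1 -exprSr addrA subrK.
Qed.

Section ArtinAlgebra.
Context (R : comNzRingType) (L : algType R) (J : lmodType R).
Implicit Types (X Y Q : lmodType L) (x e : L).

Lemma restr_submod X (N : X -> Prop) : is_submod N -> is_submod (N : restr X -> Prop).
Proof. by case=> N0 h; split=> // a y z; apply: h. Qed.

Lemma restr_linear X Y (f : {linear X -> Y}) : linear (f : restr X -> restr Y).
Proof. by move=> a y z; rewrite /= -linearP. Qed.

Hypothesis artL : artin_algebra L.
Hypothesis envJ : injective_envelope (semisimple_quotient R) J.

Let artR : artinian_module R^o := proj1 artL.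

Lemma restr_fin_gen X : fin_gen X -> fin_gen (restr X).
Proof.
case=> n [g gP]; case: artL => _ [k [l lP]].
apply: (@fin_gen_finType _ (restr X) ('I_n * 'I_k)%type (fun t => l t.2 *: g t.1)) => y.
have [c ->] := gP y; have [d dP] := choice (fun i => lP (c i)).
exists (fun t => d t.1 t.2); rewrite -(pair_big predT predT
  (fun i j => (d i j : R) *: (l j *: g i : restr X))) /=.
apply: eq_bigr => i _; rewrite [in LHS]dP scaler_suml; apply: eq_bigr => j _.
by rewrite -[RHS]/((_)%:A *: (_ *: _)) scalerA mulr_algl.
Qed.

Lemma noetherian_fg X : fin_gen X -> noetherian X.
Proof.
move=> /restr_fin_gen/(noetherian_fg_ring artR envJ) nX N /restr_submod/nX[n [g [gN
  gP]]].
exists n, g; split=> // y /gP[c ->]; exists (fun i => (c i)%:A); exact: eq_bigr.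
Qed.

Lemma artinian_fg X : fin_gen X -> artinian X.
Proof.
move=> /restr_fin_gen/(artinian_fg_ring artR) aX P [N sN PN].
have [|K [sK [sK' PK] Kmin]] := aX (fun K => is_submod (K : X -> Prop) /\ P K).
  by exists N; [exact: restr_submod|].
exists K; split=> // K' sK1 PK' le; apply: Kmin => //; exact: restr_submod.
Qed.

Lemma fin_gen_inj X Y (f : {linear X -> Y}) : injective f -> fin_gen Y -> fin_gen X.
Proof. by move=> fi /noetherian_fg/(noetherian_inj fi)/noetherian_fin_gen. Qed.

Lemma fin_gen_regular : fin_gen L^o.
Proof.
by exists 1%N, (fun=> 1) => y; exists (fun=> y);
  rewrite big_ord1 -[_ *: _]/(_ * _) mulr1.
Qed.

Section Primitive.
Context (e : L).
Hypothesis pe : primitive_idempotent e.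

Let ee : e * e = e. Proof. by case: pe. Qed.
Let e0 : e <> 0. Proof. by case: pe. Qed.

(* Fitting's lemma for right multiplication by [a] on [L e]. *)
Lemma corner_nilpotent_or_unit a : e * a * e = a ->
  (exists n, a ^+ n.+1 = 0) \/ exists c, c * a = e.
Proof.
move=> eae; have ea : e * a = a by rewrite -eae !mulrA ee.
have ae : a * e = a by rewrite -eae -!mulrA ee.
have [|N1 [_ [n NE] Nmin]] := artinian_fg fin_gen_regular (P :=
  fun N => exists n, N = fun y => exists b, y = b *: (a ^+ n : L^o)).
  by exists (fun y => exists b, y = b *: (a ^+ 0 : L^o));
    [exact: submod_cyclic|exists 0%N].
have [|K [_ [k KE] Kmax]] := noetherian_max (noetherian_fg fin_gen_regular) (P :=
  fun N => exists n, N = fun y : L^o => (y : L) * a ^+ n = 0).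
  exists (fun y : L^o => (y : L) * a ^+ 0 = 0); last by exists 0%N.
  split=> [|b y z yE zE]; first by rewrite mul0r.
  by rewrite -[b *: y]/((b : L) * (y : L)) mulrDl -mulrA yE zE mulr0 addr0.
(* Beyond both stationary indices: [n] for the left ideals L a^i and [k] for the left annihilators
   of a^i. The successor makes [m] positive, so that e a^m = a^m. *)
pose m := (n + k).+1.
have [b bE] : exists b, a ^+ m = b * a ^+ (m + m).
  have [|||| b bE] := Nmin (fun y => exists b,
    y = b *: (a ^+ (m + m) : L^o)) _ _ _ (a ^+ n).
  - exact: submod_cyclic.
  - by exists (m + m)%N.
  - move=> _ [c ->]; rewrite NE; exists (c * a ^+ (m + m - n)).
    rewrite -[_ *: _]/(c * _) -[RHS]/(c * _ * _) -mulrA -exprD subnK //.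
    by rewrite /m addSn leqW // -addnA leq_addr.
  - by rewrite NE; exists 1; rewrite scale1r.
  exists (a ^+ k.+1 * b); rewrite -mulrA.
  have <- : a ^+ n = b * a ^+ (m + m) := bE.
  by rewrite -exprD /m addSn addnC.
have ker w : w * a ^+ (m + m) = 0 -> w * a ^+ m = 0.
  move=> wE; have : K w.
    apply: (Kmax (fun y : L^o => (y : L) * a ^+ (m + m) = 0)) => //.
    - split=> [|c y z yE zE]; first by rewrite mul0r.
      by rewrite -[c *: y]/((c : L) * (y : L)) mulrDl -mulrA yE zE mulr0 addr0.
    - by exists (m + m)%N.
    move=> y; rewrite KE => yE; have -> : (m + m = k + (m + m - k))%N.
      by rewrite subnKC // /m addSn leqW // addnAC leq_addl.
    by rewrite exprD mulrA yE mul0r.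
  rewrite KE => wk; have -> : (m = k + n.+1)%N by rewrite /m addnC addnS.
  by rewrite exprD mulrA wk mul0r.
have eam : e * a ^+ m = a ^+ m by rewrite /m exprS mulrA ea.
have ame : a ^+ m * e = a ^+ m by rewrite /m exprSr -mulrA ae.
(* [u] projects onto the part where [a] is invertible and [v] onto the part where it is nilpotent.
   They are orthogonal idempotents with sum [e], so primitivity kills one of them. *)
pose u := e * b * a ^+ m; pose v := e - u.
have eu : e * u = u by rewrite /u !mulrA ee.
have ue : u * e = u by rewrite /u -mulrA ame.
have vam : v * a ^+ m = 0.
  by rewrite mulrBl eam /u -!mulrA -exprD -bE eam subrr.
have uv : u * v = 0.
  have E : u * v = (e * b - u * (e * b)) * a ^+ m.
    by rewrite /v mulrBr ue mulrBl -[u * (e * b) * _]mulrA.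
  by rewrite E; apply: ker; rewrite exprD mulrA -E -mulrA vam mulr0.
have uu : u * u = u by apply/eqP; rewrite eq_sym -subr_eq0 -{1}ue -mulrBr uv.
have vu : v * u = 0 by rewrite mulrBl eu uu subrr.
have vv : v * v = v by rewrite {1}/v mulrBl uv subr0 mulrBr ee eu.
case: pe => _ _ /(_ u v uu vv uv vu) []; first by rewrite /v addrC subrK.
  by move=> u0; left; exists (n + k)%N; rewrite -/m -eam -[e](subr0) -u0 -/v vam.
move=> v0; right; exists (e * b * a ^+ (n + k)).
by rewrite -mulrA -exprSr -/m -/u; apply/esym/eqP; rewrite -subr_eq0 -/v v0.
Qed.

(** If the first summand is nilpotent, the second is e minus a nilpotent and a geometric series
    inverts it. Thus e L e is local. *)
Lemma corner_sum a b : e = e * a * e + e * b * e ->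
  (exists c, c * (e * a * e) = e) \/ (exists c, c * (e * b * e) = e).
Proof.
move=> E; have Ea : e * (e * a * e) * e = e * a * e by rewrite !mulrA ee -[LHS]mulrA ee.
case: (corner_nilpotent_or_unit Ea) => [[n nil]|]; last by left.
right; exists (\sum_(i < n.+1) (e * a * e) ^+ i).
have -> : e * b * e = (1 - e * a * e) * e.
    by rewrite mulrBl mul1r -[e * a * e * e]mulrA ee {3}E addrC addKr.
by rewrite mulrA geometric_sum nil subr0 mul1r.
Qed.

End Primitive.
End ArtinAlgebra.

(** * Locality of corner rings, and basic families of idempotents *)

Section Local.
Context (R : comNzRingType) (L : algType R) (J : lmodType R).
Implicit Types (X Y Q : lmodType L) (x e : L).

Hypothesis artL : artin_algebra L.
Hypothesis envJ : injective_envelope (semisimple_quotient R) J.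

Section OneIdempotent.
Context (e : L).
Hypothesis pe : primitive_idempotent e.

Let ee : e * e = e. Proof. by case: pe. Qed.
Let e0 : e <> 0. Proof. by case: pe. Qed.

(** The product in the other order is a nonzero idempotent of the corner, so primitivity makes it
    e. *)
Lemma left_inverse_right a c : e * a * e = a -> c * a = e -> a * (e * c * e) = e.
Proof.
move=> eae ca.
have ea : e * a = a by rewrite -eae !mulrA ee.
have ae : a * e = a by rewrite -eae -!mulrA ee.
pose u := a * (e * c * e).
have eu : e * u = u by rewrite /u mulrA ea.
have ue : u * e = u by rewrite /u -!mulrA ee.
have ua : u * a = a by rewrite /u -!mulrA ea ca ee ae.
have uu : u * u = u by rewrite {2}/u mulrA ua.
have [] : u = 0 \/ e - u = 0.
- case: pe => _ _; apply=> //; last by rewrite addrC subrK.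
  + by rewrite /idempotent_elt mulrBr !mulrBl ee eu ue uu subrr subr0.
  + by rewrite mulrBr ue uu subrr.
  + by rewrite mulrBl eu uu subrr.
- by move=> u0; case: e0; rewrite -ca -ua u0 mul0r mulr0.
by move/eqP; rewrite subr_eq0 => /eqP.
Qed.

Lemma corner_unit_sum a b c : c * (e * (a + b) * e) = e ->
  (exists d, d * (e * a * e) = e) \/ (exists d, d * (e * b * e) = e).
Proof.
move=> E.
have E' : e = e * (c * e * a) * e + e * (c * e * b) * e.
  rewrite -mulrDl -!mulrDr; transitivity (e * (c * (e * (a + b) * e))).
    by rewrite E ee.
  by rewrite !mulrA.
by case: (corner_sum artL envJ pe E') => -[d dE]; [left|right]; exists (d * e * c);
  rewrite -!mulrA in dE *.
Qed.

Lemma corner_unit_big (T : finType) (F : T -> L) c : c * (e * (\sum_t F t) * e) = e ->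
  exists t d, d * (e * F t * e) = e.
Proof.
pose U y := exists d, d * (e * y * e) = e.
suff : U (\sum_t F t) -> exists t, U (F t) by move=> h cE; apply: h; exists c.
elim/big_ind: _ => [[d]|y z IHy IHz [d /corner_unit_sum[/IHy|/IHz]]|t _ Ut] //.
  by rewrite mulr0 mul0r mulr0 => /esym.
by exists t.
Qed.

Lemma principal_local x (g : principal x e) a b :
    (forall a : L, a *: g = 0 <-> a * e \in ideal x) -> e *: g = g ->
    a *: g + b *: g = g ->
  (exists c, c *: (a *: g) = g) \/ (exists c, c *: (b *: g) = g).
Proof.
move=> g0 eg abg.
have zg : (a + b - 1) *: g = 0 by rewrite scalerBl scalerDl abg scale1r subrr.
(* a + b acts as 1 on [g] only up to the annihilator of [g]. Subtracting from [a] the element [z],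
   which kills [g], gives a sum that fixes [e] in L itself, where [corner_unit_sum] applies. *)
pose z := (a + b - 1) * e.
have Ez : e * (e * ((a - z) + b) * e) = e.
  have -> : (a - z) + b = a + b - z by rewrite addrAC.
  by rewrite -!mulrA mulrBl /z -mulrA ee -mulrBl opprB addrCA subrr addr0 mul1r !ee.
have [[d dE]|[d dE]] := corner_unit_sum Ez; [left|right]; exists (d * e).
  have := congr1 (fun t : L => t *: g) dE.
  by rewrite -!scalerA eg scalerBl -[z *: g]scalerA eg zg subr0.
have := congr1 (fun t : L => t *: g) dE.
by rewrite -!scalerA eg.
Qed.

End OneIdempotent.

Section Basic.
Context (I : finType) (e : I -> L).
Hypothesis ce : complete_primitive_orthogonal e.
Hypothesis be : basic_idempotents e.

Let pe i : primitive_idempotent (e i). Proof. by case: ce. Qed.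
Let ee i : e i * e i = e i. Proof. by case: (pe i). Qed.

(** If e_j were a sum of terms a e_k b with k in U, locality would make one of them invertible in
    e_j L e_j. Right multiplications p and q then exhibit L e_j as a summand of L e_k, and q p is a
    nonzero idempotent under e_k, hence e_k. So the two modules are isomorphic, and basicness gives
    j = k. *)
Lemma idem_not_in_ideal j (U : {set I}) : j \notin U -> e j \notin ideal (idem_sum e U).
Proof.
move=> jU; apply/negP => /asboolP[n [a [b E]]].
pose F (t : 'I_n * I) := if t.2 \in U then a t.1 * e t.2 * b t.1 else 0.
have EF : e j = \sum_t F t.
  rewrite E (eq_bigr (fun i => \sum_k F (i, k))) => [|i _].
    by rewrite pair_big /=; apply: eq_bigr => -[].
  rewrite /idem_sum mulr_sumr mulr_suml /F /= -big_mkcond.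
  exact: eq_bigr.
have [|[i k] [c cE]] := corner_unit_big (pe j) (F := F) (c := e j).
  by rewrite -EF !ee.
move: cE; rewrite /F /=; case: ifP => kU; last first.
  rewrite mulr0 mul0r mulr0 => /esym; by case: (pe j).
set p0 := a i; set q0 := b i => cE.
pose p := e j * c * e j * p0 * e k; pose q := e k * q0 * e j.
have pq : p * q = e j.
  transitivity (e j * (c * (e j * (p0 * e k * q0) * e j))); last by rewrite cE ee.
  by rewrite /p /q -!mulrA [e k * (e k * _)]mulrA ee.
have ejp : e j * p = p by rewrite /p !mulrA ee.
have pek : p * e k = p by rewrite /p -!mulrA ee.
have ekq : e k * q = q by rewrite /q !mulrA ee.
have qej : q * e j = q by rewrite /q -!mulrA ee.
pose u := q * p.
have uu : u * u = u by rewrite /u mulrA -[q * p * q]mulrA pq qej.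
have eu : e k * u = u by rewrite /u mulrA ekq.
have ue : u * e k = u by rewrite /u -mulrA pek.
have qp : q * p = e k.
  have [] : u = 0 \/ e k - u = 0.
  - case: (pe k) => _ _; apply=> //; last by rewrite addrC subrK.
    + by rewrite /idempotent_elt mulrBr !mulrBl ee eu ue uu subrr subr0.
    + by rewrite mulrBr ue uu subrr.
    + by rewrite mulrBl eu uu subrr.
  - move=> u0; case: (pe j) => _ []; rewrite -(ee j) -pq.
    by rewrite mulrA -[p * q * p]mulrA -/u u0 mulr0 mul0r.
  by move/eqP; rewrite subr_eq0 => /eqP.
have mul (s t : I) (w : L) : (exists d,
  e s * w = d * e t) -> exists f : {linear cyclic (e s : L^o) -> cyclic (e t : L^o)},
    forall z, val (f z) = val z * w.
  case=> d wE; have fl : linear (fun z : cyclic (e s : L^o) => (val z : L) * w : L^o).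
    move=> r z z'; have -> : val (r *: z + z') = (r : L) * val z + val z' by [].
    by rewrite mulrDl -mulrA.
  have vl : linear (val : cyclic (e t : L^o) -> L^o) by [].
  have [||f fP] := @factor_inj _ _ _ _ (mklin vl) (mklin fl); last by exists f.
    exact: val_inj.
  move=> [z zP]; have /asboolP[r rE] := zP.
  have wP : (z * w : L^o) \in cyclic_pred (e t : L^o).
    by apply/asboolP; exists (r * d); rewrite rE -[_ *: _]/(r * _) -mulrA wE mulrA.
  by exists (Cyclic wP).
have [f fP] : exists f : {linear cyclic (e j : L^o) -> cyclic (e k : L^o)}, forall z,
  val (f z) = val z * p.
  by apply: mul; exists p; rewrite ejp pek.
have [g gP] : exists f : {linear cyclic (e k : L^o) -> cyclic (e j : L^o)}, forall z,
  val (f z) = val z * q.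
  by apply: mul; exists q; rewrite ekq qej.
have cyc (s : I) (z : cyclic (e s : L^o)) : (val z : L) * e s = val z.
  have /asboolP[r ->] := valP z; rewrite -[_ *: _]/(r * _); by rewrite -mulrA ee.
have E' : iso (cyclic (e j : L^o)) (cyclic (e k : L^o)).
  exists f, g => z; apply: val_inj.
    by rewrite gP fP -mulrA pq cyc.
  by rewrite fP gP -mulrA qp cyc.
by move: kU jU; rewrite (be E') => ->.
Qed.

End Basic.
End Local.

(** * Indecomposable injective modules *)

Section Coinduced.
Context (R : comNzRingType) (L : algType R) (J : lmodType R).
Implicit Types (X Y Q : lmodType L) (x e : L).

Hypothesis artL : artin_algebra L.
Hypothesis envJ : injective_envelope (semisimple_quotient R) J.

Let artR : artinian_module R^o := proj1 artL.

Lemma ideal_converse x a : (a : L^c) \in ideal (x : L^c) <-> a \in ideal x.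
Proof.
split=> /asboolP[n [b [c E]]]; apply/asboolP; exists n, c, b; rewrite E;
  apply: eq_bigr => i _.
  by rewrite -[LHS]/((c i : L) * (x * b i)) mulrA.
by rewrite -[RHS]/((b i : L) * (x * c i)) mulrA.
Qed.

(* [Q] represents the functor [X |-> Hom_R(e X, J)] on modules over            *)
(* [L / L x L]; [tau] is the universal element.                                *)
Definition coinduced x e Q : Prop :=
  Mod x Q /\ exists tau : {linear restr Q -> J},
  [/\ forall q : Q, tau (e *: q) = tau q,
      forall q : Q, (forall a : L, tau (a *: q) = 0) -> q = 0 &
      forall X, Mod x X -> forall psi : {linear restr X -> J},
        exists Phi : {linear X -> Q}, forall m : X, tau (Phi m) = psi (e *: m)].

(** The universal element is evaluation at the generator g of e (L / L x L). A functional psi on X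
    corresponds to m |-> (g a |-> psi (e a m)), well defined because the ideal kills X. *)
Lemma dual_coinduced x e : e * e = e ->
  coinduced x e (dual J (principal (x : L^c) (e : L^c))).
Proof.
move=> ee; pose P : lmodType L^c := principal (x : L^c) (e : L^c).
have [g [MP eg gen g0]] := @principalP L^c x e ee.
have g0' (a : L) : (a : L^c) *: g = 0 <-> e * a \in ideal x.
  by rewrite g0 -ideal_converse.
have dualD (f : dual J P) (u v : P) : dual_fun f (u + v) = dual_fun f u + dual_fun f v.
  have /asboolP h := valP f; by have := h 1 u v; rewrite !scale1r.
have dualZ (f : dual J P) (r : R) (u : P) : dual_fun f ((r%:A : L^c) *: u) = r *:
  dual_fun f u.
  have /asboolP h := valP f; have := h r u 0; rewrite addr0 => ->.
  by have := h 1 0 0; rewrite scaler0 scale1r addr0 => /eqP;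
    rewrite eq_sym -subr_eq0 addrK => /eqP ->; rewrite addr0.
split.
  move=> a f ax; apply: val_inj; apply: funext => u.
  rewrite -[LHS]/(dual_fun f ((a : L^c) *: u)) MP; last exact/ideal_converse.
  by rewrite -(scale0r 0) -[0 : L^c](scale0r (1 : L^c)) dualZ scale0r.
have taul : linear (fun f : restr (dual J P) => dual_fun f g).
  by move=> r f h; rewrite -[LHS]/(dual_fun f ((r%:A : L^c) *: g) + dual_fun h g) dualZ.
exists (mklin taul); split=> [f|f f0|X MX psi].
- by rewrite -[LHS]/(dual_fun f ((e : L^c) *: g)) eg.
- by apply: val_inj; apply: funext => u; have [a ->] := gen u; exact: f0.
have [c cE] := choice gen.
pose F (m : X) (n : P) : J := psi (e * (c n : L) *: m).
have wd (a b : L) m : (a : L^c) *: g = (b : L^c) *: g ->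
  psi (e * a *: m) = psi (e * b *: m).
  move=> E; apply/eqP; rewrite -subr_eq0; apply/eqP.
  transitivity (psi (e * (a - b) *: m)); first by rewrite mulrBr scalerBl (linearB psi).
  by rewrite MX; [exact: linear0|apply/g0'; rewrite scalerBl E subrr].
have FE m (a : L) : F m ((a : L^c) *: g) = psi (e * a *: m).
  by apply: wd; rewrite -cE.
have FP m : F m \in @dual_pred R L J P.
  apply/asboolP => r u v; have [a ->] := gen u; have [b ->] := gen v.
  rewrite scalerA -scalerDl !FE.
  have -> : e * ((r%:A : L^c) * (a : L^c) + b) *: m = r *: (e * a *: m : restr X) + e
    * b *: m.
    rewrite -[(r%:A : L^c) * _]/((a : L) * r%:A) mulrDr scalerDl; congr (_ + _).
    rewrite -[RHS]/(r%:A *: (e * a *: m)) scalerA; congr (_ *: m).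
    by rewrite mulr_algl mulr_algr scalerAr.
  by rewrite linearP.
pose Phi (m : X) : dual J P := Dual (FP m).
have Phil : linear Phi.
  move=> a m m'; apply: val_inj; apply: funext => u; have [b ->] := gen u.
  rewrite -[RHS]/(F m ((a : L^c) *: ((b : L^c) *: g)) + F m' ((b : L^c) *: g)) scalerA.
  rewrite -[LHS]/(F (a *: m + m') ((b : L^c) *: g)) !FE.
  rewrite -[(a : L^c) * b]/((b : L) * a) scalerDr scalerA mulrA.
  exact: (linearD psi).
exists (mklin Phil) => m; rewrite -[LHS]/(F m g) -[g in LHS](scale1r g) FE.
by rewrite mulr1.
Qed.

Section Theory.
Context (x e : L) (Q : lmodType L).
Hypothesis ee : e * e = e.
Hypothesis coQ : coinduced x e Q.

Lemma restr_cogenerates X (m : X) : m <> 0 -> exists f : {linear restr X -> J},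
  f m <> 0.
Proof. exact: (@envelope_cogenerates R J artR envJ (restr X)). Qed.

Lemma coinduced_separates X m : Mod x X -> e *: m <> 0 -> exists f : {linear X -> Q},
  f m <> 0.
Proof.
case: coQ => _ [tau [_ _ ex]] MX /restr_cogenerates[psi psi0].
have [f fE] := ex X MX psi; exists f => fm; apply: psi0.
by rewrite -fE fm; apply: linear0.
Qed.

Lemma coinduced_hom0 X : Mod x X -> hom_zero X Q <-> forall m : X, e *: m = 0.
Proof.
move=> MX; split=> [h m|h f m].
  by apply: contrapT => /(coinduced_separates MX)[f]; apply; apply: h.
case: coQ => _ [tau [taue tau0 _]]; apply: tau0 => a.
by rewrite -taue -!linearZ h linear0; apply: linear0.
Qed.

(** Injectivity of J extends the functional tau g. The map that the extension represents restricts
    to g, since only q = 0 has tau zero on all its multiples. *)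
Lemma coinduced_injective : injective_in (Mod x) Q.
Proof.
case: coQ => MQ [tau [taue tau0 ex]]; split=> // X Y i g MX MY ii.
pose psi : {linear restr X -> J} := tau \o (mklin (restr_linear g) : {linear restr X
  -> restr Q}).
have [|h hE] := @envelope_extend R J envJ _ _ (mklin (restr_linear i)) psi.
  by move=> v /(proj1 (inj_ker i) ii) ->; apply: linear0.
have [Phi PhiE] := ex Y MY h; exists Phi => m.
apply/eqP; rewrite -subr_eq0; apply/eqP/tau0 => a.
have -> : a *: (Phi (i m) - g m) = Phi (i (a *: m)) - g (a *: m) by rewrite [i (_ *:
  _)]linearZ [Phi (_ *: _)]linearZ [g (_ *: _)]linearZ scalerBr.
rewrite (linearB tau) PhiE -[e *: i _]linearZ.
have -> : h (i (e *: (a *: m))) = tau (e *: g (a *: m)) by rewrite -linearZ; exact: hE.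
by rewrite taue subrr.
Qed.

(** If the l_i span L over R, then q |-> (tau (l_i q)) embeds Q into a power of J, which is finitely
    generated over the noetherian ring R. *)
Lemma coinduced_fin_gen : fin_gen Q.
Proof.
case: coQ => MQ [tau [taue tau0 ex]]; case: (artL) => _ [n [l lP]].
have fl : linear (fun q : restr Q => [ffun i : 'I_n =>
  tau (l i *: (q : Q))] : {ffun 'I_n -> J}).
  move=> r q q'; apply/ffunP => i; rewrite !ffunE -linearP; congr (tau _).
  rewrite -[r *: q]/(r%:A *: (q : Q)) scalerDr scalerA; congr (_ + _).
  by rewrite -[RHS]/(r%:A *: (l i *: (q : Q))) scalerA mulr_algl mulr_algr.
have fi : injective (mklin fl).
  apply/inj_ker => q /ffunP q0; apply: tau0 => a; have [c ->] := lP a.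
  rewrite scaler_suml (linear_sum tau) big1 // => i _.
  rewrite -mulr_algl -scalerA -[_%:A *: _]/(c i *: (l i *: q : restr Q)) linearZ.
  by have := q0 i; rewrite !ffunE /= => ->; rewrite scaler0.
have fgJ : fin_gen {ffun 'I_n -> J}.
  by apply: (biprod_fin_gen (ffun_biprod n J)) => i; apply: envelope_fin_gen.
have /noetherian_fin_gen[k [g gP]] := noetherian_inj fi (noetherian_fg_ring artR envJ
  fgJ).
exists k, g => q; have [c cE] := gP q; exists (fun i => (c i)%:A); exact: cE.
Qed.

Hypothesis pe : primitive_idempotent e.

Let e0 : e <> 0. Proof. by case: pe. Qed.

(** Says that e r generates the right module e L; the products e r that fail to do so form the
    radical of e L. *)
Definition right_unit (r : L) : Prop := exists b, e * r * b = e.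

Lemma right_unit_left r c : c * (e * r * e) = e -> right_unit r.
Proof.
move=> cE; have E : e * (e * r * e) * e = e * r * e by rewrite !mulrA ee -[LHS]mulrA ee.
exists (e * (e * c * e)).
by rewrite mulrA; exact: (left_inverse_right pe E cE).
Qed.

Lemma right_unitD r s : right_unit (r + s) -> right_unit r \/ right_unit s.
Proof.
have sub t b c : c * (e * (t * b) * e) = e -> right_unit t.
  by move=> /right_unit_left[d dE]; exists (b * d); rewrite -[RHS]dE !mulrA.
case=> b bE; have [|[c /sub]|[c /sub]] :=
  @corner_unit_sum R L J artL envJ e pe (r * b) (s * b) e.
- by rewrite -mulrDl [e * (_ * b)]mulrA bE !ee.
- by left.
- by right.
Qed.

(** If w = e r u were nonzero, then u = c w for some c, and w is fixed by e r c e. This element is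
    nilpotent, forcing w = 0, or invertible, making r a right unit. *)
Lemma right_nonunit_kills r (u : Q) : ~ right_unit r -> simple_elt u ->
  e *: (r *: u) = 0.
Proof.
move=> nr [_ su]; apply: contrapT; set w := e *: _ => w0.
have [|c cE] := su (e * r); first by rewrite -scalerA.
have wE : w = (e * (r * c) * e) *: w.
  have ew : e *: w = w by rewrite scalerA ee.
  have cw : c *: w = u by rewrite /w [e *: _]scalerA.
  by rewrite -!scalerA ew cw.
have E : e * (e * (r * c) * e) * e = e * (r * c) * e by rewrite !mulrA ee -[LHS]mulrA
  ee.
have [[n nil]|[d /right_unit_left[b bE]]] := corner_nilpotent_or_unit artL envJ pe E.
  have wn k : w = (e * (r * c) * e) ^+ k *: w.
    elim: k => [|k IH]; first by rewrite scale1r.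
    by rewrite exprS -scalerA -IH.
  by apply: w0; rewrite (wn n.+1) nil scale0r.
by apply: nr; exists (c * b); rewrite -[RHS]bE !mulrA.
Qed.

(** The scalars that map e into the radical of e L; they kill the values of tau on simple elements
    of Q. *)
Definition residue_ideal : R^o -> Prop := fun s : R => ~ right_unit s%:A.

(** If s is a right unit then e = s^n e b^n for all n. The powers of s become stationary, s^n (1 - t
    s) = 0, so 1 - t s cannot be a right unit. *)
Lemma residue_ideal_maximal : is_maximal residue_ideal.
Proof.
split=> [|H|s /contrapT[b bE]].
- split=> [[b]|a s t ns nt].
    by rewrite scale0r mulr0 mul0r => /esym.
  rewrite /residue_ideal; have -> : (a *: s + t)%:A = a%:A * s%:A + t%:A :> L.
    by rewrite scalerDl mulr_algl scalerA.
  case/right_unitD => // -[b bE]; apply: ns; exists (a%:A * b); rewrite -[RHS]bE.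
  have -> : a%:A * s%:A = s%:A * a%:A :> L by rewrite mulr_algl mulr_algr.
  by rewrite !mulrA.
- by apply: H; exists e; rewrite scale1r mulr1 ee.
have sE n : e = (s ^+ n)%:A * e * b ^+ n.
  elim: n => [|n IH]; first by rewrite !expr0 scale1r mul1r mulr1.
  rewrite exprSr exprS {1}IH -{1}bE mulr_algr mulr_algl.
  by rewrite [RHS]mulrA; congr (_ * _); rewrite mulr_algl -!scalerAl scalerA.
have [|N [sN [n NE] Nmin]] := artinian_moduleP artR (P :=
  fun N => exists n, N = fun y => exists a, y = a *: (s ^+ n : R^o)).
  by exists (fun y => exists a, y = a *: (s ^+ 0 : R^o));
    [exact: submod_cyclic|exists 0%N].
have [||||t tE] := Nmin (fun y => exists a, y = a *: (s ^+ n.+1 : R^o)) _ _ _ (s ^+ n).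
- exact: submod_cyclic.
- by exists n.+1.
- by move=> _ [a ->]; rewrite NE; exists (a * s); rewrite -scalerA exprS.
- by rewrite NE; exists 1; rewrite scale1r.
exists t => -[c cE]; apply: e0; rewrite (sE n) -cE.
have -> : (s ^+ n)%:A * (e * (1 - t * s)%:A * c) = (s ^+ n * (1 - t * s))%:A * (e * c)
  :> L.
  by rewrite mulr_algr !mulr_algl -scalerAl scalerA.
suff -> : s ^+ n * (1 - t * s) = 0 by rewrite scale0r !mul0r.
rewrite mulrBr mulr1 mulrCA -exprSr.
by rewrite {1}(tE : s ^+ n = t * s ^+ n.+1) subrr.
Qed.

(* Simple elements of [Q] are functionals on [e L] vanishing on the right      *)
(* nonunits, with values in the line of [J] killed by the residue ideal.  The  *)
(* common kernel of the multiples of [u] consists of nonunits, so [v] vanishes *)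
(* there; finitely many multiples suffice, and injectivity of [J] writes [v]   *)
(* as an [R]-combination of them.                                              *)
Lemma coinduced_uniform (u v : Q) : simple_elt u -> simple_elt v -> exists c,
  v = c *: u.
Proof.
case: coQ => MQ [tau [taue tau0 ex]] su sv; have mm := residue_ideal_maximal.
have simple_killed (w : Q) b : simple_elt w -> killed residue_ideal (tau (b *: w)).
  move=> sw s ms; rewrite -linearZ -[_ *: _]/(s%:A *: (b *: w)) -taue.
  have [->|bw0] := EM (b *: w = 0); first by rewrite !scaler0; apply: linear0.
  by rewrite (right_nonunit_kills ms) ?linear0 //; exact: simple_elt_scale.
pose ker (s : seq L) := fun b : L => forall c, c \in s -> tau (b *: (c *: u)) = 0.
have skr s : is_submod (ker s : (L : lmodType R) -> Prop).
  split=> [c _|r a b ka kb c cs]; first by rewrite scale0r; apply: linear0.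
  rewrite scalerDl (linearD tau) kb // addr0 -mulr_algl -scalerA.
  rewrite -[_%:A *: _]/(r *: (a *: (c *: u) : restr Q)) linearZ.
  by rewrite /= ka // scaler0.
have artLR : artinian (L : lmodType R) by apply: artinian_fg_ring => //; case: artL.
have [|K [_ [s Ks] Kmin]] := artLR (fun K => exists s, K = ker s).
  by exists (ker [::]); [exact: skr|exists [::]].
have K0 b : ker s b -> forall c, tau (b *: (c *: u)) = 0.
  move=> kb c; suff : ker (c :: s) b by apply; rewrite inE eqxx.
  apply: (Kmin (ker (c :: s))); [exact: skr|by exists (c :: s)| |by rewrite Ks].
  by move=> a ka; rewrite Ks => d ds; apply: ka; rewrite inE ds orbT.
pose n := size s.
have fl : linear (fun b : (L : lmodType R) => [ffun i : 'I_n =>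
  tau (b *: (s`_i *: u))] : {ffun 'I_n -> J}).
  move=> r a b; apply/ffunP => i; rewrite !ffunE -linearP; congr (tau _).
  by rewrite scalerDl -mulr_algl -scalerA.
have gl : linear (fun b : (L : lmodType R) => tau (b *: v)).
  move=> r a b; rewrite -linearP; congr (tau _).
  by rewrite scalerDl -mulr_algl -scalerA.
have [|h hE] := @envelope_extend R J envJ _ _ (mklin fl) (mklin gl).
  move=> b /ffunP bE /=.
  have kb : ker s b.
    by move=> c /(nthP 0)[i ilt <-]; have := bE (Ordinal ilt); rewrite !ffunE.
  rewrite -taue (right_nonunit_kills _ sv) ?linear0 // => -[b' b'E]; case: su => + _;
    apply; apply: tau0 => c.
  rewrite -taue -b'E -!scalerA taue; have := K0 b kb (b' * c).
  by rewrite -scalerA.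
have [y0 y00 ky0] := envelope_socle artR envJ mm.
pose delta i : {ffun 'I_n -> J} := [ffun j => if i == j then y0 else 0].
(* The values of [h] on the vectors [delta i] are the coefficients that express [v] through the
   chosen multiples of [u]. *)
have tex i : exists t : R, h (delta i) = t *: y0.
  apply: (envelope_simple envJ mm ky0 _ y00) => r mr.
  rewrite -linearZ; have -> : r *: delta i = 0; last exact: linear0.
  by apply/ffunP => j; rewrite !ffunE; case: eqP; rewrite ?ky0 ?scaler0.
have [t tE] := choice tex.
exists (\sum_i (t i)%:A * s`_i); apply/eqP; rewrite -subr_eq0; apply/eqP/tau0 => b.
rewrite scalerBr (linearB tau); apply/eqP; rewrite subr_eq0; apply/eqP.
have /= <- := hE b; rewrite scaler_suml scaler_sumr (linear_sum tau).
have rex (i : 'I_n) : exists r : R, tau (b *: (s`_i *: u)) = r *: y0.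
  by apply: (envelope_simple envJ mm ky0 _ y00); rewrite scalerA; apply: simple_killed.
have [r rE] := choice rex.
have -> : [ffun i : 'I_n => tau (b *: (s`_i *: u))] = \sum_i r i *: delta i.
  apply/ffunP => j; rewrite sum_ffunE ffunE rE (bigD1 j) //= big1 => [|i /negbTE ij].
    by rewrite !ffunE eqxx addr0.
  by rewrite !ffunE ij scaler0.
rewrite linear_sum; apply: eq_bigr => i _; transitivity (t i *: (r i *: y0)).
  by rewrite linearZ /= tE !scalerA mulrC.
rewrite -rE -linearZ; congr (tau _); rewrite -[LHS]/((t i)%:A *: (b *: (s`_i *: u)))
  !scalerA.
by rewrite !mulrA mulr_algl mulr_algr.
Qed.

(** A nonzero kernel would contain a simple element, and u is a multiple of it. *)
Lemma coinduced_inj Y (g : {linear Q -> Y}) (u : Q) : simple_elt u -> g u <> 0 ->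
  injective g.
Proof.
move=> su gu; apply/inj_ker => q gq; apply: contrapT => q0.
have [v gv sv] := simple_elt_exists (artinian_fg artL coinduced_fin_gen) (submod_ker
  g) gq q0.
by have [c uE] := coinduced_uniform sv su; apply: gu; rewrite uE linearZ gv /= scaler0.
Qed.

End Theory.
End Coinduced.

(** * Torsion pairs *)

Section ModClosure.
Context (A : nzRingType) (x : A).
Implicit Types (X Y Z M : lmodType A).

Lemma Mod_inj X Y (i : {linear X -> Y}) : injective i -> Mod x Y -> Mod x X.
Proof. by move=> ii MY a z ax; apply: ii; rewrite linearZ /= MY // linear0. Qed.

Lemma Mod_surj X Y (p : {linear X -> Y}) : surjective_map p -> Mod x X -> Mod x Y.
Proof. by move=> ps MX a y ax; have [z <-] := ps y; rewrite -linearZ MX // linear0. Qed.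

Lemma Mod_biprod (K : finType) (M : K -> lmodType A) S :
  is_biprod M S -> (forall k, Mod x (M k)) -> Mod x S.
Proof.
case=> inj [pr [_ _ sumE]] MM a s ax; rewrite (sumE s) scaler_sumr big1 // => k _.
by rewrite -linearZ MM // linear0.
Qed.

Lemma iso_fgmod X Y : iso X Y -> fgmod x X -> fgmod x Y.
Proof.
move=> /iso_inv[f [g [fg gf]]] [MX fX].
have fs : surjective_map f by move=> y; exists (g y).
by split; [exact: Mod_surj MX|exact: fin_gen_surj fX].
Qed.

Lemma retract_trans X Y Z : retract X Y -> retract Y Z -> retract X Z.
Proof.
case=> i [r ir] [j [s js]].
by exists (j \o i : {linear X -> Z}), (r \o s : {linear Z -> X}) => z /=; rewrite js ir.
Qed.

Lemma retract_ffun1 M : retract M {ffun 'I_1 -> M}%type.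
Proof.
have [inj [pr [h _ _]]] := ffun_biprod 1 M.
by exists (inj ord0), (pr ord0) => m; apply: h.
Qed.

Lemma retract_biprod (K : finType) (M : K -> lmodType A) S k : is_biprod M S ->
  retract (M k) S.
Proof. by case=> inj [pr [h _ _]]; exists (inj k), (pr k) => m; apply: h. Qed.

Lemma projective_split X Y (p : {linear Y -> X}) : projective_in (Mod x) X -> Mod x Y ->
  surjective_map p -> retract X Y.
Proof. by case=> MX pX MY ps; have [h hE] := pX Y X p idfun MY MX ps; exists h, p. Qed.

Lemma injective_split X Y (i : {linear X -> Y}) : injective_in (Mod x) X -> Mod x Y ->
  injective i -> retract X Y.
Proof. by case=> MX pX MY ps; have [h hE] := pX X Y i idfun MX MY ps; exists i, h. Qed.

Section TorsionPair.
Context (T F : subcat A).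
Hypothesis tp : torsion_pair x (T, F).

(** When X has no maps to F, the map to the torsion-free end of its canonical sequence is zero, so X
    is isomorphic to its torsion part. *)
Lemma torsionP X : T X <-> fgmod x X /\ forall Y, F Y -> hom_zero X Y.
Proof.
case: tp => -[Tfg _] [Tiso _] h0 ex; split=> [TX|[fX h]].
  by split=> [|Y]; [exact: Tfg|exact: h0].
have [U [W [TU FW [f [g [fi gs fg]]]]]] := ex X fX.
apply: Tiso TU; apply: (iso_bij fi) => y.
by have [z ->] := proj1 (fg y) (h _ FW g y); exists z.
Qed.

Lemma torsion_freeP Y : F Y <-> fgmod x Y /\ forall X, T X -> hom_zero X Y.
Proof.
case: tp => -[_ Ffg] [_ Fiso] h0 ex; split=> [FY|[fY h]].
  by split=> [|X TX]; [exact: Ffg|exact: h0].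
have [U [W [TU FW [f [g [fi gs fg]]]]]] := ex Y fY.
apply: (Fiso _ _ _ FW); apply/iso_sym/(iso_bij (f := g)) => //; apply/inj_ker => y.
by move=> /fg[z ->]; apply: h.
Qed.

Lemma torsion_surj X Y (p : {linear X -> Y}) : surjective_map p -> T X -> T Y.
Proof.
move=> ps /torsionP[[MX fX] h]; apply/torsionP; split.
  by split; [exact: Mod_surj MX|exact: fin_gen_surj fX].
by move=> Z FZ f y; have [z <-] := ps y; have := h Z FZ (f \o p : {linear X -> Z}) z.
Qed.

Lemma torsion_ext X M Y : short_exact X M Y -> Mod x M -> T X -> T Y -> T M.
Proof.
move=> E MM /torsionP[[_ fX] hX] /torsionP[[_ fY] hY]; apply/torsionP; split.
  by split=> //; apply: (fin_gen_ext E).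
case: E => i [p [ii ps ip]] Z FZ f.
have [|g gE] := @factor_surj _ _ _ _ p f ps.
  move=> y /ip[z ->]; exact: (hX Z FZ (f \o i : {linear X -> Z})).
by move=> y; rewrite -gE hY.
Qed.

Lemma torsion_free_ext X M Y : short_exact X M Y -> Mod x M -> F X -> F Y -> F M.
Proof.
move=> E MM /torsion_freeP[[_ fX] hX] /torsion_freeP[[_ fY] hY]; apply/torsion_freeP;
  split.
  by split=> //; apply: (fin_gen_ext E).
case: E => i [p [ii ps ip]] Z TZ f.
have [|g gE] := @factor_inj _ _ _ _ i f ii.
  move=> z; have /ip[y yE] : p (f z) = 0 by exact: (hY Z TZ (p \o f : {linear Z -> Y})).
  by exists y.
by move=> y; rewrite -gE hX ?linear0.
Qed.

End TorsionPair.
End ModClosure.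

(** * Indecomposable projectives and injectives over a quotient by idempotents *)

Section Stages.
Context (R : comNzRingType) (L : algType R) (J : lmodType R) (I : finType) (e : I -> L).
Implicit Types (X Y Z M : lmodType L) (U D : {set I}) (T F C : subcat L).

Hypothesis artL : artin_algebra L.
Hypothesis envJ : injective_envelope (semisimple_quotient R) J.
Hypothesis ce : complete_primitive_orthogonal e.
Hypothesis be : basic_idempotents e.

Let pe i : primitive_idempotent (e i). Proof. by case: ce. Qed.
Let ee i : e i * e i = e i. Proof. by case: (pe i). Qed.
Let eij i j : i != j -> e i * e j = 0. Proof. by case: ce => _ h _; apply: h. Qed.

Definition kills k X : Prop := forall m : X, e k *: m = 0.

Lemma idem_sum_mul U j : j \in U -> idem_sum e U * e j = e j.
Proof.
move=> jU; rewrite mulr_suml (bigD1 j) //= ee big1 ?addr0 // => i /andP[_ ij].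
exact: eij.
Qed.

(** This turns a change of ring into a condition on supports: every ring of the procedure is seen
    through the e_j that it kills. *)
Lemma Mod_idem U X : Mod (idem_sum e U) X <-> forall j, j \in U -> kills j X.
Proof.
split=> [h j jU m|h a m /asboolP[n [b [c ->]]]].
  apply: h; apply/asboolP; exists 1%N, (fun=> 1), (fun=> e j).
  by rewrite big_ord1 mul1r idem_sum_mul.
rewrite scaler_suml big1 // => i _; rewrite -scalerA -scalerA.
rewrite /idem_sum scaler_suml big1 ?scaler0 // => j jU; exact: h.
Qed.

Lemma Mod_setU U D X :
  Mod (idem_sum e (U :|: D)) X <-> Mod (idem_sum e U) X /\ forall j,
    j \in D -> kills j X.
Proof.
rewrite !Mod_idem; split=> [h|[h h'] j /setUP[/h|/h']] //.
by split=> j jU; apply: h; rewrite inE jU ?orbT.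
Qed.

Lemma kills_inj k X Y (i : {linear X -> Y}) : injective i -> kills k Y -> kills k X.
Proof. by move=> ii h m; apply: ii; rewrite linearZ linear0; apply: h. Qed.

Lemma kills_surj k X Y (p : {linear X -> Y}) : surjective_map p -> kills k X ->
  kills k Y.
Proof. by move=> ps h y; have [m <-] := ps y; rewrite -linearZ h linear0. Qed.

Lemma kills_ext k X M Y : short_exact X M Y -> kills k X -> kills k Y -> kills k M.
Proof.
case=> i [p [ii ps ip]] kX kY m; have /ip[y yE] : p (e k *: m) = 0 by rewrite linearZ;
  apply: kY.
by rewrite -ee -scalerA yE -linearZ kX linear0.
Qed.

Lemma Mod_ext U X M Y : short_exact X M Y ->
  Mod (idem_sum e U) X -> Mod (idem_sum e U) Y -> Mod (idem_sum e U) M.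
Proof.
by move=> E /Mod_idem kX /Mod_idem kY; apply/Mod_idem => j jU; apply: (kills_ext E);
  auto.
Qed.

Lemma idem_sub X (N : X -> Prop) m : is_submod N -> (forall k, N (e k *: m)) -> N m.
Proof.
move=> sN h; rewrite -[m]scale1r; case: ce => _ _ <-; rewrite scaler_suml.
exact: submod_sum.
Qed.

Section FixedQuotient.
Context (U : {set I}).
Let x : L := idem_sum e U.

Definition iproj k : lmodType L := principal x (e k).
Definition iinj k : lmodType L := dual J (principal (x : L^c) (e k : L^c)).

Lemma iproj_gen k : exists g : iproj k, [/\ e k *: g = g, forall p, exists a,
  p = a *: g,
    forall a : L, a *: g = 0 <-> a * e k \in ideal x &
    forall X (m : X), Mod x X -> exists f : {linear iproj k -> X}, f g = e k *: m].
Proof.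
have [g [_ eg gen g0]] := principalP x (ee k); exists g; split=> // X m MX.
have [a /g0 ax|f fE] := @hom_cyclic _ _ _ g (e k *: m) gen; last by exists f.
by rewrite scalerA MX.
Qed.

Lemma iproj_Mod k : Mod x (iproj k).
Proof. by have [g []] := principalP x (ee k). Qed.

Lemma iproj_fin_gen k : fin_gen (iproj k).
Proof.
have [g [_ gen _ _]] := iproj_gen k; exists 1%N, (fun=> g) => p; have [a ->] := gen p.
by exists (fun=> a); rewrite big_ord1.
Qed.

Lemma iproj_hom0 k X : Mod x X -> hom_zero (iproj k) X <-> kills k X.
Proof.
move=> MX; have [g [eg gen _ ex]] := iproj_gen k; split=> [h m|h f p].
  by have [f <-] := ex X m MX; apply: h.
by have [a ->] := gen p; rewrite linearZ -eg linearZ /= h scaler0.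
Qed.

Lemma iproj_projective k : projective_in (Mod x) (iproj k).
Proof.
split=> [|X Y p g MX MY ps]; first exact: iproj_Mod.
have [g0 [eg gen _ ex]] := iproj_gen k; have [m mE] := ps (g g0).
have [h hE] := ex X m MX; exists h => y; have [a ->] := gen y.
by rewrite !linearZ hE !linearZ mE -!linearZ eg.
Qed.

Lemma iproj_nonzero k : k \notin U -> ~ kills k (iproj k).
Proof.
move=> kU h; have [g [eg gen g0 _]] := iproj_gen k.
have := idem_not_in_ideal artL envJ ce be kU; apply/negP; rewrite negbK.
by rewrite -[e k]mul1r; apply/g0; rewrite scale1r -eg; apply: h.
Qed.

Lemma iinj_coinduced k : coinduced J x (e k) (iinj k).
Proof. exact: dual_coinduced. Qed.

(** Maps from P_k to I_k detect e_k P_k, which is nonzero; if e_k killed I_k, all of them would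
    vanish on the generator. *)
Lemma iinj_nonzero k : k \notin U -> ~ kills k (iinj k).
Proof.
move=> kU h; apply: (iproj_nonzero kU) => m; apply: contrapT.
move=> /(coinduced_separates artL envJ (iinj_coinduced k) (@iproj_Mod k))[f]; apply.
have [g [eg gen _ _]] := iproj_gen k; have [a ->] := gen m.
by rewrite linearZ -eg linearZ /= h scaler0.
Qed.

Lemma iinj_hom0 k X : Mod x X -> hom_zero X (iinj k) <-> kills k X.
Proof. exact: (coinduced_hom0 artL envJ (iinj_coinduced k)). Qed.

Lemma iinj_Mod k : Mod x (iinj k). Proof. by case: (iinj_coinduced k). Qed.

Lemma iinj_fin_gen k : fin_gen (iinj k).
Proof. exact: (coinduced_fin_gen artL envJ (iinj_coinduced k)). Qed.

Lemma iinj_injective k : injective_in (Mod x) (iinj k).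
Proof. exact: (coinduced_injective envJ (iinj_coinduced k)). Qed.

Lemma proj_sum_biprod D :
  is_biprod (fun j : {j | j \in D} => iproj (val j)) (proj_sum e x D).
Proof. exact: dsum_biprod. Qed.

Lemma inj_sum_biprod D :
  is_biprod (fun j : {j | j \in D} => iinj (val j)) (inj_sum J e x D).
Proof. exact: dsum_biprod. Qed.

Lemma proj_sum_Mod D : Mod x (proj_sum e x D).
Proof. by apply: (Mod_biprod (proj_sum_biprod D)) => k; apply: iproj_Mod. Qed.

Lemma inj_sum_Mod D : Mod x (inj_sum J e x D).
Proof. by apply: (Mod_biprod (inj_sum_biprod D)) => k; apply: iinj_Mod. Qed.

Lemma proj_sum_hom0 D X : Mod x X ->
  hom_zero (proj_sum e x D) X <-> forall j, j \in D -> kills j X.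
Proof.
move=> MX; rewrite (biprod_hom_out (proj_sum_biprod D)); split=> [h j jD|h [j jD]].
  by apply/(iproj_hom0 j MX); apply: (h (exist _ j jD)).
exact/iproj_hom0/h.
Qed.

Lemma inj_sum_hom0 D X : Mod x X ->
  hom_zero X (inj_sum J e x D) <-> forall j, j \in D -> kills j X.
Proof.
move=> MX; rewrite (biprod_hom_in (inj_sum_biprod D)); split=> [h j jD|h [j jD]].
  by apply/(iinj_hom0 j MX); apply: (h (exist _ j jD)).
exact/iinj_hom0/h.
Qed.

Lemma add_proj_sum D X : Defs.add (proj_sum e x D) X -> projectives x X.
Proof.
move=> /add_retract[n rX]; set M := ({ffun _ -> _}%type : lmodType L) in rX.
have bM := ffun_biprod n (proj_sum e x D : lmodType L).
have pS : projective_in (Mod x) (proj_sum e x D).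
  apply: (biprod_projective (proj_sum_biprod D)) => [|k];
    [exact: proj_sum_Mod|exact: iproj_projective].
have pM : projective_in (Mod x) M.
  by apply: (biprod_projective bM) => //; apply: (Mod_biprod bM) => _;
    apply: proj_sum_Mod.
split; last by apply: (retract_projective _ rX pM); case: (rX) => i [r /can_inj ii];
  apply: (Mod_inj ii); case: pM.
apply: retract_fin_gen rX _; apply: (biprod_fin_gen bM) => _.
by apply: (biprod_fin_gen (proj_sum_biprod D)) => k; apply: iproj_fin_gen.
Qed.

Lemma add_inj_sum D X : Defs.add (inj_sum J e x D) X -> injectives x X.
Proof.
move=> /add_retract[n rX]; set M := ({ffun _ -> _}%type : lmodType L) in rX.
have bM := ffun_biprod n (inj_sum J e x D : lmodType L).
have pS : injective_in (Mod x) (inj_sum J e x D).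
  apply: (biprod_injective (inj_sum_biprod D)) => [|k];
    [exact: inj_sum_Mod|exact: iinj_injective].
have pM : injective_in (Mod x) M.
  by apply: (biprod_injective bM) => //; apply: (Mod_biprod bM) => _;
    apply: inj_sum_Mod.
split; last by apply: (retract_injective _ rX pM); case: (rX) => i [r /can_inj ii];
  apply: (Mod_inj ii); case: pM.
apply: retract_fin_gen rX _; apply: (biprod_fin_gen bM) => _.
by apply: (biprod_fin_gen (inj_sum_biprod D)) => k; apply: iinj_fin_gen.
Qed.

Lemma iproj_add D k : k \in D -> Defs.add (proj_sum e x D) (iproj k).
Proof.
move=> kD; apply: (@retract_add _ 1); apply: retract_trans (retract_ffun1 _).
exact: (retract_biprod (exist _ k kD) (proj_sum_biprod D)).
Qed.

Lemma iinj_add D k : k \in D -> Defs.add (inj_sum J e x D) (iinj k).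
Proof.
move=> kD; apply: (@retract_add _ 1); apply: retract_trans (retract_ffun1 _).
exact: (retract_biprod (exist _ k kD) (inj_sum_biprod D)).
Qed.

Lemma add_hom_out M X Y : Defs.add M X -> hom_zero M Y -> hom_zero X Y.
Proof.
move=> /add_retract[n rX] h; apply: retract_hom_out rX _.
by apply/(biprod_hom_out (ffun_biprod n M)).
Qed.

Lemma add_hom_in M X Y : Defs.add M X -> hom_zero Y M -> hom_zero Y X.
Proof.
move=> /add_retract[n rX] h; apply: retract_hom_in rX _.
by apply/(biprod_hom_in (ffun_biprod n M)).
Qed.

End FixedQuotient.
End Stages.

(** * Projectives in T and injectives in F in terms of supports *)

Section Traces.
Context (R : comNzRingType) (L : algType R) (J : lmodType R) (I : finType) (e : I -> L).
Implicit Types (X Y Z M : lmodType L) (U D : {set I}) (T F C : subcat L).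

Hypothesis artL : artin_algebra L.
Hypothesis envJ : injective_envelope (semisimple_quotient R) J.
Hypothesis ce : complete_primitive_orthogonal e.
Hypothesis be : basic_idempotents e.

Let pe i : primitive_idempotent (e i). Proof. by case: ce. Qed.
Let ee i : e i * e i = e i. Proof. by case: (pe i). Qed.

Section FixedPair.
Context (U : {set I}) (T F : subcat L).
Local Notation x := (idem_sum e U).
Local Notation P := (iproj e U).
Local Notation Q := (iinj J e U).
Hypothesis tp : torsion_pair x (T, F).

Definition kills_all k C : Prop := forall X, C X -> kills e k X.

Lemma T_Mod X : T X -> Mod x X. Proof. by move=> /(torsionP tp)[[]]. Qed.
Lemma F_Mod X : F X -> Mod x X. Proof. by move=> /(torsion_freeP tp)[[]]. Qed.
Lemma T_fin_gen X : T X -> fin_gen X. Proof. by move=> /(torsionP tp)[[]]. Qed.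
Lemma F_fin_gen X : F X -> fin_gen X. Proof. by move=> /(torsion_freeP tp)[[]]. Qed.

Lemma iproj_torsion k : T (P k) <-> kills_all k F.
Proof.
split=> [/(torsionP tp)[_ h] Y FY|h].
  by apply/(iproj_hom0 ce k (F_Mod FY))/h.
apply/(torsionP tp); split=> [|Y FY]; last exact/(iproj_hom0 ce k (F_Mod FY))/h.
by split; [exact: iproj_Mod|exact: iproj_fin_gen].
Qed.

Lemma iinj_torsion_free k : F (Q k) <-> kills_all k T.
Proof.
split=> [/(torsion_freeP tp)[_ h] Y TY|h].
  by apply/(iinj_hom0 artL envJ ce k (T_Mod TY))/h.
apply/(torsion_freeP tp); split=> [|Y TY];
  last exact/(iinj_hom0 artL envJ ce k (T_Mod TY))/h.
by split; [exact: iinj_Mod|exact: iinj_fin_gen].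
Qed.

Lemma torsion_free_inj X Y (i : {linear X -> Y}) : injective i -> F Y -> F X.
Proof.
move=> ii FY; case/(torsion_freeP tp): (FY) => -[MY fY] h; apply/(torsion_freeP tp);
  split.
  by split; [exact: Mod_inj ii MY|exact: (fin_gen_inj artL envJ ii)].
by move=> Z TZ f z; apply: ii; rewrite linear0;
  apply: (h Z TZ (i \o f : {linear Z -> Y})).
Qed.

(* Otherwise [X] modulo the trace of the [P j], [j \in D], has a simple        *)
(* quotient that is the top of some [P k]; a lift [X -> P k] is onto since     *)
(* [P k] is local, so [P k] is torsion.                                        *)
Lemma projective_torsion_add D X :
  (forall k, k \notin U -> kills_all k F -> k \in D) ->
  T X -> projectives x X -> Defs.add (proj_sum e x D) X.
Proof.
move=> hD TX [fX pX]; have MX := T_Mod TX.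
have nX := noetherian_fg artL envJ fX.
have [|n [p ps]] := finite_generation (M := proj_sum e x D) nX.
  move=> N sN hN y0; apply: contrapT => nNy0.
  have [K [sK NK [y1 nKy1] Kmax]] := maximal_submodule_exists nX sN nNy0.
  have [k nKy] : exists k, ~ K (e k *: y1).
    apply: contrapT => H; apply: nKy1; apply: (idem_sub ce sK) => k.
    by apply: contrapT => H'; apply: H; exists k.
  set y := e k *: y1 in nKy.
  have ey : e k *: y = y by rewrite scalerA ee.
  have kU : k \notin U.
    apply/negP => kU; apply: nKy; have /(Mod_idem ce)/(_ k kU) kX := MX.
    by rewrite -ey kX; case: sK.
  have [g [eg gen g0 ex]] := iproj_gen ce U k.
  have kD : k \notin D.
    apply/negP => kD; apply: nKy; apply: NK; have [f fg] := ex X y MX.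
    have [i [r ir]] := retract_biprod (exist _ k kD) (proj_sum_biprod e U D).
    have := hN (f \o r : {linear _ -> _}) (i g).
    by rewrite /= ir fg ey.
  have [S [q [qs qP]]] := quotient_exists sK.
  have MS : Mod x S := Mod_surj qs MX.
  have [f fg] := ex S (q y) MS; rewrite -linearZ ey in fg.
  have fs : surjective_map f.
    move=> s; have [z <-] := qs s; have [c /qP] := Kmax y z nKy.
    rewrite linearB linearZ => /eqP; rewrite subr_eq0 => /eqP ->.
    by exists (c *: g); rewrite linearZ fg.
  case: (pX) => _ /(_ (P k) S f q (@iproj_Mod R L I e ce U k) MS fs)[h hE].
  have [a aE] := gen (h y).
  have hs : surjective_map h.
    (* Here h y = a g and g = a g + (1 - a) g. If a g generates, [h] is onto; if (1 - a) g did, [f]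
       would vanish on [g], because f (a g) = q y = f g. *)
    have [|[c cE]|[c cE]] := @principal_local R L J artL envJ _ (pe k) x g a (1 - a)
      g0 eg.
    - by rewrite -scalerDl addrCA subrr addr0 scale1r.
    - move=> z; have [b ->] := gen z; exists (b *: (c *: y)).
      by rewrite 2!linearZ /= aE cE.
    case: nKy; apply/qP; rewrite -fg -cE linearZ scalerBl scale1r -aE linearB hE fg
      subrr.
    by rewrite /= scaler0.
  move/negP: kD; apply; apply: hD kU _; apply/iproj_torsion.
  exact: (torsion_surj tp hs TX).
apply: (@retract_add _ n); apply: (projective_split pX _ ps).
by apply: (Mod_biprod (ffun_biprod n _)) => _; apply: proj_sum_Mod.
Qed.

(* Dually, a simple submodule on which the [e j], [j \in D], vanish embeds in  *)
(* some [Q k], and the extension [Q k -> X] is injective.                      *)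
Lemma injective_torsion_free_add D X :
  (forall k, k \notin U -> kills_all k T -> k \in D) ->
  F X -> injectives x X -> Defs.add (inj_sum J e x D) X.
Proof.
move=> hD FX [fX pX]; have MX := F_Mod FX.
have aX := artinian_fg artL fX.
have [|n [p ps]] := finite_cogeneration (M := inj_sum J e x D) aX.
  move=> x0 nx0; apply: contrapT => H.
  pose N (y : X) := forall f : {linear X -> inj_sum J e x D}, f y = 0.
  have sN : is_submod N.
    split=> [f|a y z Ny Nz f]; first by rewrite linear0.
    by rewrite linearP Ny Nz scaler0 addr0.
  have [|u0 Nu0 su0] := simple_elt_exists aX sN _ nx0.
    by move=> f; apply: contrapT => f0; apply: H; exists f.
  have [k u0k] : exists k, e k *: u0 <> 0.
    apply: contrapT => H'; case: su0 => + _; apply;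
      apply: (idem_sub ce (@submod_zero _ X)) => k.
    by apply: contrapT => H''; apply: H'; exists k.
  set u := e k *: u0 in u0k.
  have su : simple_elt u by exact: simple_elt_scale.
  have Nu : N u := submodZ (e k) sN Nu0.
  have eu : e k *: u = u by rewrite scalerA ee.
  have kU : k \notin U.
    by apply/negP => kU; apply: u0k; have /(Mod_idem ce)/(_ k kU) kX := MX; apply: kX.
  have cQ := @iinj_coinduced R L J I e ce U k.
  have [|f fu] := coinduced_separates (m := u) artL envJ cQ MX; first by rewrite eu.
  have kD : k \notin D.
    apply/negP => kD; have [i [r ir]] := retract_biprod (exist _ k kD) (inj_sum_biprod
      J e U D).
    apply: fu; rewrite -(ir (f u)).
    by have /= -> := Nu (i \o f : {linear _ -> _}); rewrite linear0.
  have [S [i [ii iP]]] := submodule_exists (submod_cyclic u).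
  have fi : injective (f \o i : {linear S -> Q k}).
    apply/inj_ker => s /= fis; apply: ii; rewrite linear0; apply: contrapT => is0.
    have [a E] : exists a, i s = a *: u by apply/iP; exists s.
    case: su => _ /(_ a); rewrite -E => /(_ is0)[c cE].
    by apply: fu; rewrite -cE linearZ fis /= scaler0.
  have MS : Mod x S := Mod_inj ii MX.
  case: (pX) => _ /(_ S (Q k) _ i MS (@iinj_Mod R L J I e ce U k) fi)[h hE].
  have [s sE] : exists s, i s = u by apply/iP; exists 1; rewrite scale1r.
  have hfu : h (f u) = u by rewrite -{1}sE -sE; exact: hE.
  have sfu : simple_elt (f u).
    split=> // a afu; have [|c cE] := proj2 su a; last by exists c;
      rewrite -!linearZ cE.
    by move=> au; apply: afu; rewrite -linearZ au linear0.
  have hi : injective h.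
    by apply: (coinduced_inj artL envJ (ee k) cQ (pe k) sfu); rewrite hfu; case: su.
  move/negP: kD; apply; apply: hD kU _; apply/iinj_torsion_free.
  exact: (torsion_free_inj hi FX).
apply: (@retract_add _ n); apply: (injective_split pX _ ps).
by apply: (Mod_biprod (ffun_biprod n _)) => _; apply: inj_sum_Mod.
Qed.

Lemma add_proj_sum_torsion D X : (forall k, k \in D -> kills_all k F) ->
  Defs.add (proj_sum e x D) X -> T X.
Proof.
move=> h aX; have [fX [MX _]] := add_proj_sum ce aX; apply/(torsionP tp);
  split=> // Y FY.
by apply: (add_hom_out aX); apply/(proj_sum_hom0 ce D (F_Mod FY)) => j jD; apply: h.
Qed.

Lemma add_inj_sum_torsion_free D X : (forall k, k \in D -> kills_all k T) ->
  Defs.add (inj_sum J e x D) X -> F X.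
Proof.
move=> h aX; have [fX [MX _]] := add_inj_sum artL envJ ce aX;
  apply/(torsion_freeP tp); split=> // Y TY.
by apply: (add_hom_in aX); apply/(inj_sum_hom0 artL envJ ce D (T_Mod TY)) => j jD;
  apply: h.
Qed.

Lemma torsion_choiceP D : [disjoint D & U] ->
  (forall X, T X /\ projectives x X <-> Defs.add (proj_sum e x D) X) <->
  (forall k, k \in D <-> k \notin U /\ kills_all k F).
Proof.
move=> dU; split=> [h k|h X].
  split=> [kD|[kU kF]].
    split; first by rewrite (disjointFr dU).
    by apply/iproj_torsion; case: (proj2 (h (P k)) (iproj_add e U kD)).
  apply: contrapT => /negP kD; have kUD : k \notin U :|: D by rewrite inE negb_or kU.
  (* The test module is the projective at k over the ring with both U and D removed. It receives no
     map from P_j with j in D, hence none from P_k, which is a retract of a power of their sum; so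
     e_k would kill it. *)
  apply: (iproj_nonzero artL envJ ce be kUD).
  have /(Mod_setU ce)[MU MD] := @iproj_Mod R L I e ce (U :|: D) k.
  apply/(iproj_hom0 ce k MU)/(add_hom_out (M := proj_sum e x D));
    last exact/proj_sum_hom0.
  apply/h; split; first exact/iproj_torsion.
  by split; [exact: iproj_fin_gen|exact: iproj_projective].
split=> [[TX pX]|aX].
  by apply: projective_torsion_add => // k kU kF; apply/h.
split; last exact: add_proj_sum aX.
by apply: add_proj_sum_torsion aX => k /h[].
Qed.

Lemma torsion_free_choiceP D : [disjoint D & U] ->
  (forall X, F X /\ injectives x X <-> Defs.add (inj_sum J e x D) X) <->
  (forall k, k \in D <-> k \notin U /\ kills_all k T).
Proof.
move=> dU; split=> [h k|h X].
  split=> [kD|[kU kF]].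
    split; first by rewrite (disjointFr dU).
    by apply/iinj_torsion_free; case: (proj2 (h (Q k)) (iinj_add J e U kD)).
  apply: contrapT => /negP kD; have kUD : k \notin U :|: D by rewrite inE negb_or kU.
  apply: (iproj_nonzero artL envJ ce be kUD).
  have /(Mod_setU ce)[MU MD] := @iproj_Mod R L I e ce (U :|: D) k.
  apply/(iinj_hom0 artL envJ ce k MU)/(add_hom_in (M := inj_sum J e x D));
    last exact/inj_sum_hom0.
  apply/h; split; first exact/iinj_torsion_free.
  by split; [exact: iinj_fin_gen|exact: iinj_injective].
split=> [[TX pX]|aX].
  by apply: injective_torsion_free_add => // k kU kF; apply/h.
split; last exact: add_inj_sum aX.
by apply: add_inj_sum_torsion_free aX => k /h[].
Qed.

(** If F has full support, the projectives in T are sums over the empty set of indices, hence zero;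
    dually for injectives. Conversely a missing index makes P_k or I_k a nonzero counterexample. *)
Lemma torsion_pair_EP : torsion_pair_E x (T, F) <->
  forall k, k \notin U -> ~ kills_all k F /\ ~ kills_all k T.
Proof.
split=> [[_ hT hF] k kU|h].
  split=> [/iproj_torsion TP|/iinj_torsion_free FQ].
    apply: (iproj_nonzero artL envJ ce be kU) => m; apply: hT => //.
    by split; [exact: iproj_fin_gen|exact: iproj_projective].
  apply: (iinj_nonzero artL envJ ce be kU) => m; apply: hF => //.
  by split; [exact: iinj_fin_gen|exact: iinj_injective].
split=> // X /= CX pX m.
  have aX : Defs.add (proj_sum e x set0) X.
    by apply: projective_torsion_add => // k /h[].
  apply: (add_hom_out aX (Y := X) _ idfun).
  by apply/(proj_sum_hom0 ce set0 (T_Mod CX)) => j; rewrite inE.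
have aX : Defs.add (inj_sum J e x set0) X.
  by apply: injective_torsion_free_add => // k /h[].
apply: (add_hom_in aX (Y := X) _ idfun).
by apply/(inj_sum_hom0 artL envJ ce set0 (F_Mod CX)) => j; rewrite inE.
Qed.

End FixedPair.
End Traces.

(** * Single stages *)

Section Steps.
Context (R : comNzRingType) (L : algType R) (J : lmodType R) (I : finType) (e : I -> L).
Implicit Types (X Y Z M : lmodType L) (U D : {set I}) (T F C : subcat L).

Hypothesis artL : artin_algebra L.
Hypothesis envJ : injective_envelope (semisimple_quotient R) J.
Hypothesis ce : complete_primitive_orthogonal e.
Hypothesis be : basic_idempotents e.

Let pe i : primitive_idempotent (e i). Proof. by case: ce. Qed.
Let ee i : e i * e i = e i. Proof. by case: (pe i). Qed.

Definition left_perp x F : subcat L := fun X => fgmod x X /\ forall Y,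
  F Y -> hom_zero X Y.
Definition right_perp x T : subcat L :=
  fun Y => fgmod x Y /\ forall X, T X -> hom_zero X Y.

Lemma iso_hom_zero_l X X' Y : iso X X' -> hom_zero X Y -> hom_zero X' Y.
Proof.
move=> /iso_inv[f [g [fg gf]]] h k y; rewrite -(gf y).
exact: (h (k \o f : {linear X -> Y})).
Qed.

Lemma iso_hom_zero_r X Y Y' : iso Y Y' -> hom_zero X Y -> hom_zero X Y'.
Proof.
move=> /iso_inv[f [g [fg gf]]] h k y; rewrite -(gf (k y)).
by have /= -> := h (g \o k : {linear X -> Y}) y; rewrite linear0.
Qed.

(** The torsion part of X is a submodule N minimal among those with quotient in F. For a map f from
    N to a module of F, X / ker f is an extension of X / N by a submodule of the target, so it lies
    in F, and minimality gives ker f = N. *)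
Lemma torsion_pair_left_perp U F : let x := idem_sum e U in
    (forall X, F X -> fgmod x X) -> (forall X Y, iso X Y -> F X -> F Y) ->
    (forall X Y (i : {linear X -> Y}), injective i -> F Y -> F X) ->
    (forall X, fgmod x X -> zero_module X -> F X) ->
    (forall X M Y, short_exact X M Y -> F X -> F Y -> F M) ->
  torsion_pair x (left_perp x F, F).
Proof.
move=> x Ffg Fiso Finj F0 Fext; split=> [||X Y [_ h] FY|X [MX fX]].
- by split=> [X []|].
- split=> // X Y XY [fX h]; split=> [|Z FZ]; first exact: iso_fgmod fX.
  exact: iso_hom_zero_l (h Z FZ).
- exact: h.
have [|N [sN [Y [p [ps pN FY]]] Nmin]] := artinian_fg artL fX (P := fun N =>
    exists Y (p : {linear X -> Y}), [/\ surjective_map p, forall z,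
      p z = 0 <-> N z & F Y]).
  exists (fun _ => True); first exact: submod_setT.
  have [Y [p [ps pP]]] := quotient_exists (@submod_setT _ X).
  exists Y, p; split=> //; apply: F0.
    by split; [exact: Mod_surj ps MX|exact: fin_gen_surj ps fX].
  by move=> y; have [z <-] := ps y; apply/pP.
have [W [i [ii iN]]] := submodule_exists sN.
exists W, Y; split=> //; last by apply: (short_exactP ii ps) => z; rewrite pN iN.
split=> [|Z FZ f w]; first by split; [exact: Mod_inj ii MX|exact: (fin_gen_inj artL
  envJ ii)].
have sK := submod_im i (submod_ker f).
have [V [r [rs rP]]] := quotient_exists sK.
have [B [q [qs qP]]] := quotient_exists (submod_ker f).
have [|fb fbE] := @factor_surj _ _ _ _ q f qs; first by move=> z /qP.
have fbi : injective fb.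
  by apply/inj_ker => b; have [z <-] := qs b; rewrite fbE => /qP.
have [|j jE] := @factor_surj _ _ _ _ q (r \o i : {linear W -> V}) qs.
  by move=> z /qP fz /=; apply/rP; exists z.
have ji : injective j.
  apply/inj_ker => b; have [z <-] := qs b; rewrite jE => /rP[z' fz' /ii <-].
  exact/qP.
have [|t tE] := @factor_surj _ _ _ _ r p rs.
  by move=> z /rP[w' _ <-]; apply/pN/iN; exists w'.
have ts : surjective_map t by move=> y; have [z <-] := ps y; exists (r z).
have FV : F V.
  apply: (Fext B V Y _ (Finj _ _ fb fbi FZ) FY); apply: (short_exactP ji ts) => v.
  split=> [|[b <-]].
    have [z <-] := rs v; rewrite tE => /pN/iN[w' <-]; exists (q w'); exact: jE.
  have [w' <-] := qs b; rewrite jE /= tE; apply/pN/iN; by exists w'.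
have [|||w' fw' /ii <-] // := Nmin _ sK _ _ (i w).
- by exists V, r; split.
- by move=> _ [w' _ <-]; apply/iN; exists w'.
by apply/iN; exists w.
Qed.

(** Dually, N is a maximal submodule in T. The preimage in X of the image of a map Z -> X / N with Z
    in T is an extension of modules in T, so it equals N. *)
Lemma torsion_pair_right_perp U T : let x := idem_sum e U in
    (forall X, T X -> fgmod x X) -> (forall X Y, iso X Y -> T X -> T Y) ->
    (forall X Y (p : {linear X -> Y}), surjective_map p -> T X -> T Y) ->
    (forall X, fgmod x X -> zero_module X -> T X) ->
    (forall X M Y, short_exact X M Y -> T X -> T Y -> T M) ->
  torsion_pair x (T, right_perp x T).
Proof.
move=> x Tfg Tiso Tsurj T0 Text; split=> [||X Y TX [_ h]|X [MX fX]].
- by split=> [|X []].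
- split=> // X Y XY [fX h]; split=> [|Z TZ]; first exact: iso_fgmod fX.
  exact: iso_hom_zero_r (h Z TZ).
- exact: h.
have [|N [sN [V [i [ii iN TV]]] Nmax]] :=
  noetherian_max (noetherian_fg artL envJ fX) (P := fun N =>
    exists (V : lmodType L) (i : {linear V -> X}), [/\ injective i, forall z,
      N z <-> exists v, i v = z & T V]).
  exists (fun z => z = 0); first exact: submod_zero.
  have [V [i [ii iP]]] := submodule_exists (@submod_zero _ X).
  exists V, i; split=> //; apply: T0.
    by split; [exact: Mod_inj ii MX|exact: (fin_gen_inj artL envJ ii)].
  by move=> v; apply: ii; rewrite linear0; apply/iP; exists v.
have [W [p [ps pN]]] := quotient_exists sN.
exists V, W; split=> //; last by apply: (short_exactP ii ps) => z; rewrite pN iN.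
split=> [|Z TZ f z]; first by split; [exact: Mod_surj ps MX|exact: fin_gen_surj ps fX].
have [B [k [ki kP]]] := submodule_exists (submod_im f (@submod_setT _ Z)).
have [|f' f'E] := @factor_inj _ _ _ _ k f ki; first by move=> z'; apply/kP; exists z'.
have f's : surjective_map f'.
  move=> b; have [|z' _ E] := proj2 (kP (k b)); first by exists b.
  by exists z'; apply: ki; rewrite f'E.
have sK := submod_preim p (submod_im f (@submod_setT _ Z)).
have [M [j [ji jP]]] := submodule_exists sK.
have [|i' i'E] := @factor_inj _ _ _ _ j i ji.
  move=> v; apply/jP; exists 0 => //; rewrite linear0; apply/esym/pN/iN; by exists v.
have [|p' p'E] := @factor_inj _ _ _ _ k (p \o j : {linear M -> W}) ki.
  by move=> m; apply/kP; apply/jP; exists m.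
have TM : T M.
  have i'i : injective i' by move=> u v E; apply: ii; rewrite -!i'E E.
  have p's : surjective_map p'.
    move=> b; have [w E] := ps (k b).
    have /jP[m mE] : exists2 z', True & f z' = p w by rewrite E; apply/kP; exists b.
    by exists m; apply: ki; rewrite p'E /= mE.
  apply: (Text V M B _ TV (Tsurj _ _ _ f's TZ)); apply: (short_exactP i'i p's) => m.
  split=> [m0|[v <-]].
    have /iN[v vE] : N (j m) by apply/pN; rewrite -[LHS]p'E m0 linear0.
    by exists v; apply: ji; rewrite i'E.
  by apply: ki; rewrite p'E /= i'E linear0; apply/pN/iN; exists v.
have [w wE] := ps (f z); rewrite -wE; apply/pN.
apply: (Nmax _ sK); first by exists M, j; split.
  by move=> w' /pN w'0; exists 0; rewrite // linear0 w'0.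
by exists z.
Qed.

Section Forward.
Context (U D : {set I}) (T F : subcat L).
Local Notation x := (idem_sum e U).
Local Notation xD := (idem_sum e (U :|: D)).
Hypothesis tp : torsion_pair x (T, F).

(** For a module killed by the e_j, j in D, the old canonical sequence serves the new pair, since
    its torsion part is killed by them too. *)
Lemma torsion_pair_even : (forall k, k \in D -> kills_all e k F) ->
  torsion_pair xD (fun X => T X /\ hom_zero (proj_sum e x D) X, F).
Proof.
move=> hD; case: (tp) => -[Tfg Ffg] [Tiso Fiso] h0 ex; split.
- split=> [X [TX h]|X FX].
    have [MX fX] := Tfg X TX; split=> //; apply/(Mod_setU ce); split=> //.
    exact/(proj_sum_hom0 ce D MX).
  have [MX fX] := Ffg X FX; split=> //; apply/(Mod_setU ce); split=> // j jD.
  exact: hD FX.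
- split=> // X Y XY [TX h]; split; first exact: Tiso TX.
  exact: iso_hom_zero_r h.
- by move=> X Y [TX _]; apply: h0.
move=> X [/(Mod_setU ce)[MX kX] fX]; have [|V [W [TV FW E]]] := ex X; first by [].
exists V, W; split=> //; split=> //.
apply/(proj_sum_hom0 ce D); first by case: (Tfg V TV).
by move=> j jD; case: E => i [p [ii _ _]]; apply: (kills_inj ii); apply: kX.
Qed.

Lemma torsion_pair_odd : (forall k, k \in D -> kills_all e k T) ->
  torsion_pair xD (T, fun X => F X /\ hom_zero X (inj_sum J e x D)).
Proof.
move=> hD; case: (tp) => -[Tfg Ffg] [Tiso Fiso] h0 ex; split.
- split=> [X TX|X [FX h]].
    have [MX fX] := Tfg X TX; split=> //; apply/(Mod_setU ce); split=> // j jD.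
    exact: hD TX.
  have [MX fX] := Ffg X FX; split=> //; apply/(Mod_setU ce); split=> //.
  exact/(inj_sum_hom0 artL envJ ce D MX).
- split=> // X Y XY [FX h]; split; first exact: Fiso FX.
  exact: iso_hom_zero_l h.
- by move=> X Y TX [FY _]; apply: h0.
move=> X [/(Mod_setU ce)[MX kX] fX]; have [|V [W [TV FW E]]] := ex X; first by [].
exists V, W; split=> //; split=> //.
apply/(inj_sum_hom0 artL envJ ce D); first by case: (Ffg W FW).
by move=> j jD; case: E => i [p [_ ps _]]; apply: (kills_surj ps); apply: kX.
Qed.

Lemma ideal_mulr (y a b : L) : a \in ideal y -> a * b \in ideal y.
Proof.
move=> /asboolP[n [c [d ->]]]; apply/asboolP; exists n, c, (fun i => d i * b).
by rewrite big_distrl; apply: eq_bigr => i _; rewrite /= !mulrA.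
Qed.

Lemma ideal_mull (y a b : L) : b \in ideal y -> a * b \in ideal y.
Proof. by move=> h; apply: (@rpredZ _ _ (ideal y) a b h). Qed.

Lemma idem_sum_mulr U' j : j \in U' -> e j * idem_sum e U' = e j.
Proof.
move=> jU; rewrite mulr_sumr (bigD1 j) //= ee big1 ?addr0 // => i /andP[_ ij].
by case: ce => _ + _; apply; rewrite eq_sym.
Qed.

(** Without such an a, P_k has no part at D. The image of any map from P_k to Y in F then lies in F
    and has no maps to the I_j, j in D, so e_k kills it; thus e_k Y = 0, against full support. *)
Lemma link_odd k : (forall k, k \notin U -> ~ kills_all e k F) -> k \notin U ->
    kills_all e k (fun X => F X /\ hom_zero X (inj_sum J e x D)) ->
  exists a : L, idem_sum e D * a * e k \notin ideal x.
Proof.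
move=> fullF kU kF'; apply: contrapT => H; apply: (fullF k kU) => Y FY m.
have MY : Mod x Y := F_Mod tp FY.
have [g [eg gen g0 ex]] := iproj_gen ce U k; have [f fg] := ex Y m MY.
have [S [i [ii iP]]] := submodule_exists (submod_im f (@submod_setT _ _)).
have FS : F S := torsion_free_inj artL envJ tp ii FY.
have [s sE] : exists s, i s = f g by apply/iP; exists g.
have : e k *: s = 0.
  apply: (kF' S); split=> //; apply/(inj_sum_hom0 artL envJ ce D (F_Mod tp FS)) =>
    j jD s'.
  have [|p _ pE] := proj2 (iP (i s')); first by exists s'.
  apply: ii; rewrite linear0 linearZ -pE -linearZ; have [a ->] := gen p.
  suff -> : e j *: (a *: g) = 0 by rewrite linear0.
  rewrite scalerA; apply/g0; have -> : e j * a * e k = e j * (idem_sum e D * a * e k).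
    by rewrite !mulrA idem_sum_mulr.
  apply: ideal_mull; apply: contrapT => /negP nz.
  by apply: H; exists a.
by move=> /(congr1 i); rewrite linearZ sE fg linear0 /= scalerA ee.
Qed.

(** For X in T, divide by the submodule generated by the e_j X, j in D: the quotient is killed by
    e_k, so e_k X lies in that submodule. Without such an a the submodule is killed by e_k as well,
    against full support. *)
Lemma link_even k : (forall k, k \notin U -> ~ kills_all e k T) -> k \notin U ->
    kills_all e k (fun X => T X /\ hom_zero (proj_sum e x D) X) ->
  exists a : L, e k * a * idem_sum e D \notin ideal x.
Proof.
move=> fullT kU kT'; apply: contrapT => H; apply: (fullT k kU) => X TX m.
have MX : Mod x X := T_Mod tp TX.
pose N (y : X) := forall K, is_submod K -> (forall j (m : X),
  j \in D -> K (e j *: m)) -> K y.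
have sN : is_submod N.
  split=> [K [] //|a y z Ny Nz K sK hK]; case: (sK) => _; apply; [exact: Ny|exact: Nz].
have [W [p [ps pN]]] := quotient_exists sN.
have TW : T W := torsion_surj tp ps TX.
have /pN : p (e k *: m) = 0.
  rewrite linearZ; apply: (kT' W); split=> //.
  apply/(proj_sum_hom0 ce D (T_Mod tp TW)) => j jD w; have [y <-] := ps w.
  by rewrite -linearZ; apply/pN => K sK; apply.
move=> Nm; pose K (y : X) := forall c : L, e k *: (c *: y) = 0.
have sK : is_submod K.
  split=> [c|a y z hy hz c]; first by rewrite !scaler0.
  by rewrite !scalerDr hz addr0 [c *: (a *: y)]scalerA hy.
have hK j (m' : X) : j \in D -> K (e j *: m').
  move=> jD c; rewrite !scalerA; apply: MX; rewrite -(idem_sum_mul ce jD) !mulrA.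
  by apply: ideal_mulr; apply: contrapT => /negP h; apply: H; exists c.
by have := Nm K sK hK 1; rewrite scale1r scalerA ee.
Qed.

End Forward.

Section Backward.
Context (U D : {set I}) (T F : subcat L).
Local Notation x := (idem_sum e U).
Local Notation xD := (idem_sum e (U :|: D)).
Hypothesis tp : torsion_pair xD (T, F).

Lemma fgmod_setU X : fgmod xD X <-> fgmod x X /\ forall j, j \in D -> kills e j X.
Proof.
split=> [[/(Mod_setU ce)[MX kX] fX]|[[MX fX] kX]]; first by [].
by split=> //; apply/(Mod_setU ce).
Qed.

Lemma T_fgmod X : T X -> fgmod xD X. Proof. by case/(torsionP tp). Qed.
Lemma F_fgmod X : F X -> fgmod xD X. Proof. by case/(torsion_freeP tp). Qed.

Lemma T_kills j : j \in D -> kills_all e j T.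
Proof. by move=> jD X /T_fgmod/fgmod_setU[_]; apply. Qed.
Lemma F_kills j : j \in D -> kills_all e j F.
Proof. by move=> jD X /F_fgmod/fgmod_setU[_]; apply. Qed.

(** F stays closed under submodules and extensions over the larger ring, because modules killed by
    the e_j, j in D, are closed under extensions there. *)
Lemma back_even : torsion_pair x (left_perp x F, F).
Proof.
apply: torsion_pair_left_perp.
- by move=> X /F_fgmod/fgmod_setU[].
- by case: tp => _ [].
- by move=> X Y i ii; apply: (torsion_free_inj artL envJ tp ii).
- move=> X [MX fX] X0; apply/(torsion_freeP tp); split=> [|Z TZ f z]; last exact: X0.
  by apply/fgmod_setU; split=> // j _ m; apply: X0.
move=> X M Y E FX FY; apply: (torsion_free_ext tp E) => //.
by apply: (Mod_ext ce E); [case: (F_fgmod FX)|case: (F_fgmod FY)].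
Qed.

Lemma back_odd : torsion_pair x (T, right_perp x T).
Proof.
apply: torsion_pair_right_perp.
- by move=> X /T_fgmod/fgmod_setU[].
- by case: tp => _ [].
- by move=> X Y p ps; apply: (torsion_surj tp ps).
- move=> X [MX fX] X0; apply/(torsionP tp); split=> [|Z TZ f z];
  last by rewrite [z]X0 linear0.
  by apply/fgmod_setU; split=> // j _ m; apply: X0.
move=> X M Y E TX TY; apply: (torsion_ext tp E) => //.
by apply: (Mod_ext ce E); [case: (T_fgmod TX)|case: (T_fgmod TY)].
Qed.

Lemma back_evenE : (fun X => left_perp x F X /\ hom_zero (proj_sum e x D) X) = T.
Proof.
apply: funext => X; apply/propext; split=> [[[[MX fX] h] k]|TX].
  apply/(torsionP tp); split=> //; apply/fgmod_setU; split=> //.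
  exact/(proj_sum_hom0 ce D MX).
have /fgmod_setU[[MX fX] kX] := T_fgmod TX.
split; last exact/(proj_sum_hom0 ce D MX).
by split=> //; case/(torsionP tp): TX.
Qed.

Lemma back_oddE : (fun X => right_perp x T X /\ hom_zero X (inj_sum J e x D)) = F.
Proof.
apply: funext => X; apply/propext; split=> [[[[MX fX] h] k]|FX].
  apply/(torsion_freeP tp); split=> //; apply/fgmod_setU; split=> //.
  exact/(inj_sum_hom0 artL envJ ce D MX).
have /fgmod_setU[[MX fX] kX] := F_fgmod FX.
split; last exact/(inj_sum_hom0 artL envJ ce D MX).
by split=> //; case/(torsion_freeP tp): FX.
Qed.

Lemma ideal_sum_idem (a b : L) (D' : {set I}) : a * idem_sum e D' * b \notin ideal x ->
  exists2 j, j \in D' & a * e j * b \notin ideal x.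
Proof.
move=> h; apply: contrapT => H; move/negP: h; apply.
rewrite mulr_sumr mulr_suml; apply: (@rpred_sum _ (ideal x)) => j jD.
by apply: contrapT => /negP h; apply: H; exists j.
Qed.

(** The I_j with j in D lie in the enlarged torsion-free class. They supply the indices of D; for
    any other missing k, the link gives an element of e_j P_k that I_j separates from 0, so e_k does
    not kill I_j. *)
Lemma back_odd_full :
    (forall k, k \notin U :|: D -> kills_all e k F ->
      exists a : L, idem_sum e D * a * e k \notin ideal x) ->
  forall k, k \notin U -> ~ kills_all e k (right_perp x T).
Proof.
move=> hk k kU kF1.
have QF j : j \in D -> right_perp x T (iinj J e U j).
  by move=> jD; apply/(iinj_torsion_free artL envJ ce back_odd)/T_kills.
have [kD|kD] := boolP (k \in D).
  exact: (iinj_nonzero artL envJ ce be kU (kF1 _ (QF k kD))).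
have [|X FX|a] := hk k; first by rewrite inE negb_or kU.
  apply: kF1; have /fgmod_setU[fX _] := F_fgmod FX.
  by split=> //; case/(torsion_freeP tp): FX.
rewrite -[idem_sum e D]mul1r -mulrA => /ideal_sum_idem[j jD]; rewrite mul1r => nz.
have [g [eg gen g0 ex]] := iproj_gen ce U k.
have z0 : e j *: (a *: g) <> 0.
  by rewrite scalerA => /g0; apply/negP; rewrite -mulrA.
have [|f] := coinduced_separates artL envJ (iinj_coinduced J ce U j) _ z0.
  exact: iproj_Mod.
by apply; rewrite linearZ -eg linearZ /= (kF1 _ (QF j jD)) scaler0.
Qed.

(** Dually, the P_j with j in D lie in the enlarged torsion class, and a link from j to k says that
    e_k P_j is nonzero. *)
Lemma back_even_full :
    (forall k, k \notin U :|: D -> kills_all e k T ->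
      exists a : L, e k * a * idem_sum e D \notin ideal x) ->
  forall k, k \notin U -> ~ kills_all e k (left_perp x F).
Proof.
move=> hk k kU kT1.
have PT j : j \in D -> left_perp x F (iproj e U j).
  by move=> jD; apply/(iproj_torsion ce back_even)/F_kills.
have [kD|kD] := boolP (k \in D).
  exact: (iproj_nonzero artL envJ ce be kU (kT1 _ (PT k kD))).
have [|X TX|a] := hk k; first by rewrite inE negb_or kU.
  apply: kT1; have /fgmod_setU[fX _] := T_fgmod TX.
  by split=> //; case/(torsionP tp): TX.
rewrite -[_ * idem_sum e D]mulr1 => /ideal_sum_idem[j jD]; rewrite mulr1 => nz.
have [g [eg gen g0 ex]] := iproj_gen ce U j.
move/negP: nz; apply; apply/g0; rewrite -scalerA; exact: (kT1 _ (PT j jD)).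
Qed.

End Backward.
End Steps.

(** * The correspondence *)

Section Sequences.
Context (R : comNzRingType) (L : algType R) (J : lmodType R) (I : finType) (e : I -> L).
Implicit Types (X Y Z M : lmodType L) (U D : {set I}) (T F C : subcat L)
  (S : seq {set I}) (tf : subcat_pair L).

Hypothesis artL : artin_algebra L.
Hypothesis envJ : injective_envelope (semisimple_quotient R) J.
Hypothesis ce : complete_primitive_orthogonal e.
Hypothesis be : basic_idempotents e.

Let pe i : primitive_idempotent (e i). Proof. by case: ce. Qed.
Let ee i : e i * e i = e i. Proof. by case: (pe i). Qed.

Section Filtration.
Context (U D : {set I}) (T F : subcat L).
Local Notation x := (idem_sum e U).
Hypothesis tp : torsion_pair x (T, F).

(** X' is the trace in X of the sum of the P_j. It contains every e_j X with j in D, so the quotient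
    is killed by these e_j. *)
Lemma torsion_split X : T X -> exists X' Z,
  [/\ short_exact X' X Z, Gen (proj_sum e x D) X' & T Z /\ hom_zero (proj_sum e x D) Z].
Proof.
move=> TX; have MX : Mod x X := T_Mod tp TX; have fX := T_fin_gen tp TX.
pose N (y : X) := forall K, is_submod K ->
  (forall (f : {linear proj_sum e x D -> X}) m, K (f m)) -> K y.
have sN : is_submod N.
  split=> [K [] //|a y z Ny Nz K sK hK]; case: (sK) => _; apply; [exact: Ny|exact: Nz].
have [X' [Z [i [p [ii ps iP pP]]]]] := submodule_quotient sN.
exists X', Z; split; first by apply: (short_exactP ii ps) => z; rewrite pP iP.
  have fX' : fin_gen X' := fin_gen_inj artL envJ ii fX.
  split=> //; apply: finite_generation (noetherian_fg artL envJ fX') _ => N' sN' hN' x'.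
  have /(_ (fun y => exists2 z, N' z & i z = y)) h : N (i x') by apply/iP; exists x'.
  have [||z + /ii <-//] := h; first exact: submod_im.
  move=> f m; have [|f' f'E] := @factor_inj _ _ _ _ i f ii.
    by move=> m'; apply/iP => K _; apply.
  by exists (f' m).
have TZ := torsion_surj tp ps TX; split=> //.
apply/(proj_sum_hom0 ce D (T_Mod tp TZ)) => j jD z; have [y <-] := ps z.
rewrite -linearZ; apply/pP => K sK hK.
have [g [eg gen g0 ex]] := iproj_gen ce U j; have [f <-] := ex X y MX.
have [k [r kr]] := retract_biprod (exist _ j jD) (proj_sum_biprod e U D).
by have := hK (f \o r : {linear _ -> _}) (k g); rewrite /= kr.
Qed.

(** X' is the common kernel of all maps from X to the sum of the I_j, j in D. These maps separate
    the elements of e_j X, so e_j kills X', and they cogenerate the quotient. *)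
Lemma torsion_free_split X : F X -> exists X' Z,
  [/\ short_exact X' X Z, F X' /\ hom_zero X' (inj_sum J e x D) & Cogen (inj_sum J e x
    D) Z].
Proof.
move=> FX; have MX : Mod x X := F_Mod tp FX; have fX := F_fin_gen tp FX.
pose N (y : X) := forall f : {linear X -> inj_sum J e x D}, f y = 0.
have sN : is_submod N.
  split=> [f|a y z Ny Nz f]; first by rewrite linear0.
  by rewrite linearP Ny Nz scaler0 addr0.
have [X' [Z [i [p [ii ps iP pP]]]]] := submodule_quotient sN.
exists X', Z; split; first by apply: (short_exactP ii ps) => z; rewrite pP iP.
  have FX' := torsion_free_inj artL envJ tp ii FX; split=> //.
  apply/(inj_sum_hom0 artL envJ ce D (F_Mod tp FX')) => j jD y.
  apply: ii; rewrite linear0 linearZ; apply: contrapT => ne.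
  have [|f] := coinduced_separates artL envJ (iinj_coinduced J ce U j) MX (m :=
    e j *: i y).
    by rewrite scalerA ee.
  apply; rewrite linearZ; have [k [r kr]] :=
    retract_biprod (exist _ j jD) (inj_sum_biprod J e U D).
  have Niy : N (i y) by apply/iP; exists y.
  by rewrite -(kr (f (i y))); have /= -> := Niy (k \o f : {linear _ -> _});
    rewrite linear0 scaler0.
have fZ := fin_gen_surj ps fX; split=> //.
apply: finite_cogeneration (artinian_fg artL fZ) _ => z z0.
have [y yE] := ps z; apply: contrapT => H; apply: z0; rewrite -yE; apply/pP => f.
have [|f' f'E] := @factor_surj _ _ _ _ p f ps; first by move=> w /pP; apply.
by rewrite -f'E; apply: contrapT => ne; apply: H; exists f'; rewrite -yE.
Qed.

Lemma Gen_torsion X : (forall k, k \in D -> kills_all e k F) ->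
  Gen (proj_sum e x D) X -> T X.
Proof.
move=> hD [fX [n [p ps]]]; have bM := ffun_biprod n (proj_sum e x D : lmodType L).
apply/(torsionP tp); split.
  split=> //; apply: (Mod_surj ps); apply: (Mod_biprod bM) => _; exact: proj_sum_Mod.
move=> Y FY f y; have [z <-] := ps y.
have h : hom_zero {ffun 'I_n -> proj_sum e x D}%type Y.
  apply/(biprod_hom_out bM) => _; apply/(proj_sum_hom0 ce D (F_Mod tp FY)) => j jD.
  exact: hD FY.
exact: (h (f \o p : {linear _ -> _})).
Qed.

Lemma Cogen_torsion_free X : (forall k, k \in D -> kills_all e k T) ->
  Cogen (inj_sum J e x D) X -> F X.
Proof.
move=> hD [fX [n [i ii]]]; have bM := ffun_biprod n (inj_sum J e x D : lmodType L).
apply/(torsion_freeP tp); split.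
  split=> //; apply: (Mod_inj ii); apply: (Mod_biprod bM) => _; exact: inj_sum_Mod.
move=> Y TY f y; apply: ii; rewrite linear0.
have h : hom_zero Y {ffun 'I_n -> inj_sum J e x D}%type.
  apply/(biprod_hom_in bM) => _; apply/(inj_sum_hom0 artL envJ ce D (T_Mod tp TY)) =>
    j jD.
  exact: hD TY.
exact: (h (i \o f : {linear _ -> _})).
Qed.

End Filtration.

Definition cov S : {set I} := \bigcup_(D <- S) D.

Lemma cov_rcons S D : cov (rcons S D) = cov S :|: D.
Proof. by rewrite /cov -cats1 big_cat big_seq1. Qed.

Lemma eps_rcons S D : eps e (rcons S D) = eps e S + idem_sum e D.
Proof. by rewrite /eps -cats1 big_cat big_seq1. Qed.

Lemma idem_sum_setU U D : [disjoint D & U] ->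
  idem_sum e (U :|: D) = idem_sum e U + idem_sum e D.
Proof.
move=> dU; rewrite /idem_sum (big_setID U) /=; congr (_ + _); apply: eq_bigl => i.
  by rewrite !inE; case: (i \in U); rewrite ?andbF.
rewrite !inE; case: (boolP (i \in D)) => [/(disjointFr dU) ->//|]; by case: (i \in U).
Qed.

Definition disjoint_seq S : Prop :=
  forall i j, (i < j < size S)%N -> [disjoint nth set0 S i & nth set0 S j].

Lemma mem_covP S k : reflect (exists2 i,
  (i < size S)%N & k \in nth set0 S i) (k \in cov S).
Proof.
elim/last_ind: S => [|S D IH]; first by rewrite /cov big_nil inE; constructor=> -[].
rewrite cov_rcons inE; apply: (iffP orP) => [[/IH[i iS kS]|kD]|[i]].
- by exists i; rewrite ?size_rcons ?nth_rcons ?iS // ltnW.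
- by exists (size S); rewrite ?size_rcons ?nth_rcons ?ltnn ?eqxx.
rewrite size_rcons ltnS leq_eqVlt nth_rcons => /orP[/eqP ->|iS].
  by rewrite ltnn eqxx; right.
by rewrite iS => kS; left; apply/IH; exists i.
Qed.

Lemma disjoint_seq_rcons S D :
  disjoint_seq (rcons S D) <-> disjoint_seq S /\ [disjoint D & cov S].
Proof.
split=> [h|[h dD] i j].
  split=> [i j /andP[ij jS]|].
    have := h i j; rewrite !nth_rcons jS (ltn_trans ij jS) size_rcons ltnS (ltnW jS) ij.
    by apply.
  rewrite disjoint_sym disjoint_subset; apply/subsetP => k /mem_covP[i iS kS].
  have := h i (size S); rewrite size_rcons !nth_rcons iS ltnn eqxx leqnn => /(_ isT) d.
  by rewrite inE (disjointFr d kS).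
rewrite size_rcons ltnS => /andP[ij]; rewrite leq_eqVlt => /orP[/eqP jE|jS]; last first.
  by rewrite !nth_rcons jS (ltn_trans ij jS); apply: h; rewrite ij.
rewrite jE in ij *; rewrite !nth_rcons ij ltnn eqxx disjoint_sym.
rewrite disjoint_subset; apply/subsetP => k kD; rewrite inE; apply/negP => kS.
have := disjointFr dD kD; move/negbT/negP; apply; apply/mem_covP; by exists i.
Qed.

Lemma eps_cov S : disjoint_seq S -> eps e S = idem_sum e (cov S).
Proof.
elim/last_ind: S => [_|S D IH /disjoint_seq_rcons[dS dD]].
  by rewrite /eps /cov !big_nil /idem_sum big_set0.
by rewrite eps_rcons cov_rcons idem_sum_setU // IH.
Qed.

Lemma disjoint_seq_take n S : disjoint_seq S -> disjoint_seq (take n S).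
Proof.
move=> h i j /andP[ij jn]; have := jn; rewrite size_take_min leq_min => /andP[jn' jS].
by rewrite !nth_take ?(ltn_trans ij) //; apply: h; rewrite ij.
Qed.

(* The condition that the type imposes on [k] at position [i] of [S]. *)
Definition link_at S i k : Prop :=
  let D := nth set0 S i.-1 in
  let x := eps e (take i.-1 S) in
  if odd i then (1 < i)%N -> exists a : L, e k * a * idem_sum e D \notin ideal x
  else exists a : L, idem_sum e D * a * e k \notin ideal x.

(** The two parities become one condition indexed by the position, which can be carried through an
    induction on S. *)
Lemma type1_linkP S : type1_part_partition e S <->
  [/\ (0 < size S)%N, disjoint_seq S, forall i,
    (0 < i < size S)%N -> nth set0 S i != set0 &
      forall i, (0 < i < size S)%N -> forall k, k \in nth set0 S i -> link_at S i k].
Proof.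
split=> [[[S0 dS nS] h1 h2]|[S0 dS nS hl]].
  split=> // i /andP[i0 iS] k kD; rewrite /link_at; case: ifP => oi.
    move=> i1; have iE : i = i./2.*2.+1 by rewrite -[LHS]odd_double_half oi.
    have /= := h2 i./2; rewrite -iE i1 iS => /(_ isT k kD).
    by have -> : i./2.*2 = i.-1 by rewrite [in RHS]iE.
  have iE : i = i./2.*2 by rewrite -[LHS]odd_double_half oi.
  by have /= := h1 i./2; rewrite -iE i0 iS => /(_ isT k kD).
split=> // i /andP[i0 iS] k kD.
  by have := hl i.*2; rewrite /link_at odd_double i0 iS => /(_ isT k kD).
have := hl i.*2.+1; rewrite /link_at /= odd_double iS /= => /(_ isT k kD).
by apply.
Qed.

Lemma link_at_rcons S D i k : (0 < i <= size S)%N ->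
  link_at (rcons S D) i k <-> link_at S i k.
Proof.
case: i => // i /= iS; rewrite /link_at /= nth_rcons iS.
by rewrite -cats1 takel_cat // ltnW.
Qed.

End Sequences.

(** * Invariants of the procedure *)

Section Correspondence.
Context (R : comNzRingType) (L : algType R) (J : lmodType R) (I : finType) (e : I -> L).
Implicit Types (X Y Z M : lmodType L) (U D : {set I}) (T F C : subcat L)
  (S : seq {set I}) (tf tfz : subcat_pair L).

Hypothesis artL : artin_algebra L.
Hypothesis envJ : injective_envelope (semisimple_quotient R) J.
Hypothesis ce : complete_primitive_orthogonal e.
Hypothesis be : basic_idempotents e.

Lemma stage_choiceP S tf D : disjoint_seq S -> torsion_pair (eps e S) tf ->
  stage_choice J e S tf D <->
  forall k, k \in D <-> k \notin cov S /\ kills_all e k (if odd (size S) then tf.1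
    else tf.2).
Proof.
move=> dS; case: tf => T F; rewrite /stage_choice eps_cov // => tp.
rewrite -/(cov S); split=> [[dD]|h].
  by case: ifP => _; [move/(torsion_free_choiceP artL envJ ce be tp
    dD)|move/(torsion_choiceP artL envJ ce be tp dD)].
have dD : [disjoint D & cov S].
  by rewrite disjoint_subset; apply/subsetP => k /h[].
split=> //; move: h; case: ifP => _ h.
  exact/(torsion_free_choiceP artL envJ ce be tp dD).
exact/(torsion_choiceP artL envJ ce be tp dD).
Qed.

Lemma stage_choice_disjoint S tf D : stage_choice J e S tf D -> [disjoint D & cov S].
Proof. by case. Qed.

Lemma torsion_pair_stage_next S tf D : disjoint_seq S -> torsion_pair (eps e S) tf ->
  stage_choice J e S tf D -> torsion_pair (eps e (rcons S D)) (stage_next J e S tf D).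
Proof.
move=> dS tp sc; have dD := stage_choice_disjoint sc.
have dS' : disjoint_seq (rcons S D) by apply/disjoint_seq_rcons.
move/(stage_choiceP _ dS tp): sc; rewrite (eps_cov e dS') cov_rcons.
case: tf tp => T F; rewrite /stage_next (eps_cov e dS) => tp.
case: ifP => _ /= h.
  by apply: (torsion_pair_odd artL envJ ce tp) => k /h[].
by apply: (torsion_pair_even ce tp) => k /h[].
Qed.

Lemma torsion_pair_E_kills S tf : disjoint_seq S -> torsion_pair (eps e S) tf ->
  torsion_pair_E (eps e S) tf <->
  forall k, k \notin cov S -> ~ kills_all e k tf.2 /\ ~ kills_all e k tf.1.
Proof.
move=> dS; case: tf => T F; rewrite eps_cov // => tp.
exact: (torsion_pair_EP artL envJ ce be tp).
Qed.

(** The invariant of a run. The third clause is full support for the class that the last stage left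
    unchanged. The last clause prepares the next stage: every index it could remove is already
    linked to the last set removed, and becomes an instance of the fourth clause once chosen. *)
Lemma F_stages_spec tfz S tf : torsion_pair 0 tfz -> F_stages J e tfz S tf ->
  [/\ disjoint_seq S, torsion_pair (eps e S) tf,
      S <> [::] -> forall k, k \notin cov S ->
        ~ kills_all e k (if odd (size S) then tf.2 else tf.1),
      forall i, (0 < i < size S)%N ->
        nth set0 S i != set0 /\ forall k, k \in nth set0 S i -> link_at e S i k &
      (0 < size S)%N -> forall k, k \notin cov S ->
        kills_all e k (if odd (size S) then tf.1 else tf.2) -> link_at e S (size S) k].
Proof.
move=> tp0; elim=> [|{}S {}tf D FS [dS tp full lk hint] _ nE sc].
  by split=> // [i j||i]; rewrite ?ltn0 ?andbF // /eps big_nil.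
have tp' := torsion_pair_stage_next dS tp sc.
have dD := stage_choice_disjoint sc.
have dS' : disjoint_seq (rcons S D) by apply/disjoint_seq_rcons.
have hD := proj1 (stage_choiceP D dS tp) sc.
split=> //; rewrite ?size_rcons /= ?cov_rcons.
- move=> _ k; rewrite inE negb_or => /andP[kS kD] kk; move/negP: kD; apply; apply/hD.
  by split=> //; move: kk; rewrite /stage_next; case: (odd _).
- move=> i /andP[i0]; rewrite ltnS leq_eqVlt => /orP[/eqP iE|iS]; last first.
    rewrite nth_rcons iS; have [|ni li] := lk i; first by rewrite i0.
    by split=> // k kD; apply/link_at_rcons; [rewrite i0 ltnW|exact: li].
  have S0 : (0 < size S)%N by rewrite -iE.
  rewrite iE nth_rcons ltnn eqxx; split=> [|k kD]; last first.
    have /hD[kS kk] := kD.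
    by apply/link_at_rcons; [rewrite S0 /=|exact: hint].
  (* An empty choice would give full support to the class under examination; the other class has it
     by the invariant, so the pair would be in E and the procedure would have stopped. *)
  apply/eqP => D0; have SN : S <> [::] by move=> SN; rewrite SN in S0.
  apply: nE; first exact/eqP.
  apply/torsion_pair_E_kills => // k kS; have := full SN k kS; have := proj2 (hD k).
  rewrite D0 inE; case: (odd _) => h1 h2; split=> // h3; suff : false by [];
    apply: h1; by split.
move=> _ k; rewrite inE negb_or => /andP[kS kD] kk;
  rewrite /link_at /= nth_rcons ltnn eqxx.
rewrite -cats1 take_size_cat //.
move: tp kk full; rewrite eps_cov // /stage_next;
  case: tf {FS tp' hint nE sc hD} => T F tp.
rewrite !eps_cov //; case: (boolP (odd (size S))) => oS /= kk full.
  apply: (link_odd artL envJ ce tp _ kS kk); apply: full => SN.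
  by rewrite SN in oS.
rewrite ltnS => S0; apply: (link_even ce tp _ kS kk); apply: full => SN.
by rewrite SN in S0.
Qed.

End Correspondence.

(** * Existence and uniqueness of the output of F *)

Section Maps.
Context (R : comNzRingType) (L : algType R) (J : lmodType R) (I : finType) (e : I -> L).
Implicit Types (X Y Z M : lmodType L) (U D : {set I}) (T F C : subcat L)
  (S : seq {set I}) (tf tfz : subcat_pair L) (y : seq {set I} * subcat_pair L).

Hypothesis artL : artin_algebra L.
Hypothesis envJ : injective_envelope (semisimple_quotient R) J.
Hypothesis ce : complete_primitive_orthogonal e.
Hypothesis be : basic_idempotents e.

Lemma F_stages_nil tfz tf : F_stages J e tfz [::] tf -> tf = tfz.
Proof.
move E: [::] => S0 FS; case: FS E => // S tf0 D _ _ _ _.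
by move/(congr1 size); rewrite size_rcons.
Qed.

Lemma F_stages_rcons tfz S D tf : F_stages J e tfz (rcons S D) tf -> exists tf0,
  [/\ F_stages J e tfz S tf0, S != [::] -> ~ torsion_pair_E (eps e S) tf0,
      stage_choice J e S tf0 D & tf = stage_next J e S tf0 D].
Proof.
move E: (rcons S D) => S0 FS; case: FS E => [|S1 tf0 D1 {}FS _ nE sc].
  by move/(congr1 size); rewrite size_rcons.
by move=> /rcons_inj[-> ->]; exists tf0.
Qed.

Section Forward.
Context (tfz : subcat_pair L).
Hypothesis tpz : torsion_pair 0 tfz.

Lemma F_stages_unique S S' tf tf' : size S = size S' ->
  F_stages J e tfz S tf -> F_stages J e tfz S' tf' -> S = S' /\ tf = tf'.
Proof.
elim/last_ind: S S' tf tf' => [|S D IH] S' tf tf'.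
  by case: S' => // _ /F_stages_nil -> /F_stages_nil ->.
case/lastP: S' => [|S' D']; first by rewrite size_rcons.
rewrite !size_rcons => -[sE] /F_stages_rcons[tf0 [FS _ sc ->]] /F_stages_rcons[tf1
  [FS' _ sc' ->]].
have [ES Etf] := IH _ _ _ sE FS FS'; rewrite -{}ES -{}Etf in FS' sc' *.
have [dS tp _ _ _] := F_stages_spec artL envJ ce be tpz FS.
have -> : D = D'; last by [].
have h := proj1 (stage_choiceP artL envJ ce be D dS tp) sc.
have h' := proj1 (stage_choiceP artL envJ ce be D' dS tp) sc'.
by apply/setP => k; apply/idP/idP => [/h/h'|/h'/h].
Qed.

Lemma F_stages_prefix n S tf : (n < size S)%N -> F_stages J e tfz S tf ->
  exists2 tf', F_stages J e tfz (take n S) tf' &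
    take n S != [::] -> ~ torsion_pair_E (eps e (take n S)) tf'.
Proof.
elim/last_ind: S tf => [|S D IH] tf //; rewrite size_rcons ltnS leq_eqVlt.
case/orP=> [/eqP ->|nS] /F_stages_rcons[tf0 [FS nE _ _]].
  by rewrite -cats1 take_size_cat //; exists tf0.
by rewrite -cats1 takel_cat ?(ltnW nS) //; apply: IH FS.
Qed.

(** The longer of two runs passes through the final pair of the shorter one, which lies in E, and
    may not continue from there. *)
Lemma F_graph_unique y y' : F_graph J e tfz y -> F_graph J e tfz y' -> y = y'.
Proof.
have lt z z' : F_graph J e tfz z -> F_graph J e tfz z' -> (size z'.1 <= size z.1)%N.
  move=> [nS FS E] [_ FS' _]; rewrite leqNgt; apply/negP => ltS.
  have [tf1 FS1 nE] := F_stages_prefix ltS FS'.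
  have [ES Etf] := F_stages_unique (esym (size_takel (ltnW ltS))) FS FS1.
  by apply: nE; rewrite -ES -?Etf.
move=> Gy Gy'; have szE : size y.1 = size y'.1 by apply/eqP; rewrite eqn_leq !lt.
case: Gy Gy' => [_ FS _] [_ FS' _]; have [E1 E2] := F_stages_unique szE FS FS'.
by rewrite (surjective_pairing y) (surjective_pairing y') E1 E2.
Qed.

Lemma F_graph_exists : exists y, F_graph J e tfz y.
Proof.
have step S tf : F_stages J e tfz S tf -> (S != [::] ->
  ~ torsion_pair_E (eps e S) tf) ->
    exists D, F_stages J e tfz (rcons S D) (stage_next J e S tf D).
  move=> FS nE; have [dS tp _ _ _] := F_stages_spec artL envJ ce be tpz FS.
  exists [set k | (k \notin cov S) && `[< kills_all e k (if odd (size S) then tf.1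
    else tf.2) >]].
  apply: F_stage => //; apply/(stage_choiceP artL envJ ce be _ dS tp) => k; rewrite inE.
  by split=> [/andP[kS /asboolP]|[kS /asboolP ->]]; rewrite ?kS.
(* Termination: after the first stage every chosen set is nonempty, so the number of remaining
   indices drops strictly. *)
suff loop n S tf : (#|~: cov S| < n)%N -> S != [::] -> F_stages J e tfz S tf ->
  exists y, F_graph J e tfz y.
  have [|D FS] := @step [::] tfz (F_start _ _ _); first by [].
  by apply: (loop #|~: cov (rcons [::] D)|.+1 _ _ _ _ FS).
elim: n S tf => // n IH S tf lt nS FS.
have [E|nE] := EM (torsion_pair_E (eps e S) tf); first by exists (S, tf).
have [D FS'] := step S tf FS (fun _ => nE).
apply: (IH _ _ _ _ FS'); last by case: (S).
rewrite ltnS in lt; apply: leq_trans lt; apply: proper_card.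
rewrite cov_rcons.
have [dS' tp' _ lk _] := F_stages_spec artL envJ ce be tpz FS'.
have /disjoint_seq_rcons[_ dD] := dS'.
have [|D0 _] := lk (size S); first by rewrite size_rcons ltnSn andbT lt0n size_eq0.
rewrite nth_rcons ltnn eqxx in D0; have /set0Pn[k kD] := D0.
apply/properP; split; first by rewrite setCU subsetIl.
by exists k; rewrite !inE ?kD ?orbT // (disjointFr dD kD).
Qed.

Lemma F_graph_type1 y : F_graph J e tfz y ->
  type1_part_partition e y.1 /\ torsion_pair_E (eps e y.1) y.2.
Proof.
case: y => S tf [/= nS FS E]; split=> //.
have [dS _ _ lk _] := F_stages_spec artL envJ ce be tpz FS.
apply/type1_linkP; split=> //; first by rewrite lt0n size_eq0.
  by move=> i /lk[].
by move=> i /lk[].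
Qed.

End Forward.
End Maps.

(** * Running the procedure backwards, and the formula for G *)

Section Inverse.
Context (R : comNzRingType) (L : algType R) (J : lmodType R) (I : finType) (e : I -> L).
Implicit Types (X Y Z M : lmodType L) (U D : {set I}) (T F C : subcat L)
  (S : seq {set I}) (tf tfz : subcat_pair L) (y : seq {set I} * subcat_pair L).

Hypothesis artL : artin_algebra L.
Hypothesis envJ : injective_envelope (semisimple_quotient R) J.
Hypothesis ce : complete_primitive_orthogonal e.
Hypothesis be : basic_idempotents e.

(** Starting from the final pair, each stage is undone by taking a perpendicular class over the
    larger ring. The links of the type keep supports full where needed, so that rerunning the
    procedure removes exactly the prescribed sets and stops no earlier. *)
Lemma F_stages_backward S tf' : type1_part_partition e S ->
  torsion_pair_E (eps e S) tf' ->
  exists2 tfz, torsion_pair 0 tfz & F_graph J e tfz (S, tf').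
Proof.
move=> /type1_linkP[S0 dS nS lk] E; case: (E) => tp' _ _.
have hE := proj1 (torsion_pair_E_kills artL envJ ce be dS tp') E.
(* Downward induction on n. The clauses say that stage n can remove only indices of the n-th set,
   that the other class has full support when n is positive, and that a run reaching this pair
   continues to the given end. *)
suff loop m n : size S = (n + m)%N -> exists tf,
    [/\ torsion_pair (eps e (take n S)) tf,
        forall k, k \notin cov (take n S) -> kills_all e k (if odd n then tf.1 else
          tf.2) ->
          (n < size S)%N /\ k \in nth set0 S n,
        (0 < n)%N -> forall k, k \notin cov (take n S) ->
          ~ kills_all e k (if odd n then tf.2 else tf.1) &
        forall tfz, F_stages J e tfz (take n S) tf -> F_stages J e tfz S tf'].
  have [tf [tp _ _ FS]] := loop (size S) 0%N (add0n _).
  rewrite take0 in tp FS; exists tf; first by rewrite /eps big_nil in tp.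
  by split; [rewrite -size_eq0 -lt0n|apply: FS; apply: F_start|].
elim: m n => [|m IH] n sE.
  have -> : take n S = S by rewrite take_oversize // sE addn0.
  by exists tf'; split=> // [k /hE[h1 h2]|_ k /hE[h1 h2]]; case: odd.
have nlt : (n < size S)%N by rewrite sE addnS ltnS leq_addr.
have [|tf2 [tp2 inv2 full2 FS2]] := IH n.+1; first by rewrite sE addnS.
have dn : disjoint_seq (take n S) by apply: disjoint_seq_take.
have dn1 : disjoint_seq (take n.+1 S) by apply: disjoint_seq_take.
have sn : size (take n S) = n by rewrite size_takel // ltnW.
have lkn k : (n.+1 < size S)%N -> k \in nth set0 S n.+1 -> link_at e S n.+1 k.
  by move=> h; apply: lk.
have D0 : (0 < n)%N -> nth set0 S n != set0 by move=> n0; apply: nS; rewrite n0.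
move: tp2 inv2 full2 FS2; rewrite (eps_cov e dn1) (take_nth set0 nlt) cov_rcons.
move: lkn D0; rewrite /link_at /= (eps_cov e dn).
set D := nth set0 S n; set U := cov (take n S) => lkn D0;
  case: tf2 => T F tp inv full FS.
have /disjoint_seq_rcons[_ dD] : disjoint_seq (rcons (take n S) D) by rewrite -take_nth.
have {}full := full isT.
have finish tf : torsion_pair (idem_sum e U) tf ->
    (forall k, k \in D <-> k \notin U /\ kills_all e k (if odd n then tf.1 else tf.2))
      ->
    stage_next J e (take n S) tf D = (T, F) ->
    forall tfz, F_stages J e tfz (take n S) tf -> F_stages J e tfz S tf'.
  move=> tp0 hD En tfz FSn; apply: FS; rewrite -En.
  have tp1 : torsion_pair (eps e (take n S)) tf by rewrite eps_cov.
  apply: F_stage => //; last by apply/(stage_choiceP artL envJ ce be D dn tp1);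
    rewrite sn.
  (* For positive n the stage is really performed: D is nonempty and its indices are missing from a
     support, so the pair is not in E. *)
  rewrite -size_eq0 sn -lt0n => /D0/set0Pn[k /hD[kU kk]].
  move/(torsion_pair_E_kills artL envJ ce be dn tp1)/(_ k kU).
  by move: kk; case: odd => kk [].
move: inv full finish lkn; rewrite /stage_next sn (eps_cov e dn) -/U /=.
have [on|on] := boolP (odd n) => /= inv full finish lkn.
  have tpb := back_odd artL envJ ce tp.
  have hD k : k \in D <-> k \notin U /\ kills_all e k T.
    split=> [kD|[kU kk]]; first by rewrite (disjointFr dD) //; split=> //;
      apply: (T_kills ce tp).
    by apply: contrapT => /negP kD; apply: (full k) => //; rewrite inE negb_or kU.
  exists (T, right_perp (idem_sum e U) T); split=> //.
  - by move=> k kU kk; split=> //; apply/hD.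
  - move=> n0; apply: (back_odd_full artL envJ ce be tp) =>
    k kUD /(inv k kUD)[h /lkn]; exact.
  by apply: finish => //; rewrite (back_oddE artL envJ ce tp).
have tpb := back_even artL envJ ce tp.
have hD k : k \in D <-> k \notin U /\ kills_all e k F.
  split=> [kD|[kU kk]]; first by rewrite (disjointFr dD) //; split=> //;
    apply: (F_kills ce tp).
  by apply: contrapT => /negP kD; apply: (full k) => //; rewrite inE negb_or kU.
exists (left_perp (idem_sum e U) F, F); split=> //.
- by move=> k kU kk; split=> //; apply/hD.
- move=> n0; apply: (back_even_full artL envJ ce be tp) => k kUD /(inv k kUD)[h /lkn];
  exact.
by apply: finish => //; rewrite (back_evenE ce tp).
Qed.

Definition G_gen1 S tf : subcat L := fun X => tf.1 X \/ exists i,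
  [/\ (i < size S)%N, ~~ odd i & Gen (proj_sum e (eps e (take i S)) (nth set0 S i)) X].

Definition G_gen2 S tf : subcat L := fun X => tf.2 X \/ exists i,
  [/\ (i < size S)%N, odd i & Cogen (inj_sum J e (eps e (take i S)) (nth set0 S i)) X].

Lemma ext_closure_sub C C' X : (forall Y, C Y -> ext_closure C' Y) ->
  ext_closure C X -> ext_closure C' X.
Proof.
move=> h; elim=> [Y /h//|Z M Y _ IHU _ IHY E]; exact: ext_ext IHU IHY E.
Qed.

Lemma ext_closure_min C C' X : (forall Y, C Y -> C' Y) ->
  (forall X M Y, short_exact X M Y -> C' X -> C' Y -> C' M) -> ext_closure C X -> C' X.
Proof.
move=> h hE; elim=> [Y /h//|Z M Y _ IHU _ IHY E]; exact: hE E IHU IHY.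
Qed.

(** The formula for G holds along the whole run, not only at its end: each stage replaces a module
    of the shrinking class by an extension of a generated (or cogenerated) piece and a module of the
    new class. The converse inclusions hold because T and F are closed under extensions. *)
Lemma F_stages_G tfz S tf : torsion_pair 0 tfz -> F_stages J e tfz S tf ->
  tfz = G_map J e (S, tf).
Proof.
move=> tpz FS.
have {FS}[sub1 sub2 sup1 sup2] : [/\ forall X, G_gen1 S tf X -> tfz.1 X,
    forall X, G_gen2 S tf X -> tfz.2 X,
    forall X, tfz.1 X -> ext_closure (G_gen1 S tf) X &
    forall X, tfz.2 X -> ext_closure (G_gen2 S tf) X].
  elim: FS => [|{}S {}tf D FS [sub1 sub2 sup1 sup2] _ _ sc].
    split=> X; [by case=> [|[i []]]|by case=> [|[i []]]| |]; by move=> h;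
      apply: ext_incl; left.
  have [dS tp _ _ _] := F_stages_spec artL envJ ce be tpz FS.
  have := proj1 (stage_choiceP artL envJ ce be D dS tp) sc.
  have lt_rcons i : (i < size (rcons S D))%N -> (i < size S)%N \/ i = size S.
    by rewrite size_rcons ltnS leq_eqVlt => /orP[/eqP|]; [right|left].
  have old i : (i < size S)%N -> [/\ (i < size (rcons S D))%N,
      take i (rcons S D) = take i S & nth set0 (rcons S D) i = nth set0 S i].
    by move=> iS; rewrite size_rcons ltnW // nth_rcons iS -cats1 takel_cat // ltnW.
  have new : take (size S) (rcons S D) = S /\ nth set0 (rcons S D) (size S) = D.
    by rewrite nth_rcons ltnn eqxx -cats1 take_size_cat.
  have old1 X tf0 : (exists i, [/\ (i < size S)%N,
    ~~ odd i & Gen (proj_sum e (eps e (take i S)) (nth set0 S i)) X]) ->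
      G_gen1 (rcons S D) tf0 X.
    by case=> i [iS oi h]; right; exists i; have [-> -> ->] := old i iS.
  have old2 X tf0 : (exists i, [/\ (i < size S)%N,
    odd i & Cogen (inj_sum J e (eps e (take i S)) (nth set0 S i)) X]) ->
      G_gen2 (rcons S D) tf0 X.
    by case=> i [iS oi h]; right; exists i; have [-> -> ->] := old i iS.
  move: tp sub1 sub2 sup1 sup2; rewrite /stage_next (eps_cov e dS);
    case: tf {FS sc} => T F tp.
  case: (boolP (odd (size S))) => /= oS sub1 sub2 sup1 sup2 hD.
    split=> X.
    - case=> [TX|[i [/lt_rcons[iS|->] oi]]]; first by apply: sub1; left.
        by have [_ -> ->] := old i iS => h; apply: sub1; right; exists i.
      by rewrite oS in oi.
    - case=> [[FX _]|[i [/lt_rcons[iS|->] oi]]]; first by apply: sub2; left.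
        by have [_ -> ->] := old i iS => h; apply: sub2; right; exists i.
      case: new => -> ->; rewrite (eps_cov e dS) => h; apply: sub2; left.
      by apply: (Cogen_torsion_free artL envJ ce tp _ h) => k /hD[].
    - move=> /sup1; apply: ext_closure_sub => Y [TY|/old1 h]; last exact: ext_incl.
      by apply: ext_incl; left.
    move=> /sup2; apply: ext_closure_sub => Y [FY|/old2 h]; last exact: ext_incl.
    have [X' [Z [E FX' CZ]]] := torsion_free_split artL envJ ce D tp FY.
    apply: (ext_ext _ _ E); apply: ext_incl; first by left.
    right; exists (size S); case: new => -> ->; rewrite size_rcons ltnSn oS.
    by rewrite (eps_cov e dS).
  split=> X.
  - case=> [[TX _]|[i [/lt_rcons[iS|->] oi]]]; first by apply: sub1; left.
      by have [_ -> ->] := old i iS => h; apply: sub1; right; exists i.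
    case: new => -> ->; rewrite (eps_cov e dS) => h; apply: sub1; left.
    by apply: (Gen_torsion ce tp _ h) => k /hD[].
  - case=> [FX|[i [/lt_rcons[iS|->] oi]]]; first by apply: sub2; left.
      by have [_ -> ->] := old i iS => h; apply: sub2; right; exists i.
    by rewrite oi in oS.
  - move=> /sup1; apply: ext_closure_sub => Y [TY|/old1 h]; last exact: ext_incl.
    have [X' [Z [E GX' TZ]]] := torsion_split artL envJ ce D tp TY.
    apply: (ext_ext _ _ E); apply: ext_incl; last by left.
    right; exists (size S); case: new => -> ->; rewrite size_rcons ltnSn oS.
    by rewrite (eps_cov e dS).
  move=> /sup2; apply: ext_closure_sub => Y [FY|/old2 h]; last exact: ext_incl.
  by apply: ext_incl; left.
have Mod0 X : Mod (0 : L) X.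
  move=> a m /asboolP[n [b [c ->]]]; rewrite big1 ?scale0r // => i _.
  by rewrite mulr0 mul0r.
case: tfz tpz sub1 sub2 sup1 sup2 => T F tpz /= sub1 sub2 sup1 sup2.
congr pair; apply: funext => X; apply/propext; split.
- exact: sup1.
- by apply: ext_closure_min => // Z M Y E; apply: (torsion_ext tpz E).
- exact: sup2.
- by apply: ext_closure_min => // Z M Y E; apply: (torsion_free_ext tpz E).
Qed.

End Inverse.

Lemma sval_inj (T : Type) (P : T -> Prop) (u v : {x | P x}) : sval u = sval v -> u = v.
Proof. by case: u v => [u p] [v q] /= E; apply: eq_exist. Qed.

Theorem theorem3p11 (R : comNzRingType) (L : algType R) (J : lmodType R)
    (I : finType) (e : I -> L) :
  artin_algebra L ->
  injective_envelope (semisimple_quotient R) J ->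
  complete_primitive_orthogonal e ->
  basic_idempotents e ->
  exists (F : setM L -> setN e) (G : setN e -> setM L),
    [/\ forall (x : setM L) (y : seq {set I} * subcat_pair L),
          F_graph J e (sval x) y <-> y = sval (F x),
        forall y : setN e, sval (G y) = G_map J e (sval y),
        cancel F G &
        cancel G F].
Proof.
move=> artL envJ ce be.
have [F FP] : {F : setM L -> setN e & forall x, F_graph J e (sval x) (sval (F x))}.
  apply: (@choice _ _ (fun x z => F_graph J e (sval x) (sval z))) => -[tf tp].
  have [y Gy] := F_graph_exists artL envJ ce be tp.
  by exists (exist _ y (F_graph_type1 artL envJ ce be tp Gy)).
have Guniq (x : setM L) y : F_graph J e (sval x) y <-> y = sval (F x).
  split=> [Gy|->]; last exact: FP.
  exact: (F_graph_unique artL envJ ce be (svalP x) Gy (FP x)).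
have GE (x : setM L) y : F_graph J e (sval x) y -> sval x = G_map J e y.
  by case: y => S tf [_ FS _]; apply: (F_stages_G artL envJ ce be (svalP x) FS).
(* [G] is chosen as a preimage under [F]; [GE] shows that it is given by the formula, and also that
   [F] determines its argument. *)
have [G GP] : {G : setN e -> setM L & forall y, F_graph J e (sval (G y)) (sval y)}.
  apply: (@choice _ _ (fun y x => F_graph J e (sval x) (sval y))) => -[[S tf] [t1 E]].
  have [tfz tpz Gz] := F_stages_backward artL envJ ce be t1 E.
  by exists (exist _ tfz tpz).
exists F, G; split=> // [y|x|y]; first exact: GE.
  by apply: sval_inj; rewrite (GE _ _ (GP _)) -(GE _ _ (FP x)).
by apply: sval_inj; apply/esym/Guniq.
Qed.
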